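(* Consider the linear model described in the context, with $n,p\to\infty$, $n/p\to\delta\in(0,\infty)$. Define $\gamma(q)=\delta/(q+\sigma^2)$ for $q\ge0$, and fix any constant $\iota>0$. Then there exists $\epsilon=\epsilon(\iota,\delta,\sigma^2)>0$ such that the following holds: for any compact set $K\subset[0,\infty)\times[0,\infty)$ satisfying $\sup_{(q,r)\in K}|q-r|\le\epsilon$, with probability approaching $1$ as $n,p\to\infty$, $$\inf_{(m,s)\in\Gamma^p[K]}\frac1p\mathcal F_{\mathrm{TAP}}(m,s)\ \ge\ \inf_{(q,r)\in K}\phi(\gamma(q))-\iota .$$
   Context: Model: $y=X\beta_0+\varepsilon\in\mathbb R^n$, where $X\in\mathbb R^{n\times p}$, $\beta_0\in\mathbb R^p$, $\varepsilon\in\mathbb R^n$ are independent with i.i.d. entries $x_{ij}\sim N(0,1/p)$, $\beta_{0,j}\sim\mathsf P_0$, $\varepsilon_i\sim N(0,\sigma^2)$, $\sigma^2>0$. $\mathsf P_0$ is a probability law on $\mathbb R$ with compact support containing at least three distinct values; $(\sigma^2,\delta,\mathsf P_0)$ are fixed independently of $n,p$. Exponential family: for $(\lambda,\gamma)\in\mathbb R^2$ let $\mathsf P_{\lambda,\gamma}(d\beta)\propto e^{-(\gamma/2)\beta^2+\lambda\beta}\mathsf P_0(d\beta)$ and $\langle f(\beta)\rangle_{\lambda,\gamma}=\int f\,d\mathsf P_{\lambda,\gamma}$. $\Gamma=\{(\langle\beta\rangle_{\lambda,\gamma},\langle\beta^2\rangle_{\lambda,\gamma}):(\lambda,\gamma)\in\mathbb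 R^2\}$. Let $-\mathsf h(m,s)=\sup_{(\lambda,\gamma)\in\mathbb R^2}\{-\tfrac12\gamma s+\lambda m-\log\mathbb E_{\beta\sim\mathsf P_0}[e^{-(\gamma/2)\beta^2+\lambda\beta}]\}$. TAP free energy on $\Gamma^p$: with $D_0(m,s)=\sum_j-\mathsf h(m_j,s_j)$, $S(s)=\frac1p\sum_js_j$, $Q(m)=\frac1p\sum_jm_j^2$, $$\mathcal F_{\mathrm{TAP}}(m,s)=\tfrac n2\log2\pi\sigma^2+D_0(m,s)+\tfrac1{2\sigma^2}\|y-Xm\|_2^2+\tfrac n2\log\Big(1+\tfrac{S(s)-Q(m)}{\sigma^2}\Big).$$ For $K\subseteq[0,\infty)^2$, $$\Gamma^p[K]=\Big\{(m,s)\in\Gamma^p:\Big(\tfrac1p\sum_{j=1}^p(m_j-\beta_{0,j})^2,\ \tfrac1p\sum_{j=1}^p(s_j-m_j^2)\Big)\in K\Big\}.$$ An infimum over an empty set is $+\infty$. Replica-symmetric potential: $\phi(\gamma)=\frac{\sigma^2\gamma}2-\frac\delta2\log\frac\gamma{2\pi\delta}+i(\gamma)$ for $\gamma>0$, where $i(\gamma)$ is the mutual information (nats) between $\beta_0\sim\mathsf P_0$ and $\gamma\beta_0+\sqrt\gamma z$, $z\sim N(0,1)$ independent of $\beta_0$. *)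

(* Defs.v *)
From HB Require Import structures.
From mathcomp Require Import all_boot all_order all_algebra.
From mathcomp Require Import all_classical all_reals all_analysis.

Set Implicit Arguments.
Unset Strict Implicit.
Unset Printing Implicit Defensive.

Import Order.TTheory GRing.Theory Num.Theory.
Import numFieldNormedType.Exports.

Local Open Scope classical_set_scope.
Local Open Scope ring_scope.

Section support.
Context {R : realType}.

Definition measure_support (P : probability (measurableTypeR R) R) : set R :=
  [set x | forall U : set R, open U -> U x -> (0 < P U)%E].

End support.

Section independence.
Context d (Om : measurableType d) (R : realType) (P : probability Om R).

(* Taking A i = setT outside a subset of I gives the product rule for every
   subfamily. *)
Definition mutually_independent (I : finType) (Z : I -> Om -> R) : Prop :=
  forall A : I -> set (measurableTypeR R), (forall i, measurable (A i)) ->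
    P (\bigcap_(i in [set: I]) (Z i @^-1` A i)) =
    (\prod_(i : I) P (Z i @^-1` A i))%E.

End independence.

Section with_high_probability.
Context {R : realType} {d : nat -> measure_display}
  {Om : forall k, measurableType (d k)} (P : forall k, probability (Om k) R).

(* An event defined by an infimum over an uncountable set is not visibly
   measurable, and a measure has no meaningful value outside the
   sigma-algebra; hence the inner approximation. For measurable E this is
   P k (E k) --> 1, see whpE. *)
Definition whp (E : forall k, set (Om k)) : Prop :=
  exists A : forall k, set (Om k),
    (forall k, measurable (A k) /\ A k `<=` E k) /\
    P k (A k) @[k --> \oo] --> 1%E.

Lemma whpE (E : forall k, set (Om k)) : (forall k, measurable (E k)) ->
  whp E <-> P k (E k) @[k --> \oo] --> 1%E.
Proof.
move=> mE; split=> [[A [AE A1]]|E1]; last first.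
  by exists E; split => // k; split.
apply: (squeeze_cvge _ A1 (cvg_cst 1%E)).
near=> k; have [mA sAE] := AE k; rewrite probability_le1 ?andbT//.
by apply: le_measure => //; rewrite inE.
Unshelve. all: by end_near. Qed.

End with_high_probability.

Section mutual_information.
Local Open Scope ereal_scope.
Local Open Scope charge_scope.

(* The derivative is positive P-almost everywhere; lne 0 = -oo only occurs on
   a P-null set. *)
Definition kl_divergence d (T : measurableType d) (R : realType)
    (P Q : probability T R) : \bar R :=
  if `[< P `<< Q >]
  then \int[P]_x lne (('d (charge_of_finite_measure P) '/d Q) x)
  else +oo.

Context d1 d2 d3 (Om : measurableType d1) (T1 : measurableType d2)
  (T2 : measurableType d3) (R : realType) (P : probability Om R).

Definition rv_pair (X : {RV P >-> T1}) (Y : {RV P >-> T2}) (w : Om) : T1 * T2 :=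
  (X w, Y w).

Lemma measurable_rv_pair X Y : measurable_fun setT (rv_pair X Y).
Proof. by apply/measurable_fun_pairP; split; exact: measurable_funPT. Qed.

HB.instance Definition _ (X : {RV P >-> T1}) (Y : {RV P >-> T2}) :=
  isMeasurableFun.Build _ _ _ _ (rv_pair X Y) (measurable_rv_pair X Y).

Definition mutual_info (X : {RV P >-> T1}) (Y : {RV P >-> T2}) : \bar R :=
  kl_divergence (distribution P (rv_pair X Y))
                (distribution P X \x distribution P Y).

End mutual_information.

Section gaussian_channel.
Context {R : realType} (P0 : probability (measurableTypeR R) R).

Definition channel_prob :
    probability (measurableTypeR R * measurableTypeR R)%type R :=
  (P0 \x normal_prob 0 1)%E.

Definition channel_input (bz : measurableTypeR R * measurableTypeR R) :
  measurableTypeR R := bz.1.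

Definition channel_output (g : R) (bz : measurableTypeR R * measurableTypeR R) :
  measurableTypeR R := g * bz.1 + Num.sqrt g * bz.2.

Lemma measurable_channel_input : measurable_fun setT channel_input.
Proof. exact: measurable_fst. Qed.

Lemma measurable_channel_output g : measurable_fun setT (channel_output g).
Proof.
apply: measurable_realfun.measurable_funD;
  exact: measurable_realfun.measurable_funM.
Qed.

HB.instance Definition _ :=
  isMeasurableFun.Build _ _ _ _ channel_input measurable_channel_input.
HB.instance Definition _ g :=
  isMeasurableFun.Build _ _ _ _ (channel_output g)
    (measurable_channel_output g).

Definition channel_mutual_info (g : R) : \bar R :=
  mutual_info (channel_input : {RV channel_prob >-> measurableTypeR R})
              (channel_output g : {RV channel_prob >-> measurableTypeR R}).

Definition rs_potential (delta s2 g : R) : \bar R :=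
  ((s2 * g / 2 - delta / 2 * ln (g / (2 * pi * delta)))%:E
   + channel_mutual_info g)%E.

End gaussian_channel.

Section tap.
Context {R : realType} (P0 : probability (measurableTypeR R) R).

Definition tilt (l g b : R) : R := expR (- (g / 2) * b ^+ 2 + l * b).

(* Real-valued integrals: when P0 has compact support the integrands are
   P0-essentially bounded, so that no value is lost by \int[_]_ in R. *)
Definition partition_fun (l g : R) : R := \int[P0]_b tilt l g b.

Definition bracket (f : R -> R) (l g : R) : R :=
  (\int[P0]_b (f b * tilt l g b)) / partition_fun l g.

Definition moment_set : set (R * R) :=
  [set (bracket (fun b => b) lg.1 lg.2, bracket (fun b => b ^+ 2) lg.1 lg.2)
    | lg in [set: R * R]].

(* The supremum itself, that is -h and not h. It is taken in \bar R, where it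
   never needs a default value; it is finite on moment_set. *)
Definition neg_entropy (m s : R) : \bar R :=
  ereal_sup [set (- (1 / 2) * lg.2 * s + lg.1 * m
                  - ln (partition_fun lg.1 lg.2))%:E | lg in [set: R * R]].

(* \bar R-valued only because neg_entropy is. *)
Definition tap_free_energy (s2 : R) (n p : nat) (X : 'M[R]_(n, p))
    (y : 'cV[R]_n) (m s : 'cV[R]_p) : \bar R :=
  let S := p%:R^-1 * \sum_j s j ord0 in
  let Q := p%:R^-1 * \sum_j (m j ord0) ^+ 2 in
  ((n%:R / 2 * ln (2 * pi * s2))%:E
   + \sum_j neg_entropy (m j ord0) (s j ord0)
   + (1 / (2 * s2) * \sum_i ((y - X *m m) i ord0) ^+ 2)%:E
   + (n%:R / 2 * ln (1 + (S - Q) / s2))%:E)%E.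

Definition tap_domain (p : nat) (beta0 : 'cV[R]_p) (K : set (R * R)) :
    set ('cV[R]_p * 'cV[R]_p) :=
  [set ms : 'cV[R]_p * 'cV[R]_p |
    (forall j, moment_set (ms.1 j ord0, ms.2 j ord0)) /\
    K (p%:R^-1 * \sum_j (ms.1 j ord0 - beta0 j ord0) ^+ 2,
       p%:R^-1 * \sum_j (ms.2 j ord0 - (ms.1 j ord0) ^+ 2))].

End tap.

Section linear_model.
Context {R : realType} {d} {Om : measurableType d} (P : probability Om R).
Context (n p : nat) (P0 : probability (measurableTypeR R) R) (s2 : R).
Context (x : 'I_n -> 'I_p -> {RV P >-> measurableTypeR R})
        (beta0 : 'I_p -> {RV P >-> measurableTypeR R})
        (eps : 'I_n -> {RV P >-> measurableTypeR R}).

Definition model_entries (k : 'I_n * 'I_p + 'I_p + 'I_n) : Om -> R :=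
  match k with
  | inl (inl ij) => x ij.1 ij.2
  | inl (inr j) => beta0 j
  | inr i => eps i
  end.

(* The second parameter of normal_prob is the standard deviation. *)
Record gaussian_linear_model : Prop := {
  design_law : forall i j A, measurable A ->
    distribution P (x i j) A = normal_prob 0 (Num.sqrt (p%:R^-1)) A ;
  signal_law : forall j A, measurable A ->
    distribution P (beta0 j) A = P0 A ;
  noise_law : forall i A, measurable A ->
    distribution P (eps i) A = normal_prob 0 (Num.sqrt s2) A ;
  entries_independent : mutually_independent P model_entries }.

Definition design (w : Om) : 'M[R]_(n, p) := \matrix_(i, j) x i j w.
Definition signal (w : Om) : 'cV[R]_p := \col_j beta0 j w.
Definition noise (w : Om) : 'cV[R]_n := \col_i eps i w.
Definition response (w : Om) : 'cV[R]_n :=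
  design w *m signal w + noise w.

End linear_model.

(* Main.v *)
Require Import Defs.
From HB Require Import structures.
From mathcomp Require Import all_boot all_order all_algebra.
From mathcomp Require Import all_classical all_reals all_analysis.
From mathcomp Require Import measurable_realfun ring lra.

(** Fix [gam = delta / (q + s2)].  Replacing each entropy by its conjugate at the
    second parameter [gam] and [|a|^2 / (2 s2)] by its tangent [w |a| - w^2 s2 / 2]
    at slope [w = sqrt (gam p)], the TAP free energy dominates an energy of the
    form [w |G v| + psi(v)], where [G] is a standard Gaussian matrix, [v] collects
    [(beta0 - m) / sqrt p] and the noise level, and a penalty confines
    [|m - beta0|^2 / p] to a neighbourhood of [q].  Gordon's comparison inequality
    (interpolation and Gaussian integration by parts) bounds the lower tail of the
    minimal energy, uniformly over finite sets of points, hence over a countable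
    dense set, by that of the decoupled form [w (|v| |g| + <h, v>) + psi(v)].  The
    latter is at least [sqrt (delta p n) - gam p q / 2] plus a sum of [p] i.i.d.
    information densities of the scalar channel with signal-to-noise ratio [gam],
    whose mean is the mutual information; an exponential Markov inequality makes
    the deviation probability exponentially small.  Letting [q] run through a
    finite net of the compact set [K] gives the bound, the loss
    [delta / 2 ln ((s2 + r) / (s2 + q)) + gam (q - r) / 2] being of the order of
    [|q - r| delta / s2]. *)

Set Implicit Arguments.
Unset Strict Implicit.
Unset Printing Implicit Defensive.

Import Order.TTheory GRing.Theory Num.Theory.
Import numFieldNormedType.Exports.

Local Open Scope classical_set_scope.
Local Open Scope ring_scope.

(** * Gaussian measures *)

(** The entropies are suprema, possibly infinite and only lower semicontinuous in [m], so their
    values on a countable dense set of [m] would not control them. The energy is therefore a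
    function of a pair [(m, H)], where [H] is a free upper bound of the conjugates: it is continuous
    in the pair, and its bad event becomes a countable union, hence measurable. The vectors [v]
    depend on the signal, so Gordon's inequality is applied for each fixed signal and then
    integrated. It is used for events, with a constant that does not see the number of points; the
    extra scalar Gaussian of the comparison is removed by restricting to its being nonpositive, a
    constant factor that is harmless against an exponentially small probability. The smoothing [tau]
    keeps the norm differentiable; it may be of order p and still cost only a fraction of [iota] per
    coordinate. The parameters are tuned to [q] whereas [m] is arbitrary: the penalty makes up for
    the mismatch, and being of order p it costs little on a fine net. At [r = q] the leading term of
    the relaxed bound is exactly phi(gamma(q)), so that the relaxation loses nothing there. *)

Section density.
Context d (T : measurableType d) (R : realType).
Variables (mu nu : {measure set T -> \bar R}) (g : T -> R).
Hypothesis mg : measurable_fun setT g.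
Hypothesis g0 : forall x, 0 <= g x.
Hypothesis nuE : forall A, measurable A -> nu A = (\int[mu]_(x in A) (g x)%:E)%E.
Local Open Scope ereal_scope.
Import HBNNSimple.

(** Both sides are limits along the same increasing simple functions, and for a simple function the
    identity is [nuE] on each level set. *)
Lemma ge0_integral_density (f : T -> \bar R) : measurable_fun setT f ->
  (forall x, 0 <= f x) -> \int[nu]_x f x = \int[mu]_x (f x * (g x)%:E).
Proof.
move=> mf f0.
pose h := nnsfun_approx measurableT mf.
have hf x : setT x -> (EFin \o h n) x @[n --> \oo] --> f x.
  by move=> _; exact: cvg_nnsfun_approx.
have -> : \int[nu]_x f x = lim (\int[nu]_x (EFin \o h n) x @[n --> \oo]).
  under eq_integral do rewrite -(cvg_lim _ (hf _ I))//.
  apply: monotone_convergence => //.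
  - by move=> n; exact/measurable_EFinP.
  - by move=> n x Ex //=; rewrite lee_fin.
  - by move=> x Ex a b ab; rewrite lee_fin; exact/lefP/nd_nnsfun_approx.
have -> : \int[mu]_x (f x * (g x)%:E) =
    lim (\int[mu]_x ((EFin \o h n) x * (g x)%:E) @[n --> \oo]).
  have fg x : f x * (g x)%:E = lim (((EFin \o h n) x * (g x)%:E) @[n --> \oo]).
    by apply/esym/cvg_lim => //; apply: cvgeZr => //; exact: cvg_nnsfun_approx.
  under eq_integral do rewrite fg.
  apply: monotone_convergence => [//| | |].
  - by move=> n; apply/measurable_EFinP; exact: measurable_funM.
  - by move=> n x Ex /=; rewrite mule_ge0 ?lee_fin ?g0.
  - by move=> x Ex a b ab/=; rewrite lee_wpmul2r ?lee_fin ?g0//; exact/lefP/nd_nnsfun_approx.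
suff suf n : \int[mu]_x ((EFin \o h n) x * (g x)%:E) = \int[nu]_x (EFin \o h n) x.
  by under [in RHS]eq_fun do rewrite suf.
transitivity (\int[nu]_x
   (\sum_(y \in range (h n)) (y * \1_(h n @^-1` [set y]) x)%:E)); last first.
  by apply: eq_integral => t tE; rewrite /= fimfunE -fsumEFin.
have indich m r : measurable_fun setT (fun x => (r * \1_(h m @^-1` [set r]) x)%:E).
  by apply: (measurable_comp measurableT) => //; exact: measurable_funM.
rewrite ge0_integral_fsum//; last by move=> m y Ey; exact: nnfun_muleindic_ge0.
transitivity (\int[mu]_x (\sum_(y \in range (h n))
    (y * \1_(h n @^-1` [set y]) x)%:E * (g x)%:E)).
  under [RHS]eq_integral => x xE.
    rewrite -ge0_mule_fsuml => [|y]; last exact: nnfun_muleindic_ge0.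
    rewrite fsumEFin // -(fimfunE _ x); over.
  by [].
have mgE : measurable_fun setT (EFin \o g) by exact/measurable_EFinP.
rewrite ge0_integral_fsum//; last 2 first.
  - by move=> y; apply: emeasurable_funM.
  - move=> m y Ey; apply: mule_ge0; last by rewrite lee_fin.
    by rewrite EFinM; exact: nnfun_muleindic_ge0.
apply: eq_fsbigr => r rhn.
under [RHS]eq_integral do rewrite EFinM.
rewrite integralZl_indic_nnsfun => //.
under eq_integral do rewrite EFinM -muleA.
rewrite ge0_integralZl//.
- congr (_ * _); rewrite integral_indic// setIT nuE// [RHS]integral_mkcond.
  apply: eq_integral => x _; rewrite /= /patch indicE; case: (x \in _).
    by rewrite mul1e.
  by rewrite mul0e.
- by apply: emeasurable_funM => //; exact/measurable_EFinP.
- by move=> x _; rewrite mule_ge0 ?lee_fin.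
- by move: rhn; rewrite inE /= => -[x _ <-]; rewrite lee_fin.
Qed.

(** Multiplication by the nonnegative [g x] commutes with taking positive and negative parts. *)
Lemma integral_density (f : T -> \bar R) : measurable_fun setT f ->
  \int[nu]_x f x = \int[mu]_x (f x * (g x)%:E).
Proof.
move=> mf; rewrite [LHS]integralE [RHS]integralE.
have posM (a : \bar R) b : (0 <= b)%R -> maxe (a * b%:E) 0 = maxe a 0 * b%:E.
  by move=> b0; rewrite ![_ * b%:E]muleC maxe_pMr// mule0.
rewrite (ge0_integral_density (measurable_funepos mf)) ?(ge0_integral_density (measurable_funeneg mf))//.
congr (_ - _); apply: eq_integral => x _.
- by rewrite !funeposE posM.
- by rewrite !funenegE -mulNe posM.
Qed.

End density.

Definition image_measure d1 d2 (T1 : measurableType d1) (T2 : measurableType d2)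
    (R : realType) (mu : {measure set T1 -> \bar R}) (f : T1 -> T2)
    (mf : measurable_fun setT f) : {measure set T2 -> \bar R} :=
  measure_function_pushforward__canonical__measure_function_Measure mu mf.

Section normal.
Context {R : realType}.
Local Notation mu := (@lebesgue_measure R).
Local Notation N := (normal_prob (0 : R) 1).
Implicit Types (f : measurableTypeR R -> \bar R).

Lemma ge0_integral_normal_prob (m s : R) f : measurable_fun setT f ->
  (forall x, 0 <= f x)%E ->
  (\int[normal_prob m s]_x f x = \int[mu]_x (f x * (normal_pdf m s x)%:E))%E.
Proof.
move=> mf f0; apply: ge0_integral_density => //.
  exact: measurable_normal_pdf.
by move=> x; exact: normal_pdf_ge0.
Qed.

Lemma normal_peakE (s : R) : 0 < s -> normal_peak s = (s * Num.sqrt (pi *+ 2))^-1.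
Proof.
by move=> s0; rewrite /normal_peak -mulrnAr sqrtrM ?sqr_ge0// sqrtr_sqr gtr0_norm.
Qed.

Lemma normal_pdf1E (m x : R) :
  normal_pdf m 1 x = normal_peak 1 * expR (- (x - m) ^+ 2 / 2).
Proof. by rewrite normal_pdfE ?oner_neq0// /normal_fun expr1n. Qed.

(** Completing the square: an exponential tilt of the standard normal law is a shift of its mean.
    The moment generating function and the law of the channel output both come from it. *)
Lemma ge0_integral_normal_tilt (s : R) f : measurable_fun setT f ->
  (forall x, 0 <= f x)%E ->
  (\int[N]_x (f x * (expR (s * x))%:E) =
   (expR (s ^+ 2 / 2))%:E * \int[normal_prob s 1]_x f x)%E.
Proof.
move=> mf f0.
have me : measurable_fun setT (fun x : measurableTypeR R => (expR (s * x))%:E).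
  by apply/measurable_EFinP; apply: measurableT_comp => //; exact: measurable_funM.
rewrite !ge0_integral_normal_prob//; last 2 first.
- exact: emeasurable_funM.
- by move=> x; rewrite mule_ge0// lee_fin expR_ge0.
rewrite -ge0_integralZl//; last 2 first.
- apply: emeasurable_funM => //; apply/measurable_EFinP; exact: measurable_normal_pdf.
- by move=> x _; rewrite mule_ge0// lee_fin normal_pdf_ge0.
apply: eq_integral => x _.
rewrite muleCA -muleA -!EFinM; congr (_ * _%:E)%E.
rewrite !normal_pdf1E mulrCA [RHS]mulrCA -!expRD; congr (_ * expR _); lra.
Qed.

Lemma normal_mgf (s : R) :
  (\int[N]_x (expR (s * x))%:E = (expR (s ^+ 2 / 2))%:E)%E.
Proof.
have := @ge0_integral_normal_tilt s (cst 1%E).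
under eq_integral do rewrite mul1e.
move=> ->//; rewrite integral_cst//= mul1e.
by rewrite (_ : normal_prob s 1 setT = 1%E) ?mule1// probability_setT.
Qed.

(** The rescaled image of Lebesgue measure under the affine map gives half-open intervals their
    length, so it is Lebesgue measure by uniqueness. *)
Lemma ge0_integral_affine (a b : R) f : 0 < a -> measurable_fun setT f ->
  (forall x, 0 <= f x)%E ->
  (\int[mu]_x f (a * x + b)%R = (a^-1)%:E * \int[mu]_x f x)%E.
Proof.
move=> a0 mf f0.
pose phi (x : measurableTypeR R) : measurableTypeR R := a * x + b.
have mphi : measurable_fun setT phi.
  by apply: measurable_funD => //; exact: measurable_funM.
pose nu := mscale (NngNum (ltW a0)) (image_measure mu mphi).
have nuE A : measurable A -> mu A = nu A.
  apply: lebesgue_measure_unique => _ [[u v]] _ <-.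
  change (mu `]u, v] = a%:E * mu (phi @^-1` `]u, v]))%E.
  have -> : phi @^-1` `]u, v] = `](u - b) / a, (v - b) / a]%classic.
    apply/seteqP; split => x /=; rewrite !in_itv/= /phi;
    by rewrite ltr_pdivrMr// ler_pdivlMr// ltrBlDr lerBrDr (mulrC x).
  rewrite !lebesgue_measure_itv/= !lte_fin ltr_pM2r ?invr_gt0// ltrD2r.
  case: ifPn => _; last by rewrite mule0.
  rewrite -!EFinD -EFinM; congr EFin.
  by field; rewrite gt_eqF.
have -> : (\int[mu]_x f x = \int[nu]_x f x)%E.
  by apply: eq_measure_integral => A mA _; exact: nuE.
rewrite ge0_integral_mscale//= muleA -EFinM mulVf ?gt_eqF// mul1e.
by rewrite ge0_integral_pushforward// => x _.
Qed.

Lemma ge0_integral_normal_affine (m s : R) f : 0 < s -> measurable_fun setT f ->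
  (forall x, 0 <= f x)%E ->
  (\int[N]_x f (m + s * x)%R = \int[normal_prob m s]_x f x)%E.
Proof.
move=> s0 mf f0.
have mphi : measurable_fun setT (fun x : measurableTypeR R => f (m + s * x)).
  apply: measurableT_comp => //; apply: measurable_funD => //; exact: measurable_funM.
rewrite (ge0_integral_normal_prob 0 1 mphi) => [|x]; last exact: f0.
rewrite (ge0_integral_normal_prob m s mf f0).
have := @ge0_integral_affine s m (fun x => f x * (s * normal_pdf m s x)%:E)%E s0.
move=> H.
(* The factor [s] placed in the integrand cancels the Jacobian [s^-1] of the substitution. *)
transitivity (\int[mu]_x (fun x => f x * (s * normal_pdf m s x)%:E)%E (s * x + m)%R)%E.
  apply: eq_integral => x _ /=; rewrite addrC; congr (_ * _%:E)%E.
  rewrite normal_pdf1E normal_pdfE ?gt_eqF// /normal_fun addrK subr0 mulrA.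
  congr (_ * expR _).
    by rewrite !normal_peakE// mul1r invfM mulrA divff ?gt_eqF// mul1r.
  by field; rewrite gt_eqF.
rewrite H; first last.
- by move=> x; rewrite mule_ge0// lee_fin mulr_ge0 ?normal_pdf_ge0// ltW.
- apply: emeasurable_funM => //; apply/measurable_EFinP; apply: measurable_funM => //.
  exact: measurable_normal_pdf.
rewrite -ge0_integralZl//.
- apply: eq_integral => x _; rewrite muleCA -EFinM mulrA mulVf ?mul1r// gt_eqF//.
- apply: emeasurable_funM => //; apply/measurable_EFinP; apply: measurable_funM => //.
  exact: measurable_normal_pdf.
- by move=> x _; rewrite mule_ge0// lee_fin mulr_ge0 ?normal_pdf_ge0// ltW.
- by rewrite lee_fin invr_ge0 ltW.
Qed.

End normal.

Section stein.
Context {R : realType}.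
Local Notation mu := (@lebesgue_measure R).
Local Notation N := (normal_prob (0 : R) 1).
Local Notation phi := (normal_pdf (0 : R) 1).

(** The integrand is at most [expR (c * x) + expR (- c * x)], whose integral is given by the moment
    generating function. *)
Lemma integrable_normal_expR (c : R) :
  N.-integrable setT (fun x : measurableTypeR R => (expR (c * `|x|))%:E).
Proof.
have me (s : R) : measurable_fun setT (fun x : measurableTypeR R => (expR (s * x))%:E).
  by apply/measurable_EFinP; apply: measurableT_comp => //; exact: measurable_funM.
have ma : measurable_fun setT (fun x : measurableTypeR R => (expR (c * `|x|))%:E).
  apply/measurable_EFinP; apply: measurableT_comp => //; apply: measurable_funM => //.
apply/integrableP; split => //.
apply: (@le_lt_trans _ _ (\int[N]_x ((expR (c * x))%:E + (expR (- c * x))%:E))%E).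
  apply: ge0_le_integral => //.
  - by apply: (measurableT_comp _ ma).
  - exact: emeasurable_funD.
  - move=> x _; rewrite -EFinD lee_fin ger0_norm ?expR_ge0//.
    have [x0|x0] := leP 0 x.
      by rewrite ger0_norm// lerDl expR_ge0.
    by rewrite ltr0_norm// mulrN -mulNr lerDr expR_ge0.
rewrite ge0_integralD//; try by move=> x _; rewrite lee_fin expR_ge0.
by rewrite !normal_mgf -EFinD ltry.
Qed.

Lemma integrable_normal (F : measurableTypeR R -> R) (C c : R) :
  measurable_fun setT F -> (forall x, `|F x| <= C * expR (c * `|x|)) ->
  N.-integrable setT (EFin \o F).
Proof.
move=> mF FC.
have := integrableZl measurableT C (integrable_normal_expR c).
apply: le_integrable => //; first exact/measurable_EFinP.
move=> x _ /=; rewrite lee_fin (le_trans (FC x))// ler_norm//.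
Qed.

Lemma normal_pdf_tail (C : R) (F : R -> R) :
  (forall x, `|F x| <= C * (1 + `|x|)) ->
  F n%:R * phi n%:R @[n --> \oo] --> (0 : R) /\
  F (- n%:R) * phi (- n%:R) @[n --> \oo] --> (0 : R).
Proof.
move=> FC.
have C0 : 0 <= C.
  by have := le_trans (normr_ge0 _) (FC 0); rewrite normr0 addr0 mulr1.
have K0 : 0 <= @normal_peak R 1 by exact: normal_peak_ge0.
(* Expanding [(n - 1) ^+ 2 >= 0] bounds the Gaussian factor by [expR (1/2 - n)], and
   [expR n >= (1 + n / 2) ^+ 2] beats the linear growth of [F] by one power of [n]. *)
have bnd x n : `|x| = n%:R -> `|F x * phi x| <= C * normal_peak 1 * 4 * expR (1/2) * n.+1%:R^-1.
  move=> xn; rewrite normrM [X in _ * X]ger0_norm ?normal_pdf_ge0//.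
  rewrite normal_pdf1E subr0.
  apply: (@le_trans _ _ (C * (1 + n%:R) * (normal_peak 1 * (expR (1/2) * expR (- n%:R))))).
    rewrite ler_pM//.
    - by rewrite mulr_ge0// expR_ge0.
    - by have := FC x; rewrite xn.
    - rewrite ler_wpM2l// -expRD ler_expR -(real_normK (num_real x)) xn.
      have : 0 <= (n%:R - 1 : R) ^+ 2 by exact: sqr_ge0.
      nra.
  rewrite expRN.
  have e2 : (1 + n%:R / 2) ^+ 2 <= expR n%:R :> R.
    rewrite [in leRHS](_ : n%:R = n%:R / 2 + n%:R / 2 :> R); last by field.
    by rewrite expRD -expr2 ler_pXn2r ?nnegrE ?expR_ge0 ?expR_ge1Dx// addr_ge0// divr_ge0.
  have n0 : 0 <= n%:R :> R by [].
  have e3 : (1 + n%:R) * (1 + n%:R) <= 4 * expR n%:R :> R by nra.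
  have e4 : (1 + n%:R) * (expR n%:R)^-1 <= 4 * n.+1%:R^-1 :> R.
    rewrite ler_pdivrMr ?expR_gt0// mulrAC ler_pdivlMr//.
    by rewrite -natr1 (addrC n%:R 1).
  rewrite [leLHS](_ : _ = (C * normal_peak 1 * expR (1/2)) * ((1 + n%:R) * (expR n%:R)^-1)); last by ring.
  rewrite [leRHS](_ : _ = (C * normal_peak 1 * expR (1/2)) * (4 * n.+1%:R^-1)); last by ring.
  by rewrite ler_wpM2l// !mulr_ge0// expR_ge0.
have cv : (C * normal_peak 1 * 4 * expR (1/2) * n.+1%:R^-1) @[n --> \oo] --> (0 : R).
  rewrite -[X in _ --> X](mulr0 (C * normal_peak 1 * 4 * expR (1/2))).
  by apply: cvgM; [exact: cvg_cst|exact: cvg_harmonic].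
split; apply: norm_cvg0; apply: (squeeze_cvgr _ (cvg_cst 0) cv);
  near=> n; rewrite normr_ge0/= bnd// ?normrN ger0_norm//.
Unshelve. all: by end_near. Qed.

(** Stein's identity: [(F' x - x * F x) * phi x] is the derivative of [F * phi], which vanishes at
    infinity, so its integral over the line is zero. *)
Lemma normal_ibp (F F' : R -> R) (C : R) :
  (forall x : R, is_derive x (1 : R) F (F' x)) -> continuous F' ->
  (forall x, `|F x| <= C * (1 + `|x|)) -> (forall x, `|F' x| <= C) ->
  \int[N]_x (x * F x) = \int[N]_x F' x.
Proof.
move=> dF cF' FC F'C.
have cF : continuous F.
  by move=> x; apply: differentiable_continuous; apply/derivable1_diffP; have [] := dF x.
have C0 : 0 <= C.
  by have := le_trans (normr_ge0 _) (F'C 0).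
have mF : measurable_fun setT F by exact: continuous_measurable_fun.
have mF' : measurable_fun setT F' by exact: continuous_measurable_fun.
have mid : measurable_fun setT (@id R) by exact: measurable_id.
have mxF : measurable_fun setT (fun x : measurableTypeR R => x * F x).
  exact: measurable_funM.
have xe (x : R) : 1 + `|x| <= expR (1 * `|x|) by rewrite mul1r expR_ge1Dx.
have iF' : N.-integrable setT (EFin \o F').
  apply: (@integrable_normal _ C 0) => // x.
  by rewrite mul0r expR0 mulr1.
have ixF : N.-integrable setT (EFin \o (fun x => x * F x)).
  apply: (@integrable_normal _ C 2) => // x; rewrite normrM.
  have /= := FC x; have := xe x; rewrite mul1r => h1 h2.
  have -> : expR (2 * `|x|) = expR `|x| * expR `|x| by rewrite -expRD; congr expR; ring.
  rewrite mulrCA; apply: ler_pM => //; last first.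
    by apply: (le_trans h2); rewrite ler_wpM2l.
  by apply: le_trans h1; rewrite lerDr.
apply/eqP; rewrite eq_sym -subr_eq0 -RintegralB//; apply/eqP.
pose h x := F' x * phi x - x * F x * phi x.
have cphi : continuous (phi : R -> R) by apply: continuous_normal_pdf; rewrite oner_neq0.
have ch : continuous h.
  move=> x; apply: cvgB; apply: cvgM.
  - exact: cF'.
  - exact: cphi.
  - by apply: cvgM; [exact: cvg_id|exact: cF].
  - exact: cphi.
have dphi (x : R) : is_derive x (1 : R) phi (- x * phi x).
  have -> : phi = (fun x => normal_peak 1 * expR (- x ^+ 2 / 2)).
    by apply/funext => y; rewrite normal_pdf1E subr0.
  by apply: is_derive_eq; rewrite /GRing.scale/=; field.
have dG (x : R) : is_derive x (1 : R) (fun x => F x * phi x) (h x).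
  by apply: is_derive_eq; rewrite /GRing.scale/= /h; ring.
have cG : continuous (fun x => F x * phi x).
  by move=> x; apply: cvgM; [exact: cF|exact: cphi].
have mh : measurable_fun setT h by exact: continuous_measurable_fun.
have ih : mu.-integrable setT (EFin \o h).
  apply/integrableP; split; first exact/measurable_EFinP.
  have : N.-integrable setT (EFin \o (fun x => F' x - x * F x)).
    by apply: eq_integrable (integrableB measurableT iF' ixF) => // x _.
  move=> /integrableP[_]; apply: le_lt_trans.
  rewrite ge0_integral_normal_prob//; last first.
    apply: measurableT_comp => //; apply/measurable_EFinP.
    exact: measurable_funB.
  apply: ge0_le_integral => //.
  - by apply: measurableT_comp => //; exact/measurable_EFinP.
  - apply: emeasurable_funM; last by apply/measurable_EFinP; exact: measurable_normal_pdf.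
    apply: measurableT_comp => //; apply/measurable_EFinP.
    exact: measurable_funB.
  - move=> x _ /=; rewrite -EFinM lee_fin /h -mulrBl normrM.
    by rewrite (ger0_norm (normal_pdf_ge0 _ _ _)).
have I0 : (\int[mu]_x (h x)%:E = 0)%E.
  (* Starting at [n.+1] keeps the intervals nondegenerate, as the fundamental theorem of calculus
     demands. *)
  pose A n : set R := `[- n.+1%:R, n.+1%:R]%classic.
  have m1 n : measurable_fun setT ((EFin \o h) \_ (A n)).
    apply/(measurable_restrictT _ _).1; first exact: measurable_itv.
    by apply: measurable_funTS; exact/measurable_EFinP.
  have m2 : measurable_fun setT (EFin \o h) by exact/measurable_EFinP.
  have c3 : {ae mu, forall x, setT x -> ((EFin \o h) \_ (A n)) x @[n --> \oo] --> (EFin \o h) x}.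
    apply: aeW => x _; apply: cvg_near_cst; near=> n.
    rewrite patchE mem_set// /A/= in_itv/= -ler_norml.
    rewrite (le_trans (ltW (archi_boundP _)))// ler_nat.
    by near: n; exists (Num.bound `|x|) => // k /= kn; rewrite (leq_trans kn).
  have i4 : mu.-integrable setT (abse \o (EFin \o h)) by exact: integrable_abse.
  have c5 : {ae mu, forall x n, setT x -> (`|((EFin \o h) \_ (A n)) x| <= (abse \o (EFin \o h)) x)%E}.
    apply: aeW => x n _; rewrite patchE; case: ifPn => _ //=.
    by rewrite normr0 lee_fin.
  have [_ _ cv] := @dominated_convergence _ (measurableTypeR R) R mu setT measurableT
    (fun n => (EFin \o h) \_ (A n)) (EFin \o h) (abse \o (EFin \o h)) m1 m2 c3 i4 c5.
  have {}cv : (\int[mu]_(x in A n) (h x)%:E)%E @[n --> \oo] --> (\int[mu]_x (h x)%:E)%E.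
    by under eq_fun do rewrite integral_mkcond.
  have cv2 : (\int[mu]_(x in A n) (h x)%:E)%E @[n --> \oo] --> (0%:E)%E.
    have -> : (fun n => \int[mu]_(x in A n) (h x)%:E)%E =
      (fun n => (F n.+1%:R * phi n.+1%:R - F (- n.+1%:R) * phi (- n.+1%:R))%:E).
      apply/funext => n; rewrite (@continuous_FTC2 _ h (fun x => F x * phi x)).
      + by rewrite EFinB.
      + by rewrite (@lt_trans _ _ 0)// ?oppr_lt0 ltr0n.
      + exact: continuous_subspaceT.
      + split.
        * by move=> x _; have [] := dG x.
        * exact/cvg_at_right_filter/cG.
        * exact/cvg_at_left_filter/cG.
      + by move=> x _; rewrite derive1E; have [] := dG x.
    apply: cvg_EFin; first exact: nearW.
    have [t1 t2] := normal_pdf_tail FC.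
    rewrite -[X in _ --> X](subr0 0); apply: cvgB.
      by rewrite (cvg_shiftS (fun n => F n%:R * phi n%:R)).
    by rewrite (cvg_shiftS (fun n => F (- n%:R) * phi (- n%:R))).
  exact: cvg_unique cv cv2.
rewrite /Rintegral (@integral_density _ _ _ mu N phi)//.
- rewrite -[RHS]/(fine 0%E) -I0; congr fine; apply: eq_integral => x _.
  by rewrite -EFinM mulrBl.
- exact: measurable_normal_pdf.
- by move=> x; exact: normal_pdf_ge0.
- by apply/measurable_EFinP; exact: measurable_funB.
Unshelve. all: by end_near. Qed.

Lemma normal_second_moment : \int[N]_x (x * x) = 1.
Proof.
rewrite (@normal_ibp id (cst 1) 1).
- by rewrite Rintegral_cst//= mul1r probability_setT.
- by move=> x; exact: cvg_cst.
- by move=> x; rewrite mul1r lerDr.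
- by move=> x; rewrite normr1.
Qed.

End stein.

(** * Finite products of probability laws on the line *)

Section image_probability.
Context d1 d2 (T1 : measurableType d1) (T2 : measurableType d2) (R : realType).
Variables (P : probability T1 R) (f : T1 -> T2) (mf : measurable_fun setT f).

Definition image_mfun : {mfun T1 >-> T2} :=
  HB.pack f (isMeasurableFun.Build _ _ _ _ f mf).

Definition image_prob : probability T2 R := distribution P image_mfun.

Lemma image_probE A : image_prob A = P (f @^-1` A).
Proof. by []. Qed.

Lemma ge0_integral_image_prob (g : T2 -> \bar R) : measurable_fun setT g ->
  (forall y, 0 <= g y)%E -> (\int[image_prob]_y g y = \int[P]_x g (f x))%E.
Proof. by move=> mg g0; rewrite ge0_integral_distribution. Qed.

Lemma integral_image_prob (g : T2 -> \bar R) : measurable_fun setT g ->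
  P.-integrable setT (g \o f) -> (\int[image_prob]_y g y = \int[P]_x g (f x))%E.
Proof. by move=> mg ig; rewrite integral_distribution. Qed.

End image_probability.

Section tuple_product.
Context {R : realType}.
Local Notation RT := (measurableTypeR R).
Local Open Scope ereal_scope.

Lemma measurable_tcons n :
  measurable_fun setT (fun xt : RT * n.-tuple RT => [tuple of xt.1 :: xt.2]).
Proof. by apply: measurable_cons. Qed.

Fixpoint tuple_prob n : ('I_n -> probability RT R) -> probability (n.-tuple RT) R :=
  match n with
  | 0 => fun _ => dirac [tuple]
  | m.+1 => fun mu => image_prob (mu ord0 \x tuple_prob (fun i => mu (lift ord0 i)))
              (@measurable_tcons m)
  end.

Lemma tuple_prob_rect n (mu : 'I_n -> probability RT R) (A : 'I_n -> set RT) :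
  (forall i, measurable (A i)) ->
  tuple_prob mu [set t | forall i, A i (tnth t i)] = \prod_i mu i (A i).
Proof.
elim: n mu A => [|n IH] mu A mA /=.
  by rewrite big_ord0 diracE mem_set// => -[].
have -> : (fun xt : RT * n.-tuple RT => [tuple of xt.1 :: xt.2]) @^-1`
    [set t | forall i, A i (tnth t i)] =
    A ord0 `*` [set t | forall i, A (lift ord0 i) (tnth t i)].
  apply/seteqP; split => -[x t] /=.
    move=> H; split; first by have := H ord0; rewrite tnth0.
    by move=> i; have := H (lift ord0 i); rewrite tnthS.
  move=> [Hx Ht] i; have [j ->|->] := unliftP ord0 i; last by rewrite tnth0.
  by rewrite tnthS.
rewrite product_measure1E//.
  rewrite big_ord_recl; congr (_ * _).
  exact: (IH (fun i => mu (lift ord0 i)) (fun i => A (lift ord0 i)) (fun i => mA _)).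
rewrite [X in measurable X](_ : _ = \bigcap_(i in setT) (fun t => tnth t i) @^-1` A (lift ord0 i)).
  apply: fin_bigcap_measurable => // i _.
  by rewrite -[X in measurable X]setTI; exact: measurable_tnth.
by apply/seteqP; split => t /=; [move=> H i _|move=> H i]; exact: H.
Qed.

(** Rectangles are stable under intersection and generate the sigma-algebra of tuples, so two finite
    measures that agree on them agree everywhere. *)
Lemma tuple_prob_unique n (mu : 'I_n -> probability RT R) (nu : {measure set (n.-tuple RT) -> \bar R}) :
  (forall A : 'I_n -> set RT, (forall i, measurable (A i)) ->
    nu [set t | forall i, A i (tnth t i)] = \prod_i mu i (A i)) ->
  forall B, measurable B -> tuple_prob mu B = nu B.
Proof.
move=> nuE B mB.
pose G : set (set (n.-tuple RT)) := [set X | exists2 A : 'I_n -> set RT,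
  (forall i, measurable (A i)) & X = [set t | forall i, A i (tnth t i)]].
have GT : G setT.
  exists (fun=> setT); first by move=> i.
  by apply/seteqP; split.
apply: (@measure_unique _ R _ G (fun=> setT)) => //.
- apply/seteqP; split; last first.
    apply: smallest_sub; first exact: sigma_algebra_measurable.
    move=> _ [A mA ->].
    rewrite (_ : mkset _ = \bigcap_(i in setT) (fun t => tnth t i) @^-1` A i).
      apply: fin_bigcap_measurable => // i _.
      by rewrite -[X in measurable X]setTI; exact: measurable_tnth.
    by apply/seteqP; split => t /=; [move=> H i _|move=> H i]; exact: H.
  move=> X; apply: smallest_sub; first exact: smallest_sigma_algebra.
  move=> Y /=; rewrite -bigcup_seq => -[i _] [C mC] <-.
  (* The preimage of [C] under one coordinate is the rectangle whose other sides are full. *)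
  apply: sub_sigma_algebra; exists (fun j => if j == i then C else setT).
    by move=> j; case: ifP.
  rewrite setTI; apply/seteqP; split => t /= H.
    by move=> j; case: eqP => // ->.
  by have := H i; rewrite eqxx.
- move=> _ _ [A mA ->] [A' mA' ->]; exists (fun i => A i `&` A' i).
    by move=> i; exact: measurableI.
  apply/seteqP; split => t /=; first by move=> [H1 H2] i.
  by move=> H; split => i; have [] := H i.
- by rewrite bigcup_const.
- move=> _ [A mA ->]; transitivity (\prod_i mu i (A i)).
    exact: tuple_prob_rect.
  exact/esym/nuE.
- by move=> k; apply: (@le_lt_trans _ _ 1); [exact: probability_le1|exact: ltry].
Qed.

End tuple_product.

Section fin_product.
Context {R : realType} {K : finType}.
Local Notation RT := (measurableTypeR R).
Local Notation TT := (#|K|.-tuple RT).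
Local Open Scope ereal_scope.
Implicit Types (t : TT) (mu : K -> probability RT R).

(* A point of the product space RT^K is stored as a tuple, only tuples being
   equipped with a product sigma-algebra. *)
Definition crd t (k : K) : RT := tnth t (enum_rank k).

Definition mkt (f : K -> RT) : TT := [tuple f (enum_val i) | i < #|K|].

Lemma crd_mkt f k : crd (mkt f) k = f k.
Proof. by rewrite /crd tnth_mktuple enum_rankK. Qed.

Lemma measurable_crd k : measurable_fun setT (crd ^~ k).
Proof. exact: measurable_tnth. Qed.

Lemma measurable_mkt d (T : measurableType d) (f : T -> K -> RT) :
  (forall k, measurable_fun setT (f ^~ k)) -> measurable_fun setT (fun x => mkt (f x)).
Proof.
move=> mf; apply/measurable_fun_tnthP => i.
rewrite (_ : _ \o _ = f ^~ (enum_val i))//.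
by apply/funext => x /=; rewrite tnth_mktuple.
Qed.

Definition prodP mu : probability TT R := tuple_prob (fun i => mu (enum_val i)).

Definition rect (A : K -> set RT) : set TT := [set t | forall k, A k (crd t k)].

Lemma rectE A : rect A = [set t | forall i, A (enum_val i) (tnth t i)].
Proof.
apply/seteqP; split => t /= H i; last by have := H (enum_rank i); rewrite enum_rankK.
by have := H (enum_val i); rewrite /crd enum_valK.
Qed.

Lemma measurable_rect A : (forall k, measurable (A k)) -> measurable (rect A).
Proof.
move=> mA; rewrite (_ : rect A = \bigcap_(k in setT) crd ^~ k @^-1` A k).
  apply: fin_bigcap_measurable => // i _.
  by rewrite -[X in measurable X]setTI; exact: measurable_crd.
by apply/seteqP; split => t /=; [move=> H i _|move=> H i]; exact: H.
Qed.

Lemma prodP_rect mu A : (forall k, measurable (A k)) ->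
  prodP mu (rect A) = \prod_k mu k (A k).
Proof.
move=> mA; rewrite rectE; apply: etrans.
  by apply: (@tuple_prob_rect _ _ _ (fun i => A (enum_val i))) => i; exact: mA.
rewrite (reindex (enum_val : 'I_#|K| -> K))//=.
exists enum_rank => k _; [exact: enum_valK|exact: enum_rankK].
Qed.

Lemma prodP_unique mu (nu : {measure set TT -> \bar R}) :
  (forall A, (forall k, measurable (A k)) -> nu (rect A) = \prod_k mu k (A k)) ->
  forall B, measurable B -> prodP mu B = nu B.
Proof.
move=> nuE; apply: tuple_prob_unique => A mA.
have := nuE (fun k => A (enum_rank k)) (fun k => mA _).
rewrite rectE (_ : [set t | _] = [set t | forall i, A i (tnth t i)]); last first.
  by apply/seteqP; split => t /= H i; have := H i; rewrite enum_valK.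
move=> ->; rewrite (reindex (enum_val : 'I_#|K| -> K))//=.
  by apply: eq_bigr => i _; rewrite enum_valK.
exists enum_rank => k _; [exact: enum_valK|exact: enum_rankK].
Qed.

Definition upd t k (x : RT) : TT := mkt (fun j => if j == k then x else crd t j).

Lemma crd_upd t k x j : crd (upd t k x) j = if j == k then x else crd t j.
Proof. by rewrite /upd crd_mkt. Qed.

Lemma measurable_upd k : measurable_fun setT (fun tx : TT * RT => upd tx.1 k tx.2).
Proof.
apply: measurable_mkt => j; case: eqP => // _; first exact: measurable_snd.
by apply: (measurableT_comp (measurable_crd j)).
Qed.

(** Replacing one coordinate by an independent copy preserves the product law. In this form
    one-dimensional facts are applied to a single coordinate while the others stay frozen. *)
Lemma prodP_resample mu k B : measurable B ->
  prodP mu B = image_prob (prodP mu \x mu k) (measurable_upd k) B.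
Proof.
apply: prodP_unique => A mA.
transitivity ((prodP mu \x mu k) ((fun tx : TT * RT => upd tx.1 k tx.2) @^-1` rect A)); first by [].
pose A' j := if j == k then setT else A j.
have mA' j : measurable (A' j) by rewrite /A'; case: ifP.
have -> : (fun tx : TT * RT => upd tx.1 k tx.2) @^-1` rect A = rect A' `*` A k.
  apply/seteqP; split => -[t x] /=.
    move=> H; split; last by have := H k; rewrite crd_upd eqxx.
    by move=> j; rewrite /A'; case: eqP => // /eqP jk; have := H j; rewrite crd_upd (negbTE jk).
  move=> [Ht Hx] j; rewrite crd_upd; case: eqP => [->//|/eqP jk].
  by have := Ht j; rewrite /A' (negbTE jk).
rewrite product_measure1E//; last exact: measurable_rect.
transitivity ((\prod_j mu j (A' j)) * mu k (A k)).
  by congr (_ * _); exact: prodP_rect.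
rewrite (bigD1 k)//= [RHS](bigD1 k)//= {1}/A' eqxx probability_setT mul1e muleC.
by congr (_ * _); apply: eq_bigr => j jk; rewrite /A' (negbTE jk).
Qed.

End fin_product.

Section fin_product_theory.
Context {R : realType} {K : finType}.
Local Notation RT := (measurableTypeR R).
Local Notation TT := (#|K|.-tuple RT).
Implicit Types (t : TT) (mu : K -> probability RT R).

(** The bridge from independent variables on an arbitrary space to the canonical product space: the
    product rule on rectangles determines the joint law. *)
Lemma law_prodP d (T : measurableType d) (P : {measure set T -> \bar R})
    (Z : T -> K -> RT) mu (mZ : forall k, measurable_fun setT (Z ^~ k)) :
  (forall A : K -> set RT, (forall k, measurable (A k)) ->
    P [set w | forall k, A k (Z w k)] = (\prod_k mu k (A k))%E) ->
  forall B, measurable B -> P ((fun w => mkt (Z w)) @^-1` B) = prodP mu B.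
Proof.
move=> PE B mB; apply/esym.
apply: (@prodP_unique _ _ _ (image_measure P (measurable_mkt mZ))) => // A mA.
rewrite -PE//; congr (P _).
by apply/seteqP; split => w /= H k; have := H k; rewrite crd_mkt.
Qed.

Lemma prodP_crd mu k A : measurable A -> prodP mu (crd ^~ k @^-1` A) = mu k A.
Proof.
move=> mA.
pose A' j := if j == k then A else setT.
have -> : crd ^~ k @^-1` A = rect A'.
  apply/seteqP; split => t /=.
    by move=> H j; rewrite /A'; case: eqP => // ->.
  by move=> /(_ k); rewrite /A' eqxx.
apply: etrans; first by apply: prodP_rect => j; rewrite /A'; case: ifP.
rewrite (bigD1 k)//= {1}/A' eqxx big1 ?mule1// => j jk.
by rewrite /A' (negbTE jk) probability_setT.
Qed.

Lemma ge0_integral_crd mu k (f : RT -> \bar R) : measurable_fun setT f ->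
  (forall x, 0 <= f x)%E ->
  (\int[prodP mu]_t f (crd t k) = \int[mu k]_x f x)%E.
Proof.
move=> mf f0; rewrite -(ge0_integral_image_prob _ (@measurable_crd R K k))//.
by apply: eq_measure_integral => A mA _; exact: prodP_crd.
Qed.

Lemma ge0_integral_resample mu k (f : TT -> \bar R) : measurable_fun setT f ->
  (forall t, 0 <= f t)%E ->
  (\int[prodP mu]_t f t = \int[prodP mu]_t \int[mu k]_x f (upd t k x))%E.
Proof.
move=> mf f0.
rewrite (eq_measure_integral (image_prob (prodP mu \x mu k)%E (measurable_upd k))); last first.
  by move=> A mA _; exact: prodP_resample.
rewrite ge0_integral_image_prob// fubini_tonelli1//.
apply: measurableT_comp => //; exact: measurable_upd.
Qed.

Lemma integral_resample mu k (f : TT -> \bar R) :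
  (prodP mu).-integrable setT f ->
  (\int[prodP mu]_t f t = \int[prodP mu]_t \int[mu k]_x f (upd t k x))%E.
Proof.
move=> fi; have mf := measurable_int _ fi.
have mfu : measurable_fun setT (fun tx : TT * RT => f (upd tx.1 k tx.2)).
  by apply: (measurableT_comp mf); exact: measurable_upd.
have fiu : (prodP mu \x mu k)%E.-integrable setT (fun tx : TT * RT => f (upd tx.1 k tx.2)).
  apply/integrableP; split => //.
  rewrite fubini_tonelli1//; last exact: measurableT_comp.
  move/integrableP : fi => [_]; rewrite (@ge0_integral_resample _ k)//.
  exact: measurableT_comp.
rewrite (eq_measure_integral (image_prob (prodP mu \x mu k)%E (measurable_upd k))); last first.
  by move=> A mA _; exact: prodP_resample.
by rewrite integral_image_prob// -integral12_prod_meas1.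
Qed.

End fin_product_theory.

Lemma emeasurable_prod d (T : measurableType d) (R : realType) (I : Type) (s : seq I)
    (f : I -> T -> \bar R) : (forall i, measurable_fun setT (f i)) ->
  measurable_fun setT (fun t => \prod_(i <- s) f i t)%E.
Proof.
move=> mf; elim: s => [|i s IH]; [under eq_fun do rewrite big_nil|under eq_fun do rewrite big_cons].
  exact: measurable_cst.
exact: emeasurable_funM.
Qed.

Lemma ge0_integral_tuple_prod {R : realType} n
    (mu : 'I_n -> probability (measurableTypeR R) R)
    (f : 'I_n -> measurableTypeR R -> \bar R) :
  (forall i, measurable_fun setT (f i)) -> (forall i x, 0 <= f i x)%E ->
  (\int[tuple_prob mu]_t (\prod_i f i (tnth t i)) =
   \prod_i \int[mu i]_x f i x)%E.
Proof.
have mprod m (g : 'I_m -> measurableTypeR R -> \bar R) : (forall i, measurable_fun setT (g i)) ->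
    measurable_fun setT (fun t : m.-tuple (measurableTypeR R) => \prod_i g i (tnth t i))%E.
  move=> mg; apply: emeasurable_prod => i.
  by apply: (measurableT_comp (mg i)); exact: measurable_tnth.
have pge0 m (x : 'I_m -> \bar R) : (forall i, 0 <= x i)%E -> (0 <= \prod_i x i)%E.
  by move=> x0; apply: prode_ge0 => i _.
elim: n mu f => [|n IH] mu f mf f0.
  rewrite big_ord0; under eq_integral do rewrite big_ord0.
  rewrite integral_cst// mul1e; exact: (probability_setT (tuple_prob mu)).
have F0 (x : measurableTypeR R * n.-tuple (measurableTypeR R)) :
    (0 <= \prod_i f i (tnth [tuple of x.1 :: x.2] i))%E by exact: pge0.
rewrite /= ge0_integral_image_prob//; [|exact: mprod|by move=> y; exact: pge0].
rewrite fubini_tonelli1//; last first.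
  apply: (measurableT_comp (mprod _ _ mf)); exact: measurable_tcons.
rewrite [RHS]big_ord_recl.
have -> : (\prod_(i < n) \int[mu (lift ord0 i)]_x f (lift ord0 i) x =
   \int[tuple_prob (fun i => mu (lift ord0 i))]_t (\prod_i f (lift ord0 i) (tnth t i)))%E.
  by rewrite (IH (fun i => mu (lift ord0 i)) (fun i => f (lift ord0 i))).
rewrite -ge0_integralZr//.
- apply: eq_integral => x _; rewrite /fubini_F /=.
  rewrite -ge0_integralZl//.
  + apply: eq_integral => t _; rewrite big_ord_recl; congr (_ * _)%E.
    by apply: eq_bigr => i _; rewrite tnthS.
  + exact: (mprod n (fun i => f (lift ord0 i))).
  + by move=> t _; exact: pge0.
- by apply: integral_ge0 => t _; exact: pge0.
Qed.

Lemma ge0_integral_prodP_prod {R : realType} (K : finType)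
    (mu : K -> probability (measurableTypeR R) R) (f : K -> measurableTypeR R -> \bar R) :
  (forall k, measurable_fun setT (f k)) -> (forall k x, 0 <= f k x)%E ->
  (\int[prodP mu]_t (\prod_k f k (crd t k)) = \prod_k \int[mu k]_x f k x)%E.
Proof.
move=> mf f0; have H := @ge0_integral_tuple_prod R #|K| (fun i => mu (enum_val i)) (fun i => f (enum_val i)) (fun i => mf _) (fun i => f0 _).
have bij : {on [pred _ | true], bijective (enum_val : 'I_#|K| -> K)}.
  exists enum_rank => k _; [exact: enum_valK|exact: enum_rankK].
rewrite [RHS](reindex (enum_val : 'I_#|K| -> K))//= -H.
apply: eq_integral => t _; rewrite (reindex (enum_val : 'I_#|K| -> K))//=.
by apply: eq_bigr => i _; rewrite /crd enum_valK.
Qed.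

Section gauss.
Context {R : realType} (K : finType).
Local Notation RT := (measurableTypeR R).
Local Notation TT := (#|K|.-tuple RT).

Definition gauss : probability TT R := prodP (fun _ : K => normal_prob (0 : R) 1).

Lemma integrable_crd k : gauss.-integrable setT (fun t => (crd t k)%:E).
Proof.
apply/integrableP; split; first by apply/measurable_EFinP; exact: measurable_crd.
have := @ge0_integral_crd R K (fun=> normal_prob 0 1) k (fun x => (`|x|)%:E).
rewrite /gauss => ->//; last exact/measurable_EFinP.
have /integrableP[_] : (normal_prob (0:R) 1).-integrable setT (EFin \o (@id RT)).
  apply: (@integrable_normal _ _ 1 1) => // x.
  by rewrite !mul1r; apply: le_trans (expR_ge1Dx _); rewrite lerDr.
by [].
Qed.

Lemma integrable_gauss_bounded (F : TT -> R) (C : R) : measurable_fun setT F ->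
  (forall t, `|F t| <= C) -> gauss.-integrable setT (EFin \o F).
Proof.
move=> mF FC.
have : gauss.-integrable setT (EFin \o cst C) by exact: finite_measure_integrable_cst.
apply: le_integrable => //; first exact/measurable_EFinP.
by move=> t _ /=; rewrite lee_fin (le_trans (FC t))// ler_norm.
Qed.

Lemma integrable_crdM k (F : TT -> R) (C : R) : measurable_fun setT F ->
  (forall t, `|F t| <= C) -> gauss.-integrable setT (fun t => (crd t k * F t)%:E).
Proof.
move=> mF FC.
have C0 : 0 <= C by apply: le_trans (FC (mkt (fun=> 0))).
have := integrableZl measurableT C (integrable_crd k).
apply: le_integrable => //.
  by apply/measurable_EFinP; apply: measurable_funM => //; exact: measurable_crd.
move=> t _ /=; rewrite lee_fin !normrM mulrC (ger0_norm C0).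
by rewrite ler_wpM2r.
Qed.

(** Resampling coordinate [k] reduces the claim to Stein's identity for [x => F (upd t k x)], with
    [t] fixed. *)
Lemma gauss_ibp (k : K) (F F' : TT -> R) (C : R) :
  measurable_fun setT F -> measurable_fun setT F' ->
  (forall t, `|F t| <= C) -> (forall t, `|F' t| <= C) ->
  (forall t (x : R), is_derive x (1 : R) (fun x : R => F (upd t k x)) (F' (upd t k x))) ->
  (forall t, continuous (fun x : R => F' (upd t k x))) ->
  \int[gauss]_t (crd t k * F t) = \int[gauss]_t F' t.
Proof.
move=> mF mF' FC F'C dF cF'.
have C0 : 0 <= C by apply: le_trans (FC (mkt (fun=> 0))).
rewrite /Rintegral; congr fine.
rewrite /gauss (@integral_resample _ _ _ k); last exact: (integrable_crdM k mF FC).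
rewrite [RHS](@integral_resample _ _ _ k); last exact: (integrable_gauss_bounded mF' F'C).
apply: eq_integral => t _.
have := @normal_ibp R (fun x => F (upd t k x)) (fun x => F' (upd t k x)) C (dF t) (cF' t).
have mu1 : measurable_fun setT (fun x : RT => upd t k x).
  by apply: measurable_mkt => j; case: eqP.
have h x : `|F (upd t k x)| <= C * (1 + `|x|).
  by apply: (le_trans (FC _)); rewrite mulrDr mulr1 lerDl mulr_ge0.
move=> /(_ h (fun x => F'C _)) E.
have i1 : (normal_prob (0:R) 1).-integrable setT (EFin \o (fun x : RT => x * F (upd t k x))).
  apply: (@integrable_normal _ _ C 1) => //.
    by apply: measurable_funM => //; exact: (measurableT_comp mF).
  move=> x; rewrite normrM mulrC; apply: ler_pM => //; rewrite mul1r.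
  by apply: le_trans (expR_ge1Dx _); rewrite lerDr.
have i2 : (normal_prob (0:R) 1).-integrable setT (EFin \o (fun x : RT => F' (upd t k x))).
  apply: (@integrable_normal _ _ C 0) => //.
    by exact: (measurableT_comp mF').
  by move=> x; rewrite mul0r expR0 mulr1.
rewrite -[LHS]fineK; last by under eq_integral do rewrite crd_upd eqxx; exact: integrable_fin_num i1.
rewrite -[RHS]fineK; last exact: integrable_fin_num i2.
congr EFin; move: E; rewrite /Rintegral => <-; congr fine.
by apply: eq_integral => x _; rewrite crd_upd eqxx.
Qed.

(* B theta k is the coefficient of the k-th Gaussian in dU/dtheta and E theta k
   its partial derivative in that Gaussian, so that dU/dtheta integrates to the
   integral of the sum of the E theta k. *)
Lemma gauss_interpolation (U : R -> TT -> R) (B E : R -> K -> TT -> R) (a b C : R) :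
  a < b ->
  (forall th, measurable_fun setT (U th)) ->
  (forall th k, measurable_fun setT (B th k)) ->
  (forall th k, measurable_fun setT (E th k)) ->
  (forall th t, `|U th t| <= C) -> (forall th k t, `|B th k t| <= C) ->
  (forall th k t, `|E th k t| <= C) ->
  (forall t (th : R), is_derive th (1 : R) (U ^~ t) (\sum_k crd t k * B th k t)) ->
  (forall th k t (x : R),
    is_derive x (1 : R) (fun x : R => B th k (upd t k x)) (E th k (upd t k x))) ->
  (forall th k t, continuous (fun x : R => E th k (upd t k x))) ->
  (forall th t, a < th < b -> 0 <= \sum_k E th k t) ->
  \int[gauss]_t U a t <= \int[gauss]_t U b t.
Proof.
move=> ab mU mB mE UC BC EC dU dB cE E0.
have C0 : 0 <= C by apply: le_trans (UC 0 (mkt (fun=> 0))).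
pose H th := \int[gauss]_t U th t.
(* An integrable bound of the angular derivative that is uniform in the angle, as differentiation
   under the integral requires. *)
pose G (t : TT) : R := \sum_(k : K) (C * `|crd t k|).
have G0 t : 0 <= G t by apply: sumr_ge0 => k _; rewrite mulr_ge0.
have iG : gauss.-integrable setT (EFin \o G).
  have -> : EFin \o G = (fun t => \sum_k (C%:E * `|(crd t k)%:E|))%E.
    by apply/funext => t /=; rewrite -sumEFin.
  apply: integrable_sum => // k _; apply: integrableZl => //.
  by apply: integrable_abse; exact: integrable_crd.
have dHE (th : R) : derivable H th 1 /\ derive1 H th = \sum_k \int[gauss]_t E th k t.
  have Ith : [set` `]th - 1, th + 1[] th.
    by rewrite /= in_itv/=; apply/andP; split; lra.
  have d1 x t : derive1 (fun th => U th t) x = \sum_k crd t k * B x k t.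
    by rewrite derive1E; have [] := dU t x.
  have i1 x : [set` `]th - 1, th + 1[] x -> gauss.-integrable setT (EFin \o U x).
    by move=> _; exact: integrable_gauss_bounded.
  have i2 x t : [set` `]th - 1, th + 1[] x -> setT t -> derivable (U ^~ t) x 1.
    by move=> _ _; have [] := dU t x.
  have i3 x t : [set` `]th - 1, th + 1[] x -> setT t -> `|partial1of2 U x t| <= G t.
    move=> _ _; rewrite /partial1of2 d1; apply: (le_trans (ler_norm_sum _ _ _)).
    by apply: ler_sum => k _; rewrite normrM mulrC ler_wpM2r.
  split; first exact: (derivable_under_integral measurableT Ith i1 i2 G0 iG i3).
  rewrite (differentiation_under_integral measurableT Ith i1 i2 G0 iG i3).
  have -> : \int[gauss]_t partial1of2 U th t = \int[gauss]_t \sum_k (crd t k * B th k t).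
    by apply: eq_Rintegral => t _; rewrite /partial1of2 d1.
  transitivity (\sum_k \int[gauss]_t (crd t k * B th k t)); last first.
    by apply: eq_bigr => k _; apply: (@gauss_ibp k (B th k) (E th k) C).
  rewrite /Rintegral; under eq_integral do rewrite -sumEFin.
  rewrite integral_sum//; last by move=> k; exact: integrable_crdM.
  rewrite -sum_fine// => k _; apply: integrable_fin_num => //.
  by apply: (integrable_crdM _ _ (BC th k)).
have dH0 th : a < th < b -> 0 <= derive1 H th.
  move=> thab; rewrite (dHE th).2.
  rewrite (_ : \sum_k _ = \int[gauss]_t \sum_k E th k t); last first.
    rewrite /Rintegral; under [in RHS]eq_integral do rewrite -sumEFin.
    rewrite integral_sum//; last by move=> k; exact: integrable_gauss_bounded.
    rewrite -sum_fine// => k _; apply: integrable_fin_num => //.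
    exact: integrable_gauss_bounded.
  by apply: Rintegral_ge0 => t _; exact: E0.
have cH : {within `[a, b], continuous H}.
  by apply: derivable_within_continuous => x _; exact: (dHE x).1.
have dHx x : x \in `]a, b[ -> is_derive x (1 : R) H (derive1 H x).
  by move=> _; apply: DeriveDef; [exact: (dHE x).1|rewrite derive1E].
have [c cab Hab] := MVT ab dHx cH.
rewrite -subr_ge0 -/(H b) -/(H a) Hab; apply: mulr_ge0; last by rewrite subr_ge0 ltW.
by apply: dH0; move: cab; rewrite in_itv.
Qed.

End gauss.

(** * Gordon's comparison inequality *)

Section bigsum_calculus.
Context {R : realType}.

Lemma is_derive_bigsum (I : Type) (s : seq I) (h : I -> R -> R) (h' : I -> R) (x : R) :
  (forall i, is_derive x (1 : R) (h i) (h' i)) ->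
  is_derive x (1 : R) (fun t => \sum_(i <- s) h i t) (\sum_(i <- s) h' i).
Proof.
move=> dh; elim: s => [|i s IH].
  rewrite big_nil (_ : (fun t => _) = cst 0); first exact: is_derive_cst.
  by apply/funext => t; rewrite big_nil.
rewrite big_cons (_ : (fun t => _) = h i + (fun t => \sum_(i <- s) h i t)).
  exact: is_deriveD.
by apply/funext => t; rewrite big_cons.
Qed.

Lemma continuous_bigsum (T : topologicalType) (I : Type) (s : seq I) (h : I -> T -> R) (x : T) :
  (forall i, {for x, continuous (h i)}) ->
  {for x, continuous (fun t => \sum_(i <- s) h i t)}.
Proof.
move=> ch; elim: s => [|i s IH].
  rewrite (_ : (fun t => _) = cst 0); first exact: cvg_cst.
  by apply/funext => t; rewrite big_nil.
rewrite (_ : (fun t => _) = h i + (fun t => \sum_(i <- s) h i t)).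
  exact: continuousD.
by apply/funext => t; rewrite big_cons.
Qed.

Lemma measurable_inv_gt0 d (T : measurableType d) (f : T -> R) :
  (forall x, 0 < f x) -> measurable_fun setT f -> measurable_fun setT (fun x => (f x)^-1).
Proof.
move=> f0 mf; rewrite (_ : (fun x => _) = (fun x => expR (- ln (f x)))).
  apply: (measurableT_comp (@measurable_expR R)); apply: measurableT_comp => //.
  exact: measurableT_comp.
by apply/funext => x; rewrite expRN lnK// posrE.
Qed.

Lemma measurable_sqrt : measurable_fun setT (@Num.sqrt R).
Proof. by apply: continuous_measurable_fun; exact: sqrt_continuous. Qed.

End bigsum_calculus.

Section gordon_functional.
Context {R : realType} (F I : finType) (tau b : R).
Hypotheses (tau0 : 0 < tau) (b0 : 0 < b).
Implicit Types (Z z : F -> I -> R) (Y y : F -> R).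

(** A Euclidean norm smoothed by [tau], since the norm itself is not differentiable at the
    origin. *)
Definition snorm (Z : F -> I -> R) v : R := Num.sqrt (\sum_i Z v i ^+ 2 + tau).

Definition weight Z Y v : R := expR (- b * (snorm Z v + Y v)).

(* As b tends to infinity, a smooth version of the indicator that
   snorm Z v + Y v is positive for every v. *)
Definition gordonU Z Y : R := expR (- \sum_v weight Z Y v).

(** The derivative of [snorm Z v + Y v] in the direction [(z, y)]; [dlin2] is its derivative in a
    further direction, in which only [z'] counts because [Y] enters linearly. *)
Definition dlin Z z y v : R := (\sum_i Z v i * z v i) / snorm Z v + y v.

Definition dlin2 Z z' z v : R := (\sum_i z' v i * z v i) / snorm Z v -
  (\sum_i Z v i * z' v i) * (\sum_i Z v i * z v i) / snorm Z v ^+ 3.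

(* gordonD is the derivative of gordonU in the direction (z, y), gordonD2 the
   derivative of gordonD in a further direction (z', y'). *)
Definition gordonD Z Y z y : R :=
  b * gordonU Z Y * \sum_v weight Z Y v * dlin Z z y v.

Definition gordonD2 Z Y z' y' z y : R :=
  b * gordonU Z Y *
  (b * (\sum_v weight Z Y v * dlin Z z' y' v) * (\sum_v weight Z Y v * dlin Z z y v) +
   \sum_v weight Z Y v * (dlin2 Z z' z v - b * dlin Z z' y' v * dlin Z z y v)).

Lemma sumsq_tau_gt0 Z v : 0 < \sum_i Z v i ^+ 2 + tau.
Proof. by rewrite ltr_wpDl// sumr_ge0// => i _; exact: sqr_ge0. Qed.

Lemma snorm_gt0 Z v : 0 < snorm Z v.
Proof. by rewrite sqrtr_gt0 sumsq_tau_gt0. Qed.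

Lemma weight_gt0 Z Y v : 0 < weight Z Y v. Proof. exact: expR_gt0. Qed.

Lemma gordonU_gt0 Z Y : 0 < gordonU Z Y. Proof. exact: expR_gt0. Qed.

Lemma gordonU_le1 Z Y : gordonU Z Y <= 1.
Proof.
rewrite -expR0 ler_expR oppr_le0 sumr_ge0// => v _; exact/ltW/weight_gt0.
Qed.

Section derive.
Variables (Z : R -> F -> I -> R) (Y : R -> F -> R) (z' : F -> I -> R) (y' : F -> R) (x : R).
Hypotheses (dZ : forall v i, is_derive x (1 : R) (fun t => Z t v i) (z' v i))
           (dY : forall v, is_derive x (1 : R) (fun t => Y t v) (y' v)).

Lemma is_derive_snorm v :
  is_derive x (1 : R) (fun t => snorm (Z t) v) ((\sum_i Z x v i * z' v i) / snorm (Z x) v).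
Proof.
have d1 : is_derive x (1 : R) (fun t => \sum_i Z t v i ^+ 2 + tau)
    (\sum_i (2 * (Z x v i * z' v i))).
  have ds : is_derive x (1 : R) (fun t => \sum_i Z t v i ^+ 2) (\sum_i (2 * (Z x v i * z' v i))); last first.
    by apply: is_derive_eq; rewrite addr0.
  apply: is_derive_bigsum => i.
  have -> : (fun t => Z t v i ^+ 2) = (fun t => Z t v i * Z t v i) by [].
  apply: is_derive_eq; rewrite /GRing.scale/=; ring.
have d2 := is_derive1_sqrt (sumsq_tau_gt0 (Z x) v).
have := @is_derive1_comp R Num.sqrt (fun t => \sum_i Z t v i ^+ 2 + tau) x _ _ d2 d1.
rewrite -mulr_sumr -/(snorm (Z x) v) => H.
apply: (is_derive_eq H).
by field; rewrite gt_eqF// snorm_gt0.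
Qed.

Lemma is_derive_weight v :
  is_derive x (1 : R) (fun t => weight (Z t) (Y t) v)
    (- b * weight (Z x) (Y x) v * dlin (Z x) z' y' v).
Proof.
have H : is_derive x (1 : R) (fun t => - b * (snorm (Z t) v + Y t v)) (- b * dlin (Z x) z' y' v).
  have := is_derive_snorm v => Hs.
  apply: is_derive_eq; rewrite /GRing.scale/= /dlin; ring.
have := @is_derive1_comp R expR _ x _ _ (is_derive_expR _) H => H2.
apply: (is_derive_eq H2).
by rewrite -/(weight (Z x) (Y x) v); ring.
Qed.

Lemma is_derive_gordonU :
  is_derive x (1 : R) (fun t => gordonU (Z t) (Y t)) (gordonD (Z x) (Y x) z' y').
Proof.
have H : is_derive x (1 : R) (fun t => - \sum_v weight (Z t) (Y t) v)
    (- \sum_v (- b * weight (Z x) (Y x) v * dlin (Z x) z' y' v)).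
  by apply: is_deriveN; apply: is_derive_bigsum => v; exact: is_derive_weight.
have := @is_derive1_comp R expR _ x _ _ (is_derive_expR _) H => H2.
apply: (is_derive_eq H2).
rewrite -/(gordonU (Z x) (Y x)) /gordonD.
under eq_bigr do rewrite -mulrA.
by rewrite -mulr_sumr; ring.
Qed.

Variables (z : F -> I -> R) (y : F -> R).

Lemma is_derive_dlin v :
  is_derive x (1 : R) (fun t => dlin (Z t) z y v) (dlin2 (Z x) z' z v).
Proof.
have d1 : is_derive x (1 : R) (fun t => \sum_i Z t v i * z v i) (\sum_i z' v i * z v i).
  apply: is_derive_bigsum => i.
  apply: is_derive_eq; rewrite /GRing.scale/=; ring.
have d2 := is_derive_snorm v.
have nz : snorm (Z x) v != 0 by rewrite gt_eqF// snorm_gt0.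
have d3 := @is_deriveV R (fun t => snorm (Z t) v) x _ (1 : R) nz d2.
apply: is_derive_eq; rewrite /GRing.scale/= /dlin2.
by field.
Qed.

Lemma is_derive_gordonD :
  is_derive x (1 : R) (fun t => gordonD (Z t) (Y t) z y)
    (gordonD2 (Z x) (Y x) z' y' z y).
Proof.
have d1 := is_derive_gordonU.
have d2 : is_derive x (1 : R) (fun t => \sum_v weight (Z t) (Y t) v * dlin (Z t) z y v)
    (\sum_v weight (Z x) (Y x) v * (dlin2 (Z x) z' z v -
       b * dlin (Z x) z' y' v * dlin (Z x) z y v)).
  apply: is_derive_bigsum => v.
  have d3 := is_derive_weight v; have d4 := is_derive_dlin v.
  apply: is_derive_eq; rewrite /GRing.scale/=; ring.
apply: is_derive_eq; rewrite /GRing.scale/= /gordonD2 /gordonD; ring.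
Qed.

End derive.

Section continuity.
Context {T : topologicalType}.
Variables (Z : T -> F -> I -> R) (Y : T -> F -> R) (x : T).
Hypotheses (cZ : forall v i, {for x, continuous (fun t => Z t v i)})
           (cY : forall v, {for x, continuous (fun t => Y t v)}).
Variables (z' z : F -> I -> R) (y' y : F -> R).

Lemma continuous_snorm v : {for x, continuous (fun t => snorm (Z t) v)}.
Proof.
apply: (@continuous_comp _ _ _ (fun t => \sum_i Z t v i ^+ 2 + tau) Num.sqrt).
  apply: continuousD; last exact: cvg_cst.
  by apply: continuous_bigsum => i; apply: continuousM; exact: cZ.
exact: sqrt_continuous.
Qed.

Lemma continuous_weight v : {for x, continuous (fun t => weight (Z t) (Y t) v)}.
Proof.
apply: (@continuous_comp _ _ _ (fun t => - b * (snorm (Z t) v + Y t v)) expR); last exact: continuous_expR.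
apply: continuousM; first exact: cvg_cst.
by apply: continuousD; [exact: continuous_snorm|exact: cY].
Qed.

Lemma continuous_gordonU : {for x, continuous (fun t => gordonU (Z t) (Y t))}.
Proof.
apply: (@continuous_comp _ _ _ (fun t => - \sum_v weight (Z t) (Y t) v) expR); last exact: continuous_expR.
by apply: continuousN; apply: continuous_bigsum => v; exact: continuous_weight.
Qed.

Lemma continuous_inv_snorm v : {for x, continuous (fun t => (snorm (Z t) v)^-1)}.
Proof. by apply: continuousV; [rewrite gt_eqF// snorm_gt0|exact: continuous_snorm]. Qed.

Lemma continuous_dlin w w' v : {for x, continuous (fun t => dlin (Z t) w w' v)}.
Proof.
apply: continuousD; last exact: cvg_cst.
apply: continuousM; last exact: continuous_inv_snorm.
apply: continuous_bigsum => i; apply: continuousM; [exact: cZ|exact: cvg_cst].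
Qed.

Lemma continuous_dlin2 v : {for x, continuous (fun t => dlin2 (Z t) z' z v)}.
Proof.
apply: continuousB.
  by apply: continuousM; [exact: cvg_cst|exact: continuous_inv_snorm].
apply: continuousM.
  by apply: continuousM; apply: continuous_bigsum => i; apply: continuousM;
    solve [exact: cZ|exact: cvg_cst].
have -> : (fun t => (snorm (Z t) v ^+ 3)^-1) =
  (fun t => (snorm (Z t) v)^-1 * ((snorm (Z t) v)^-1 * (snorm (Z t) v)^-1)).
  by apply/funext => t; rewrite !exprS expr0 mulr1 !invfM.
by do 2![apply: continuousM; first exact: continuous_inv_snorm]; exact: continuous_inv_snorm.
Qed.

Lemma continuous_gordonD2 : {for x, continuous (fun t => gordonD2 (Z t) (Y t) z' y' z y)}.
Proof.
have cs w w' : {for x, continuous (fun t => \sum_v weight (Z t) (Y t) v * dlin (Z t) w w' v)}.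
  by apply: continuous_bigsum => v; apply: continuousM; [exact: continuous_weight|exact: continuous_dlin].
apply: continuousM.
  by apply: continuousM; [exact: cvg_cst|exact: continuous_gordonU].
apply: continuousD.
  by apply: continuousM; last exact: cs; apply: continuousM; [exact: cvg_cst|exact: cs].
apply: continuous_bigsum => v; apply: continuousM; first exact: continuous_weight.
apply: continuousB; first exact: continuous_dlin2.
apply: continuousM; last exact: continuous_dlin.
by apply: continuousM; [exact: cvg_cst|exact: continuous_dlin].
Qed.

End continuity.

Section measurability.
Context d (T : measurableType d).
Variables (Z : T -> F -> I -> R) (Y : T -> F -> R).
Hypotheses (mZ : forall v i, measurable_fun setT (fun t => Z t v i))
           (mY : forall v, measurable_fun setT (fun t => Y t v)).
Variables (z' z : F -> I -> R) (y' y : F -> R).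

Lemma measurable_snorm v : measurable_fun setT (fun t => snorm (Z t) v).
Proof.
apply: (measurableT_comp measurable_sqrt); apply: measurable_funD => //.
by apply: measurable_sum => i; exact: measurable_funX.
Qed.

Lemma measurable_weight v : measurable_fun setT (fun t => weight (Z t) (Y t) v).
Proof.
apply: (measurableT_comp (@measurable_expR R)); apply: measurable_funM => //.
by apply: measurable_funD => //; exact: measurable_snorm.
Qed.

Lemma measurable_gordonU : measurable_fun setT (fun t => gordonU (Z t) (Y t)).
Proof.
apply: (measurableT_comp (@measurable_expR R)); apply: measurableT_comp => //.
by apply: measurable_sum => v; exact: measurable_weight.
Qed.

Lemma measurable_inv_snorm v : measurable_fun setT (fun t => (snorm (Z t) v)^-1).
Proof. by apply: measurable_inv_gt0 => [t|]; [exact: snorm_gt0|exact: measurable_snorm]. Qed.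

Lemma measurable_dlin w w' v : measurable_fun setT (fun t => dlin (Z t) w w' v).
Proof.
apply: measurable_funD => //; apply: measurable_funM; last exact: measurable_inv_snorm.
by apply: measurable_sum => i; exact: measurable_funM.
Qed.

Lemma measurable_dlin2 v : measurable_fun setT (fun t => dlin2 (Z t) z' z v).
Proof.
apply: measurable_funB.
  by apply: measurable_funM => //; exact: measurable_inv_snorm.
apply: measurable_funM.
  by apply: measurable_funM; apply: measurable_sum => i; exact: measurable_funM.
apply: measurable_inv_gt0 => [t|]; first by rewrite exprn_gt0// snorm_gt0.
by apply: measurable_funX; exact: measurable_snorm.
Qed.

Lemma measurable_sum_dlin w w' :
  measurable_fun setT (fun t => \sum_v weight (Z t) (Y t) v * dlin (Z t) w w' v).
Proof.
apply: measurable_sum => v; apply: measurable_funM.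
  exact: measurable_weight.
exact: measurable_dlin.
Qed.

Lemma measurable_gordonD : measurable_fun setT (fun t => gordonD (Z t) (Y t) z y).
Proof.
apply: measurable_funM; last exact: measurable_sum_dlin.
by apply: measurable_funM => //; exact: measurable_gordonU.
Qed.

Lemma measurable_gordonD2 :
  measurable_fun setT (fun t => gordonD2 (Z t) (Y t) z' y' z y).
Proof.
apply: measurable_funM.
  by apply: measurable_funM => //; exact: measurable_gordonU.
apply: measurable_funD.
  apply: measurable_funM; last exact: measurable_sum_dlin.
  by apply: measurable_funM => //; exact: measurable_sum_dlin.
apply: measurable_sum => v; apply: measurable_funM; first exact: measurable_weight.
apply: measurable_funB; first exact: measurable_dlin2.
apply: measurable_funM; last exact: measurable_dlin.
by apply: measurable_funM => //; exact: measurable_dlin.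
Qed.

End measurability.

End gordon_functional.

(** Lagrange's identity: the defect of the squared inequality is half the sum of the squares
    [(x i * y j - x j * y i) ^+ 2]. *)
Lemma cauchy_schwarz_sum {R : rcfType} (I : finType) (x y : I -> R) :
  \sum_i x i * y i <= Num.sqrt (\sum_i x i ^+ 2) * Num.sqrt (\sum_i y i ^+ 2).
Proof.
set A := \sum_i x i ^+ 2; set B := \sum_i y i ^+ 2.
have A0 : 0 <= A by apply: sumr_ge0 => i _; exact: sqr_ge0.
have B0 : 0 <= B by apply: sumr_ge0 => i _; exact: sqr_ge0.
rewrite -sqrtrM//; apply: (le_trans (ler_norm _)).
rewrite -sqrtr_sqr ler_wsqrtr//.
have H : 0 <= \sum_i \sum_j (x i * y j - x j * y i) ^+ 2.
  by apply: sumr_ge0 => i _; apply: sumr_ge0 => j _; exact: sqr_ge0.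
suff E : \sum_i \sum_j (x i * y j - x j * y i) ^+ 2 = 2 * (A * B - (\sum_i x i * y i) ^+ 2).
  by move: H; rewrite E pmulr_rge0// subr_ge0.
transitivity (\sum_i \sum_j (x i ^+ 2 * y j ^+ 2 + x j ^+ 2 * y i ^+ 2
   - 2 * ((x i * y i) * (x j * y j)))).
  by apply: eq_bigr => i _; apply: eq_bigr => j _; ring.
have s1 : \sum_i \sum_j (x i ^+ 2 * y j ^+ 2) = A * B by rewrite big_distrlr.
have s2 : \sum_i \sum_j (x j ^+ 2 * y i ^+ 2) = A * B by rewrite exchange_big/= big_distrlr.
have s3 : \sum_i \sum_j (x i * y i) * (x j * y j) = (\sum_i x i * y i) ^+ 2.
  by rewrite expr2 big_distrlr.
transitivity (\sum_i \sum_j (x i ^+ 2 * y j ^+ 2) + \sum_i \sum_j (x j ^+ 2 * y i ^+ 2) -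
   2 * \sum_i \sum_j (x i * y i) * (x j * y j)).
  rewrite mulr_sumr -big_split -sumrB/=; apply: eq_bigr => i _.
  by rewrite mulr_sumr -big_split -sumrB.
by rewrite s1 s2 s3; ring.
Qed.

Section gordon_bounds.
Context {R : realType} (F I : finType) (tau b : R).
Hypotheses (tau0 : 0 < tau) (b0 : 0 < b).
Implicit Types (Z z : F -> I -> R) (Y y : F -> R).
Local Notation snorm := (@snorm R F I tau).
Local Notation weight := (@weight R F I tau b).
Local Notation gordonU := (@gordonU R F I tau b).
Local Notation dlin := (@dlin R F I tau).
Local Notation dlin2 := (@dlin2 R F I tau).

(** A crude size of a direction. The derivatives must be bounded uniformly in the base point, both
    for domination and for integration by parts. *)
Definition dirsize z y : R := \sum_v (\sum_i `|z v i| + `|y v|).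

Lemma dirsize_ge z y v : \sum_i `|z v i| + `|y v| <= dirsize z y.
Proof.
rewrite /dirsize (bigD1 v)//= lerDl; apply: sumr_ge0 => w _.
by rewrite addr_ge0// sumr_ge0.
Qed.

Lemma dirsize_ge1 z y v : \sum_i `|z v i| <= dirsize z y.
Proof. by apply: le_trans (dirsize_ge z y v); rewrite lerDl. Qed.

Lemma snorm_ge Z v i : `|Z v i| <= snorm Z v.
Proof.
rewrite -sqrtr_sqr ler_wsqrtr// (bigD1 i)//= -addrA lerDl addr_ge0 ?(ltW tau0)//.
by rewrite sumr_ge0// => j _; exact: sqr_ge0.
Qed.

Lemma snorm_dot Z z v : `|\sum_i Z v i * z v i| <= snorm Z v * \sum_i `|z v i|.
Proof.
rewrite mulr_sumr (le_trans (ler_norm_sum _ _ _))//; apply: ler_sum => i _.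
by rewrite normrM ler_wpM2r// snorm_ge.
Qed.

Lemma dlin_le Z z y v : `|dlin Z z y v| <= dirsize z y.
Proof.
apply: le_trans (dirsize_ge z y v); apply: (le_trans (ler_normD _ _)).
have s0 := snorm_gt0 tau0 Z v.
rewrite lerD2r normrM normfV (gtr0_norm s0) ler_pdivrMr// mulrC.
exact: snorm_dot.
Qed.

(** Each of the two terms carries one uncompensated [(snorm Z v)^-1], at most [(Num.sqrt tau)^-1];
    positivity of [tau] is what makes the second derivative bounded. *)
Lemma dlin2_le Z z' y' z y v :
  `|dlin2 Z z' z v| <= 2 / Num.sqrt tau * dirsize z' y' * dirsize z y.
Proof.
have s0 := snorm_gt0 tau0 Z v.
have t0 : 0 < Num.sqrt tau by rewrite sqrtr_gt0.
have st : Num.sqrt tau <= snorm Z v.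
  by rewrite ler_wsqrtr// lerDr sumr_ge0// => i _; exact: sqr_ge0.
have si : (snorm Z v)^-1 <= (Num.sqrt tau)^-1 by rewrite lef_pV2.
have p1 := dirsize_ge1 z y v; have p2 := dirsize_ge1 z' y' v.
have q1 : 0 <= \sum_i `|z v i| by rewrite sumr_ge0.
have q2 : 0 <= \sum_i `|z' v i| by rewrite sumr_ge0.
have e1 : `|\sum_i z' v i * z v i| <= dirsize z' y' * dirsize z y.
  apply: (le_trans (ler_norm_sum _ _ _)).
  apply: (@le_trans _ _ ((\sum_i `|z' v i|) * (\sum_i `|z v i|))); last exact: ler_pM.
  rewrite mulr_suml; apply: ler_sum => i _; rewrite normrM ler_wpM2l//.
  by rewrite (bigD1 i)//= lerDl sumr_ge0.
have e2 : `|(\sum_i Z v i * z' v i) * (\sum_i Z v i * z v i)| / snorm Z v ^+ 3 <=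
   dirsize z' y' * dirsize z y / snorm Z v.
  rewrite exprS invfM mulrA mulrAC ler_wpM2r ?invr_ge0 ?(ltW s0)//.
  rewrite ler_pdivrMr ?exprn_gt0// normrM.
  have -> : dirsize z' y' * dirsize z y * snorm Z v ^+ 2 =
     (snorm Z v * dirsize z' y') * (snorm Z v * dirsize z y) by ring.
  apply: ler_pM => //; apply: (le_trans (snorm_dot _ _ _)); by rewrite ler_wpM2l// ltW.
apply: (le_trans (ler_normB _ _)).
rewrite !normrM !normfV [X in _ / X + _]gtr0_norm// [X in _ + _ / X]gtr0_norm ?exprn_gt0//.
rewrite -[X in _ + X / _]normrM.
have d0 : 0 <= dirsize z' y' * dirsize z y by rewrite mulr_ge0// (le_trans _ p1, le_trans _ p2).
apply: (@le_trans _ _ (dirsize z' y' * dirsize z y / snorm Z v + dirsize z' y' * dirsize z y / snorm Z v)).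
  by rewrite lerD// ler_wpM2r// invr_ge0 ltW.
have h := ler_wpM2l d0 si.
have -> : 2 / Num.sqrt tau * dirsize z' y' * dirsize z y =
  dirsize z' y' * dirsize z y / Num.sqrt tau + dirsize z' y' * dirsize z y / Num.sqrt tau by ring.
exact: lerD.
Qed.

Lemma sum_weight_dlin_le Z Y z y :
  `|\sum_v weight Z Y v * dlin Z z y v| <= (\sum_v weight Z Y v) * dirsize z y.
Proof.
rewrite mulr_suml (le_trans (ler_norm_sum _ _ _))//; apply: ler_sum => v _.
by rewrite normrM ger0_norm ?expR_ge0// ler_wpM2l ?expR_ge0// dlin_le.
Qed.

(** The weights are unbounded in [Y], but [gordonU] is [expR (- S)] with [S] their sum, and both
    [S * expR (- S)] and [S ^+ 2 * expR (- S)] are bounded. *)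
Lemma gordonU_weight1 Z Y : gordonU Z Y * \sum_v weight Z Y v <= 1.
Proof.
rewrite /gordonU expRN mulrC ler_pdivrMr ?expR_gt0// mul1r.
by apply: le_trans (expR_ge1Dx _); rewrite lerDr.
Qed.

Lemma gordonU_weight2 Z Y : gordonU Z Y * (\sum_v weight Z Y v) ^+ 2 <= 4.
Proof.
rewrite /gordonU expRN mulrC ler_pdivrMr ?expR_gt0//.
set S := \sum_v _.
have S0 : 0 <= S by rewrite sumr_ge0// => v _; exact: expR_ge0.
have := expR_ge1Dx (S / 2) => h.
have -> : expR S = expR (S / 2) * expR (S / 2).
  by rewrite -expRD; congr expR; field.
nra.
Qed.

Lemma dirsize_ge0 z y : 0 <= dirsize z y.
Proof. by rewrite sumr_ge0// => v _; rewrite addr_ge0// sumr_ge0. Qed.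

Lemma gordonD_le Z Y z y : `|gordonD tau b Z Y z y| <= b * dirsize z y.
Proof.
rewrite /gordonD !normrM (gtr0_norm b0) (gtr0_norm (gordonU_gt0 tau b Z Y)).
rewrite -mulrA ler_wpM2l ?(ltW b0)//.
have h := sum_weight_dlin_le Z Y z y.
have U0 := ltW (gordonU_gt0 tau b Z Y).
apply: (le_trans (ler_wpM2l U0 h)); rewrite mulrA.
by rewrite ler_piMl ?dirsize_ge0// gordonU_weight1.
Qed.

(** In [5 * b], the product of the two sums contributes [4 * b] through [gordonU_weight2] and the
    product inside the last sum contributes [b]. *)
Lemma gordonD2_le Z Y z' y' z y : `|gordonD2 tau b Z Y z' y' z y| <=
  b * (5 * b + 2 / Num.sqrt tau) * (dirsize z' y' * dirsize z y).
Proof.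
have U0 := ltW (gordonU_gt0 tau b Z Y).
set M' := dirsize z' y'; set M := dirsize z y.
have M0 : 0 <= M by exact: dirsize_ge0.
have M'0 : 0 <= M' by exact: dirsize_ge0.
have t0 : 0 <= 2 / Num.sqrt tau by rewrite divr_ge0 ?sqrtr_ge0.
rewrite /gordonD2 !normrM (gtr0_norm b0) (ger0_norm U0) -[leLHS]mulrA -[leRHS]mulrA ler_wpM2l ?(ltW b0)//.
set S := \sum_v weight Z Y v.
have S0 : 0 <= S by rewrite sumr_ge0// => v _; exact: expR_ge0.
have h1 : `|b * (\sum_v weight Z Y v * dlin Z z' y' v) * (\sum_v weight Z Y v * dlin Z z y v)|
    <= b * (S ^+ 2 * (M' * M)).
  rewrite -mulrA normrM (gtr0_norm b0) ler_wpM2l ?(ltW b0)// normrM.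
  have -> : S ^+ 2 * (M' * M) = (S * M') * (S * M) by ring.
  by apply: ler_pM => //; exact: sum_weight_dlin_le.
have h2 : `|\sum_v weight Z Y v * (dlin2 Z z' z v - b * dlin Z z' y' v * dlin Z z y v)|
    <= S * ((2 / Num.sqrt tau + b) * (M' * M)).
  rewrite mulr_suml (le_trans (ler_norm_sum _ _ _))//; apply: ler_sum => v _.
  rewrite normrM ger0_norm ?expR_ge0// ler_wpM2l ?expR_ge0// (le_trans (ler_normB _ _))//.
  rewrite mulrDl lerD//; first by rewrite mulrA; exact: dlin2_le.
  rewrite !normrM (gtr0_norm b0) -mulrA ler_wpM2l ?(ltW b0)//.
  by apply: ler_pM => //; exact: dlin_le.
apply: (le_trans (ler_wpM2l U0 (le_trans (ler_normD _ _) (lerD h1 h2)))).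
have u1 := gordonU_weight1 Z Y; have u2 := gordonU_weight2 Z Y.
rewrite -/S in u1 u2.
have MM0 : 0 <= M' * M by rewrite mulr_ge0.
have -> : gordonU Z Y * (b * (S ^+ 2 * (M' * M)) + S * ((2 / Num.sqrt tau + b) * (M' * M))) =
  (b * (gordonU Z Y * S ^+ 2) + (2 / Num.sqrt tau + b) * (gordonU Z Y * S)) * (M' * M) by ring.
rewrite ler_wpM2r//.
have tb : 0 <= 2 / Num.sqrt tau + b by rewrite addr_ge0// ltW.
have w1 : b * (gordonU Z Y * S ^+ 2) <= b * 4 by rewrite ler_wpM2l// ltW.
have w2 : (2 / Num.sqrt tau + b) * (gordonU Z Y * S) <= (2 / Num.sqrt tau + b) * 1.
  by rewrite ler_wpM2l.
lra.
Qed.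

End gordon_bounds.

(** * Interpolation between the Gaussian matrix and the decoupled vectors *)

Section gordon.
Context {R : realType} (F I J : finType).
Variables (V : F -> J -> R) (psi : F -> R) (tau b : R).
Hypotheses (tau0 : 0 < tau) (b0 : 0 < b).

(* Gaussian coordinates: the matrix entries G i j and a scalar g0 on one side of
   the comparison, the vectors g and h on the other. *)
Definition gordon_index : finType := ((I * J + unit) + (I + J))%type.
Local Notation K := gordon_index.
Local Notation TT := (#|K|.-tuple (measurableTypeR R)).
Local Notation snorm := (@snorm R F I tau).
Local Notation weight := (@weight R F I tau b).
Local Notation gordonU := (@gordonU R F I tau b).
Local Notation dlin := (@dlin R F I tau).
Local Notation dlin2 := (@dlin2 R F I tau).

Definition ent (t : TT) i j : R := crd t (inl (inl (i, j)) : K).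
Definition sg0 (t : TT) : R := crd t (inl (inr tt) : K).
Definition rowg (t : TT) i : R := crd t (inr (inl i) : K).
Definition colg (t : TT) j : R := crd t (inr (inr j) : K).

Definition vnorm v : R := Num.sqrt (\sum_j V v j ^+ 2).

(** [azc s c k] and [ayc s c k] are the coefficients of the [k]-th Gaussian in the interpolated
    pair, [s] and [c] being the sine and cosine of the angle; differentiating in the angle turns
    [(s, c)] into [(c, - s)]. The scalar coordinate equalises the variances at the two ends. *)
Definition azc (s c : R) (k : K) (v : F) (i : I) : R :=
  match k with
  | inl (inl (i', j)) => s * (i == i')%:R * V v j
  | inl (inr _) => 0
  | inr (inl i') => c * (i == i')%:R * vnorm v
  | inr (inr _) => 0
  end.

Definition ayc (s c : R) (k : K) (v : F) : R :=
  match k with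
  | inl (inl _) => 0
  | inl (inr _) => s * vnorm v
  | inr (inl _) => 0
  | inr (inr j) => c * V v j
  end.

Definition Zi (s c : R) (t : TT) v i : R := \sum_k crd t k * azc s c k v i.
Definition Yi (s c : R) (t : TT) v : R := psi v + \sum_k crd t k * ayc s c k v.

Lemma sum_gordon_index (f : K -> R) : \sum_k f k =
  (\sum_i \sum_j f (inl (inl (i, j))) + f (inl (inr tt))) +
  (\sum_i f (inr (inl i)) + \sum_j f (inr (inr j))).
Proof.
rewrite big_sumType/= big_sumType/= [X in _ + X = _]big_sumType/=; congr (_ + _ + _).
  by rewrite pair_bigA/=; apply: eq_bigr => -[i j] _.
by rewrite (big_pred1 tt)// => -[].
Qed.

Lemma sum_delta (f : I -> R) (i : I) : \sum_i' f i' * (i' == i)%:R = f i.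
Proof.
rewrite (bigD1 i)//= eqxx mulr1 big1 ?addr0// => j /negbTE ->.
by rewrite mulr0.
Qed.

Lemma sum_delta' (f : I -> R) (i : I) : \sum_i' f i' * (i == i')%:R = f i.
Proof. by rewrite -[RHS]sum_delta; apply: eq_bigr => j _; rewrite eq_sym. Qed.

Lemma ZiE s c t v i : Zi s c t v i = s * (\sum_j ent t i j * V v j) + c * (rowg t i * vnorm v).
Proof.
rewrite /Zi sum_gordon_index/= mulr0 addr0; congr (_ + _).
  transitivity (\sum_i' (s * \sum_j ent t i' j * V v j) * (i == i')%:R).
    apply: eq_bigr => i' _; rewrite mulr_sumr mulr_suml; apply: eq_bigr => j _.
    by rewrite /ent; ring.
  by rewrite sum_delta'.
rewrite [X in _ + X]big1 ?addr0; last by move=> j _; rewrite mulr0.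
transitivity (\sum_i' (c * (rowg t i' * vnorm v)) * (i == i')%:R); last by rewrite sum_delta'.
by apply: eq_bigr => i' _; rewrite /rowg; ring.
Qed.

Lemma YiE s c t v : Yi s c t v = psi v + s * (sg0 t * vnorm v) + c * \sum_j colg t j * V v j.
Proof.
rewrite /Yi sum_gordon_index/= big1 ?add0r; last first.
  by move=> i _; apply: big1 => j _; rewrite mulr0.
rewrite [X in _ + (_ + (X + _))]big1 ?add0r; last by move=> i _; rewrite mulr0.
rewrite addrA mulr_sumr; congr (_ + _ + _); first by rewrite /sg0; ring.
by apply: eq_bigr => j _; rewrite /colg; ring.
Qed.

Lemma vnorm_sqr v : vnorm v ^+ 2 = \sum_j V v j ^+ 2.
Proof. by rewrite sqr_sqrtr// sumr_ge0// => j _; exact: sqr_ge0. Qed.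

Section positivity.
Variables (s c : R) (Z : F -> I -> R) (Y : F -> R).
Hypothesis sc : 0 <= s * c.

Let dl s c k v := dlin Z (azc s c k) (ayc s c k) v.
Let n v i := Z v i / snorm Z v.
Let dotV v w := \sum_j V v j * V w j.
Let dotn v w := \sum_i n v i * n w i.

Let dl_ent s' c' i j v : dl s' c' (inl (inl (i, j))) v = s' * V v j * n v i.
Proof.
rewrite /dl /dlin /= addr0 /n mulrA; congr (_ / _).
rewrite -(sum_delta (fun i' => s' * V v j * Z v i')).
by apply: eq_bigr => i' _; ring.
Qed.

Let dl_sg0 s' c' v : dl s' c' (inl (inr tt)) v = s' * vnorm v.
Proof.
by rewrite /dl /dlin /= big1 ?mul0r ?add0r// => i _; rewrite mulr0.
Qed.

Let dl_row s' c' i v : dl s' c' (inr (inl i)) v = c' * vnorm v * n v i.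
Proof.
rewrite /dl /dlin /= addr0 /n mulrA; congr (_ / _).
rewrite -(sum_delta (fun i' => c' * vnorm v * Z v i')).
by apply: eq_bigr => i' _; ring.
Qed.

Let dl_col s' c' j v : dl s' c' (inr (inr j)) v = c' * V v j.
Proof.
by rewrite /dl /dlin /= big1 ?mul0r ?add0r// => i _; rewrite mulr0.
Qed.

(** The matrix entries give [dotV * dotn], the scalar gives the product of norms, and the two
    vectors give minus the mixed terms, so the sum factors. *)
Lemma sum_dlin_dlin v w : \sum_k dl s c k v * dl c (- s) k w =
  s * c * ((vnorm v * vnorm w - dotV v w) * (1 - dotn v w)).
Proof.
rewrite sum_gordon_index dl_sg0 dl_sg0.
under eq_bigr do under eq_bigr do rewrite !dl_ent.
under [X in _ + (X + _)]eq_bigr do rewrite !dl_row.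
under [X in _ + (_ + X)]eq_bigr do rewrite !dl_col.
have -> : \sum_i \sum_j s * V v j * n v i * (c * V w j * n w i) = s * c * (dotV v w * dotn v w).
  rewrite /dotV /dotn mulrC big_distrlr/= mulr_suml exchange_big/=.
  by apply: eq_bigr => j _; rewrite mulr_suml; apply: eq_bigr => i _; ring.
have -> : \sum_i c * vnorm v * n v i * (- s * vnorm w * n w i) = - (s * c) * (vnorm v * vnorm w * dotn v w).
  by rewrite /dotn !mulr_sumr; apply: eq_bigr => i _; ring.
have -> : \sum_j c * V v j * (- s * V w j) = - (s * c) * dotV v w.
  by rewrite /dotV !mulr_sumr; apply: eq_bigr => i _; ring.
by ring.
Qed.

(** The matrix row [i] and the entry [g i] contribute opposite multiples of the same quantity, since
    [vnorm v ^+ 2] is the sum of the [V v j ^+ 2]. *)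
Lemma sum_dlin2 v : \sum_k dlin2 Z (azc s c k) (azc c (- s) k) v = 0.
Proof.
rewrite sum_gordon_index.
have d1 i j : dlin2 Z (azc s c (inl (inl (i, j)))) (azc c (- s) (inl (inl (i, j)))) v =
   s * c * V v j ^+ 2 * ((snorm Z v)^-1 - Z v i ^+ 2 / snorm Z v ^+ 3).
  rewrite /dlin2 /=.
  have -> : \sum_i' s * (i' == i)%:R * V v j * (c * (i' == i)%:R * V v j) = s * c * V v j ^+ 2.
    rewrite -(sum_delta (fun=> s * c * V v j ^+ 2) i); apply: eq_bigr => i' _.
    by case: eqP => _ /=; ring.
  have h a : \sum_i' Z v i' * (a * (i' == i)%:R * V v j) = a * V v j * Z v i.
    rewrite -(sum_delta (fun i' => a * V v j * Z v i') i); apply: eq_bigr => i' _.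
    by ring.
  rewrite !h; ring.
have d2 i : dlin2 Z (azc s c (inr (inl i))) (azc c (- s) (inr (inl i))) v =
   - (s * c) * vnorm v ^+ 2 * ((snorm Z v)^-1 - Z v i ^+ 2 / snorm Z v ^+ 3).
  rewrite /dlin2 /=.
  have -> : \sum_i' c * (i' == i)%:R * vnorm v * (- s * (i' == i)%:R * vnorm v) = - (s * c) * vnorm v ^+ 2.
    rewrite -(sum_delta (fun=> - (s * c) * vnorm v ^+ 2) i); apply: eq_bigr => i' _.
    by case: eqP => _ /=; ring.
  have h a : \sum_i' Z v i' * (a * (i' == i)%:R * vnorm v) = a * vnorm v * Z v i.
    rewrite -(sum_delta (fun i' => a * vnorm v * Z v i') i); apply: eq_bigr => i' _.
    by ring.
  rewrite !h; ring.
have z0 : dlin2 Z (fun _ _ => 0) (fun _ _ => 0) v = 0.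
  by rewrite /dlin2 !big1 ?mul0r ?subr0// => i _; rewrite mulr0.
rewrite [X in _ + X + _]z0 addr0 [X in _ + (_ + X)]big1 ?addr0; last by move=> j _; exact: z0.
under eq_bigr do under eq_bigr do rewrite d1.
under [X in _ + X]eq_bigr do rewrite d2.
rewrite vnorm_sqr -big_split/= big1// => i _.
rewrite -mulr_suml -mulr_sumr; ring.
Qed.

(* Gordon's sign condition: the summed second derivative has the sign of
   (|v||w| - <v,w>)(1 - <n_v,n_w>) with n_v = Z v / snorm Z v, and both factors
   are nonnegative. *)
Lemma sum_gordonD2_ge0 :
  0 <= \sum_k gordonD2 tau b Z Y (azc s c k) (ayc s c k) (azc c (- s) k) (ayc c (- s) k).
Proof.
rewrite /gordonD2 -mulr_sumr mulr_ge0//.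
  by rewrite mulr_ge0 ?(ltW b0)// ltW// gordonU_gt0.
rewrite big_split/=.
set w := weight Z Y.
have w0 v : 0 <= w v by exact: expR_ge0.
have -> : \sum_k b * (\sum_v w v * dlin Z (azc s c k) (ayc s c k) v) *
    (\sum_v w v * dlin Z (azc c (- s) k) (ayc c (- s) k) v) =
    b * \sum_v \sum_v' w v * w v' * (s * c * ((vnorm v * vnorm v' - dotV v v') * (1 - dotn v v'))).
  rewrite mulr_sumr.
  under eq_bigr do rewrite -mulrA big_distrlr/=.
  rewrite -mulr_sumr -mulr_sumr; congr (_ * _).
  rewrite exchange_big/=; apply: eq_bigr => v _.
  rewrite exchange_big/=; apply: eq_bigr => v' _.
  rewrite -sum_dlin_dlin mulr_sumr; apply: eq_bigr => k _.
  by rewrite /dl; ring.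
have -> : \sum_k \sum_v w v * (dlin2 Z (azc s c k) (azc c (- s) k) v -
     b * dlin Z (azc s c k) (ayc s c k) v * dlin Z (azc c (- s) k) (ayc c (- s) k) v) = 0.
  rewrite exchange_big/= big1// => v _.
  (* The products that remain are diagonal, and [vnorm v * vnorm v - dotV v v = 0]. *)
  rewrite -mulr_sumr sumrB sum_dlin2.
  under eq_bigr do rewrite -mulrA.
  rewrite -mulr_sumr (sum_dlin_dlin v v) -expr2 vnorm_sqr.
  have -> : dotV v v = \sum_j V v j ^+ 2 by [].
  by rewrite subrr; ring.
rewrite addr0 mulr_ge0 ?(ltW b0)// sumr_ge0// => v _; rewrite sumr_ge0// => v' _.
apply: mulr_ge0; first exact: mulr_ge0.
apply: mulr_ge0 => //; apply: mulr_ge0; rewrite subr_ge0; first exact: cauchy_schwarz_sum.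
have s1 := snorm_gt0 tau0 Z v; have s2 := snorm_gt0 tau0 Z v'.
(* The vectors [n v] have norm at most 1, because [snorm] contains the additional [tau]. *)
have -> : dotn v v' = (\sum_i Z v i * Z v' i) / (snorm Z v * snorm Z v').
  rewrite mulr_suml; apply: eq_bigr => i _; rewrite /n; field.
  by rewrite !gt_eqF.
rewrite ler_pdivrMr ?mulr_gt0// mul1r.
apply: (le_trans (cauchy_schwarz_sum _ _)); apply: ler_pM; rewrite ?sqrtr_ge0//;
  by rewrite ler_wsqrtr// lerDl ltW.
Qed.

End positivity.

(** Linearity of [gordonD] in the direction: it puts the angular derivative in the form
    [\sum_k crd t k * B k] on which integration by parts acts. *)
Lemma gordonD_sum Z Y (t : TT) s c :
  gordonD tau b Z Y (fun v i => \sum_k crd t k * azc s c k v i) (fun v => \sum_k crd t k * ayc s c k v) =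
  \sum_k crd t k * gordonD tau b Z Y (azc s c k) (ayc s c k).
Proof.
rewrite /gordonD.
transitivity (b * gordonU Z Y * \sum_k \sum_v crd t k * (weight Z Y v * dlin Z (azc s c k) (ayc s c k) v)).
  congr (_ * _); rewrite exchange_big/=; apply: eq_bigr => v _.
  transitivity (weight Z Y v * \sum_k crd t k * dlin Z (azc s c k) (ayc s c k) v); last first.
    by rewrite mulr_sumr; apply: eq_bigr => k _; ring.
  congr (_ * _); rewrite /dlin.
  transitivity (\sum_k (crd t k * ((\sum_i Z v i * azc s c k v i) / snorm Z v) + crd t k * ayc s c k v)); last first.
    by apply: eq_bigr => k _; rewrite mulrDr.
  rewrite big_split/=; congr (_ + _).
  under eq_bigr do rewrite mulr_sumr.
  rewrite exchange_big/= mulr_suml; apply: eq_bigr => k _.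
  rewrite mulrA mulr_sumr; congr (_ / _); apply: eq_bigr => i _; ring.
rewrite mulr_sumr; apply: eq_bigr => k _; rewrite -mulr_sumr; ring.
Qed.

End gordon.

Lemma is_derive_lin_upd {R : realType} (K : finType) (t : #|K|.-tuple (measurableTypeR R))
    (k : K) (A : K -> R) (x : R) :
  is_derive x (1 : R) (fun x : R => \sum_j (crd (upd t k x) j : R) * A j) (A k).
Proof.
have -> : (fun x : R => \sum_j (crd (upd t k x) j : R) * A j) =
    (fun x : R => x * A k + \sum_(j | j != k) (crd t j : R) * A j).
  apply/funext => y; rewrite (bigD1 k)//= crd_upd eqxx; congr (_ + _).
  by apply: eq_bigr => j jk; rewrite crd_upd (negbTE jk).
apply: is_derive_eq; rewrite /GRing.scale/=; ring.
Qed.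

Section comparison.
Context {R : realType} (F I J : finType).
Variables (V : F -> J -> R) (psi : F -> R) (tau b : R).
Hypotheses (tau0 : 0 < tau) (b0 : 0 < b).
Local Notation K := (gordon_index I J).
Local Notation TT := (#|K|.-tuple (measurableTypeR R)).
Local Notation az := (@azc R F I J V).
Local Notation ay := (@ayc R F I J V).
Local Notation Z := (@Zi R F I J V).
Local Notation Y := (@Yi R F I J V psi).

Let B0 v : R := \sum_j `|V v j| + vnorm V v.
Let A : R := \sum_v (\sum_(i : I) B0 v + B0 v).

Let vn0 v : 0 <= vnorm V v. Proof. exact: sqrtr_ge0. Qed.

Let VB v j : `|V v j| <= B0 v.
Proof.
by rewrite /B0 (bigD1 j)//= -addrA lerDl addr_ge0// sumr_ge0.
Qed.

Let nB v : vnorm V v <= B0 v.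
Proof. by rewrite /B0 lerDr sumr_ge0. Qed.

Let dirA s c k : `|s| <= 1 -> `|c| <= 1 -> dirsize (az s c k) (ay s c k) <= A.
Proof.
move=> s1 c1.
have Bge v : 0 <= B0 v by apply: le_trans (vn0 v) (nB v).
have aB v (x d : R) : `|x| <= 1 -> `|d| <= B0 v -> `|x * d| <= B0 v.
  by move=> x1 dB; rewrite normrM (le_trans (ler_piMl _ x1)).
have delta (i i' : I) : `|(i == i')%:R : R| <= 1 by case: eqP; rewrite ?normr1 ?normr0.
have nn v : `|vnorm V v| <= B0 v by rewrite ger0_norm.
apply: ler_sum => v _; apply: lerD; first (apply: ler_sum => i _).
- case: k => [[[i' j]|u]|[i'|j]] /=; rewrite ?normr0// -mulrA; apply: (aB) => //; exact: (aB).
- case: k => [[[i' j]|u]|[i'|j]] /=; rewrite ?normr0//; exact: (aB).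
Qed.

Let mZ s c v i : measurable_fun setT (fun t : TT => Z s c t v i).
Proof.
apply: measurable_sum => k; apply: measurable_funM => //; exact: measurable_crd.
Qed.

Let mY s c v : measurable_fun setT (fun t : TT => Y s c t v).
Proof.
apply: measurable_funD => //; apply: measurable_sum => k.
by apply: measurable_funM => //; exact: measurable_crd.
Qed.

Let U th (t : TT) : R := gordonU tau b (Z (sin th) (cos th) t) (Y (sin th) (cos th) t).

(** Angle 0 is the decoupled problem and angle [pi / 2] the matrix problem; between them sine and
    cosine are positive, so the sign condition makes the expected functional nondecreasing. *)
Lemma gordon_interp :
  \int[gauss K]_t gordonU tau b (Z 0 1 t) (Y 0 1 t) <=
  \int[gauss K]_t gordonU tau b (Z 1 0 t) (Y 1 0 t).
Proof.
pose Bf th k t := gordonD tau b (Z (sin th) (cos th) t) (Y (sin th) (cos th) t)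
  (az (cos th) (- sin th) k) (ay (cos th) (- sin th) k).
pose E th k t := gordonD2 tau b (Z (sin th) (cos th) t) (Y (sin th) (cos th) t)
  (az (sin th) (cos th) k) (ay (sin th) (cos th) k)
  (az (cos th) (- sin th) k) (ay (cos th) (- sin th) k).
have A0 : 0 <= A.
  apply: sumr_ge0 => v _; have h := le_trans (vn0 v) (nB v).
  by rewrite addr_ge0// sumr_ge0.
have q0 : 0 <= b * (5 * b + 2 / Num.sqrt tau).
  by rewrite mulr_ge0 ?(ltW b0)// addr_ge0 ?divr_ge0 ?sqrtr_ge0// mulr_ge0// ltW.
have bA : 0 <= b * A by rewrite mulr_ge0// ltW.
have qA : 0 <= b * (5 * b + 2 / Num.sqrt tau) * (A * A) by apply: mulr_ge0 => //; exact: mulr_ge0.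
pose C := 1 + b * A + b * (5 * b + 2 / Num.sqrt tau) * (A * A).
have s1 (th : R) : `|sin th| <= 1.
  by rewrite ler_norml sin_geN1 sin_le1.
have c1 (th : R) : `|cos th| <= 1.
  by rewrite ler_norml cos_geN1 cos_le1.
have s1N (th : R) : `|- sin th| <= 1 by rewrite normrN.
have U0E (t : TT) : gordonU tau b (Z 0 1 t) (Y 0 1 t) = U 0 t by rewrite /U sin0 cos0.
have U1E (t : TT) : gordonU tau b (Z 1 0 t) (Y 1 0 t) = U (pi / 2) t.
  by rewrite /U sin_pihalf cos_pihalf.
under eq_Rintegral do rewrite U0E.
under [leRHS]eq_Rintegral do rewrite U1E.
apply: (@gauss_interpolation R K U Bf E 0 (pi / 2) C).
- by rewrite divr_gt0// pi_gt0.
- by move=> th; exact: measurable_gordonU.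
- by move=> th k; exact: measurable_gordonD.
- by move=> th k; exact: measurable_gordonD2.
- move=> th t; rewrite gtr0_norm ?gordonU_gt0//.
  apply: (le_trans (gordonU_le1 _ _ _ _)); rewrite /C; lra.
- move=> th k t; apply: (le_trans (gordonD_le tau0 b0 _ _ _ _)).
  apply: (@le_trans _ _ (b * A)); last by rewrite /C; lra.
  by rewrite ler_wpM2l ?(ltW b0)//; exact: dirA.
- move=> th k t; apply: (le_trans (gordonD2_le tau0 b0 _ _ _ _ _ _)).
  apply: (@le_trans _ _ (b * (5 * b + 2 / Num.sqrt tau) * (A * A))); last by rewrite /C; lra.
  rewrite ler_wpM2l//; apply: ler_pM; rewrite ?dirsize_ge0//; exact: dirA.
- move=> t th; rewrite -gordonD_sum; apply: is_derive_gordonU => // [v i|v].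
    rewrite -/(Z (cos th) (- sin th) t v i) ZiE.
    have -> : (fun t0 => Z (sin t0) (cos t0) t v i) =
      (fun t0 => sin t0 * (\sum_j ent t i j * V v j) + cos t0 * (rowg t i * vnorm V v)).
      by apply/funext => y; rewrite ZiE.
    apply: is_derive_eq; rewrite /GRing.scale/=; ring.
  have -> : (fun t0 => Y (sin t0) (cos t0) t v) =
      (fun t0 => psi v + sin t0 * (sg0 t * vnorm V v) + cos t0 * \sum_j colg t j * V v j).
    by apply/funext => y; rewrite YiE.
  have -> : \sum_k crd t k * ay (cos th) (- sin th) k v = Y (cos th) (- sin th) t v - psi v.
    by rewrite /Yi; ring.
  rewrite YiE; apply: is_derive_eq; rewrite /GRing.scale/=; ring.
- move=> th k t x; apply: is_derive_gordonD => // [v i|v].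
    exact: (is_derive_lin_upd t k (fun k => az (sin th) (cos th) k v i)).
  have h := is_derive_lin_upd t k (fun k => ay (sin th) (cos th) k v) x.
  by apply: (is_derive_eq (is_deriveD (is_derive_cst (psi v) x (1 : R)) h)); rewrite add0r.
- move=> th k t x; apply: continuous_gordonD2 => // [v i|v].
    have [h _] := is_derive_lin_upd t k (fun k => az (sin th) (cos th) k v i) x.
    exact/differentiable_continuous/derivable1_diffP.
  have [h _] := is_derive_lin_upd t k (fun k => ay (sin th) (cos th) k v) x.
  apply: continuousD; first exact: cvg_cst.
  exact/differentiable_continuous/derivable1_diffP.
- move=> th t /andP[th0 thpi]; apply: sum_gordonD2_ge0 => //.
  apply: mulr_ge0.
    apply/ltW/sin_gt0_pi; rewrite th0/= (lt_trans thpi)//.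
    by rewrite ltr_pdivrMr// ltr_pMr ?pi_gt0// ltr1n.
  by apply/ltW/cos_gt0_pihalf; rewrite thpi andbT (lt_trans _ th0)// oppr_lt0 divr_gt0// pi_gt0.
Qed.

End comparison.

(** * From the smooth functional to probabilities of events *)

Lemma measurable_exists_le {R : realType} d (T : measurableType d) (F : finType)
    (f : F -> T -> R) (c : R) : (forall v, measurable_fun setT (f v)) ->
  measurable [set t | exists v, f v t <= c].
Proof.
move=> mf; rewrite (_ : mkset _ = \bigcup_(v in [set: F]) (f v @^-1` `]-oo, c])).
  apply: fin_bigcup_measurable => // v _.
  by rewrite -[X in measurable X]setTI; apply: mf => //; exact: measurable_itv.
by apply/seteqP; split => t /= [v]; [move=> h; exists v => //=; rewrite in_itv
  |move=> _ /=; rewrite in_itv/= => h; exists v].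
Qed.

Lemma measurable_exists_lt {R : realType} d (T : measurableType d) (F : finType)
    (f : F -> T -> R) (c : R) : (forall v, measurable_fun setT (f v)) ->
  measurable [set t | exists v, f v t < c].
Proof.
move=> mf; rewrite (_ : mkset _ = \bigcup_(v in [set: F]) (f v @^-1` `]-oo, c[)).
  apply: fin_bigcup_measurable => // v _.
  by rewrite -[X in measurable X]setTI; apply: mf => //; exact: measurable_itv.
by apply/seteqP; split => t /= [v]; [move=> h; exists v => //=; rewrite in_itv
  |move=> _ /=; rewrite in_itv/= => h; exists v].
Qed.

Lemma normal_prob_neg_gt0 {R : realType} :
  (0 < normal_prob (0 : R) 1 `]-oo, 0%R : R]%classic)%E.
Proof.
have mI : measurable `[(-1)%R : R, 0%R]%classic by exact: measurable_itv.
apply: (@lt_le_trans _ _ (normal_prob (0 : R) 1 `[(-1)%R : R, 0%R]%classic)); last first.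
  apply: le_measure; rewrite ?inE//=; try exact: measurable_itv.
  by move=> x /=; rewrite !in_itv/= => /andP[].
apply: (@lt_le_trans _ _ (\int[@lebesgue_measure R]_(x in `[(-1)%R : R, 0%R]%classic) (normal_pdf (0 : R) 1 1)%:E)%E).
  have E : @lebesgue_measure R `[(-1)%R : R, 0%R]%classic = 1%E.
    by rewrite lebesgue_measure_itv/= lte_fin oppr_lt0 ltr01 -EFinD; congr EFin; lra.
  rewrite integral_cst// [X in (_ * X)%E]E mule1 lte_fin normal_pdf1E.
  by rewrite mulr_gt0 ?expR_gt0// normal_peak_gt0// oner_neq0.
apply: ge0_le_integral => //.
- by move=> x _; rewrite lee_fin normal_pdf_ge0.
- by apply/measurable_EFinP; apply: measurable_funTS; exact: measurable_normal_pdf.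
- move=> x /=; rewrite in_itv/= => /andP[x1 x0].
  rewrite lee_fin !normal_pdf1E !subr0 ler_wpM2l ?normal_peak_ge0// ler_expR.
  nra.
Qed.

Section gordon_probability.
Context {R : realType} (F I J : finType).
Variables (V : F -> J -> R) (psi : F -> R) (tau : R).
Hypotheses (tau0 : 0 < tau).
Local Notation K := (gordon_index I J).
Local Notation RT := (measurableTypeR R).
Local Notation TT := (#|K|.-tuple (measurableTypeR R)).
Local Notation Z := (@Zi R F I J V).

Definition primal (t : TT) v : R :=
  Num.sqrt (\sum_i (\sum_j ent t i j * V v j) ^+ 2 + tau) + psi v.

Definition auxil (t : TT) v : R :=
  Num.sqrt (\sum_i (rowg t i * vnorm V v) ^+ 2 + tau) + \sum_j colg t j * V v j + psi v.

(** One weight that is at least 1 brings [gordonU] down to [expR (- 1)] or less, whence the first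
    factor; the second is the price of restricting to [sg0 t <= 0]. *)
Definition gordon_const : R :=
  (1 - expR (- 1)) * fine (normal_prob (0 : R) 1 `]-oo, 0%R : R]%classic).

Lemma gordon_const_gt0 : 0 < gordon_const.
Proof.
apply: mulr_gt0; first by rewrite subr_gt0 -[ltRHS]expR0 ltr_expR; lra.
rewrite fine_gt0// normal_prob_neg_gt0/=.
by apply: (le_lt_trans (probability_le1 _ _)); [exact: measurable_itv|exact: ltry].
Qed.

Lemma measurable_primal v : measurable_fun setT (primal ^~ v).
Proof.
apply: measurable_funD => //; apply: (measurableT_comp measurable_sqrt).
apply: measurable_funD => //; apply: measurable_sum => i; apply: measurable_funX.
by apply: measurable_sum => j; apply: measurable_funM => //; exact: measurable_crd.
Qed.

Lemma measurable_auxil v : measurable_fun setT (auxil ^~ v).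
Proof.
apply: measurable_funD => //; apply: measurable_funD; last first.
  by apply: measurable_sum => j; apply: measurable_funM => //; exact: measurable_crd.
apply: (measurableT_comp measurable_sqrt).
apply: measurable_funD => //; apply: measurable_sum => i; apply: measurable_funX.
by apply: measurable_funM => //; exact: measurable_crd.
Qed.

Variables (c0 a : R).
Hypothesis a0 : 0 < a.

Let PO : set TT := [set t | exists v, primal t v <= c0].
Let AO : set TT := [set t | exists v, auxil t v < c0 + a].
Let B : set TT := PO `&` [set t | sg0 t <= 0].

Let mPO : measurable PO.
Proof. by apply: measurable_exists_le => v; exact: measurable_primal. Qed.

Let mAO : measurable AO.
Proof. by apply: measurable_exists_lt => v; exact: measurable_auxil. Qed.

Let mB : measurable B.
Proof.
apply: measurableI => //; rewrite (_ : [set t | _] = crd ^~ (inl (inr tt) : K) @^-1` `]-oo, 0%R : R]%classic).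
  by rewrite -[X in measurable X]setTI; apply: measurable_crd => //; exact: measurable_itv.
by apply/seteqP; split => t /=; rewrite in_itv.
Qed.

(** [primal] does not involve [sg0], so resampling that coordinate exhibits the independence of the
    two events. *)
Let BE : gauss K B = (gauss K PO * normal_prob (0 : R) 1 `]-oo, 0%R : R]%classic)%E.
Proof.
have <- : (gauss K \x normal_prob (0 : R) 1)%E (PO `*` `]-oo, 0%R : R]%classic) =
    (gauss K PO * normal_prob (0 : R) 1 `]-oo, 0%R : R]%classic)%E.
  by apply: product_measure1E; [exact: mPO|exact: measurable_itv].
rewrite {1}/gauss (prodP_resample _ (inl (inr tt) : K) mB).
rewrite image_probE; congr (_ _); apply/seteqP; split => -[t x] /=.
  move=> [[v pv]]; rewrite /= /sg0 crd_upd eqxx => x0; split; last by rewrite in_itv.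
  exists v; move: pv; rewrite /primal /ent; under eq_bigr do under eq_bigr do rewrite crd_upd//=.
  by [].
move=> [[v pv]]; rewrite in_itv /= => x0; split; last by rewrite /= /sg0 crd_upd eqxx.
exists v; move: pv; rewrite /primal /ent; under [in X in _ -> X]eq_bigr do under eq_bigr do rewrite crd_upd//=.
by [].
Qed.

(** On [B] some weight is at least 1, so the functional at the matrix end is at most [expR (- 1)].
    Off [AO] every weight is at most [expR (- b * a)], so the functional at the decoupled end is at
    least 1 minus the error term. The interpolation inequality links the two ends. *)
Lemma gordon_comparison_b (b : R) : 0 < b ->
  gordon_const * fine (gauss K PO) <= fine (gauss K AO) + #|F|%:R * expR (- b * a).
Proof.
move=> b0.
have arith (q e z : R) : 1 - e - q <= 1 - z -> z <= q + e by lra.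
pose UA (t : TT) : R := gordonU tau b (Z 0 1 t) (Yi V (fun v => psi v - c0) 0 1 t).
pose UP (t : TT) : R := gordonU tau b (Z 1 0 t) (Yi V (fun v => psi v - c0) 1 0 t).
have mU s c : measurable_fun setT (fun t : TT => gordonU tau b (Z s c t) (Yi V (fun v => psi v - c0) s c t)).
  apply: measurable_gordonU => [v i|v].
    by apply: measurable_sum => k; apply: measurable_funM => //; exact: measurable_crd.
  apply: measurable_funD => //; apply: measurable_sum => k.
  by apply: measurable_funM => //; exact: measurable_crd.
have U1 s c t : `|gordonU tau b (Z s c t) (Yi V (fun v => psi v - c0) s c t)| <= 1.
  by rewrite gtr0_norm ?gordonU_gt0//; exact: gordonU_le1.
have iUA : (gauss K).-integrable setT (EFin \o UA).
  by apply: (@integrable_gauss_bounded _ _ _ 1); [exact: mU|exact: U1].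
have iUP : (gauss K).-integrable setT (EFin \o UP).
  by apply: (@integrable_gauss_bounded _ _ _ 1); [exact: mU|exact: U1].
have iind (D : set TT) : measurable D -> (gauss K).-integrable setT (EFin \o (\1_D : TT -> R)).
  by move=> mD; apply: integrable_indic => //; rewrite ltey_eq fin_num_measure.
have Iind (D : set TT) : measurable D -> \int[gauss K]_t (\1_D t : R) = fine (gauss K D).
  by move=> mD; rewrite /Rintegral integral_indic// setIT.
have icst (r : R) : (gauss K).-integrable setT (EFin \o (cst r : TT -> R)).
  exact: finite_measure_integrable_cst.
have Icst (r : R) : \int[gauss K]_t (cst r t : R) = r.
  rewrite Rintegral_cst// [X in fine X](_ : _ = 1%E) ?mulr1//.
  exact: (probability_setT (gauss K)).
have e1 : 0 < 1 - expR (- 1) :> R by rewrite subr_gt0 -[ltRHS]expR0 ltr_expR; lra.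
pose eta : R := #|F|%:R * expR (- b * a).
have ubP : \int[gauss K]_t UP t <= 1 - (1 - expR (- 1)) * fine (gauss K B).
  rewrite -[X in X - _](Icst 1) -(Iind _ mB) -RintegralZl//; last exact: iind.
  rewrite -RintegralB//; last first.
    by have := integrableZl measurableT (1 - expR (- 1)) (iind _ mB).
  apply: le_Rintegral => //.
    have := integrableB measurableT (icst 1) (integrableZl measurableT (1 - expR (- 1)) (iind _ mB)).
    by apply: eq_integrable.
  move=> t _; rewrite indicE; have [tB|tB] := boolP (t \in B); last first.
    by rewrite mulr0 subr0; exact: gordonU_le1.
  rewrite mulr1 subKr; move: tB; rewrite inE => -[[v pv]] /= s0.
  rewrite /UP /gordonU ler_expR lerN2.
  rewrite (bigD1 v)//= -[leLHS]addr0 lerD//; last first.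
    by rewrite sumr_ge0// => w _; exact: expR_ge0.
  rewrite /weight -[leLHS]expR0 ler_expR YiE mul0r addr0 mul1r.
  rewrite mulNr oppr_ge0 pmulr_rle0//.
  have -> : snorm tau (Z 1 0 t) v = Num.sqrt (\sum_i (\sum_j ent t i j * V v j) ^+ 2 + tau).
    by rewrite /snorm; congr (Num.sqrt (_ + _)); apply: eq_bigr => i _; rewrite ZiE mul0r mul1r addr0.
  move: pv; rewrite /primal => pv.
  have : sg0 t * vnorm V v <= 0 by rewrite mulr_le0_ge0// sqrtr_ge0.
  lra.
have lbA : 1 - eta - fine (gauss K AO) <= \int[gauss K]_t UA t.
  clear ubP.
  rewrite -(Icst (1 - eta)) -(Iind _ mAO) -RintegralB//; last exact: iind.
  apply: le_Rintegral => //.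
    have := integrableB measurableT (icst (1 - eta)) (iind _ mAO).
    by apply: eq_integrable.
  move=> t _; rewrite indicE; have [tA|tA] := boolP (t \in AO).
    apply: (@le_trans _ _ 0); last exact/ltW/gordonU_gt0.
    have : 0 <= eta by rewrite mulr_ge0// expR_ge0.
    by rewrite /cst/=; lra.
  rewrite subr0 /UA /gordonU /cst/=.
  apply: le_trans (expR_ge1Dx _); rewrite lerD2l lerN2.
  rewrite /eta -[#|F|%:R]mulr1 -[X in _ <= X * _]/(_) .
  apply: (@le_trans _ _ (\sum_(v : F) expR (- b * a))); last by rewrite sumr_const mulr1 mulr_natl.
  apply: ler_sum => v _; rewrite ler_expR !mulNr lerN2 ler_wpM2l ?(ltW b0)//.
  have nA : c0 + a <= auxil t v.
    by rewrite leNgt; apply: contraNN tA => h; rewrite inE; exists v.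
  rewrite YiE mul0r addr0 mul1r.
  have -> : snorm tau (Z 0 1 t) v = Num.sqrt (\sum_i (rowg t i * vnorm V v) ^+ 2 + tau).
    by rewrite /snorm; congr (Num.sqrt (_ + _)); apply: eq_bigr => i _; rewrite ZiE mul0r mul1r add0r.
  by move: nA; rewrite /auxil; lra.
have fB : fine (gauss K B) = fine (gauss K PO) * fine (normal_prob (0 : R) 1 `]-oo, 0%R : R]%classic).
  rewrite BE fineM//; first exact: fin_num_measure.
  by apply: fin_num_measure; exact: measurable_itv.
have H : \int[gauss K]_t UA t <= \int[gauss K]_t UP t.
  exact: (@gordon_interp R F I J V (fun v => psi v - c0) tau b tau0 b0).
have gc : (1 - expR (- 1)) * fine (gauss K B) = gordon_const * fine (gauss K PO).
  by rewrite fB /gordon_const; ring.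
by apply: arith; rewrite -gc; exact: (le_trans lbA (le_trans H ubP)).
Qed.

Lemma gordon_comparison : gordon_const * fine (gauss K PO) <= fine (gauss K AO).
Proof.
apply/ler_addgt0Pr => e e0.
have N0 : 0 <= #|F|%:R / (a * e) :> R by rewrite divr_ge0// mulr_ge0// ltW.
(* For this [b] the error is at most [e], since [#|F| <= e * (b * a) <= e * expR (b * a)]. The
   cardinality thus disappears, which later permits countable families. *)
have b0 : 0 < #|F|%:R / (a * e) + 1 :> R by rewrite ltr_wpDl.
apply: (le_trans (gordon_comparison_b b0)); rewrite lerD2l.
set b := _ + 1 in b0 *.
rewrite mulNr expRN ler_pdivrMr ?expR_gt0//.
apply: (@le_trans _ _ (e * (b * a))); last first.
  by rewrite ler_wpM2l ?(ltW e0)//; apply: le_trans (expR_ge1Dx _); rewrite lerDr.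
have -> : e * (b * a) = #|F|%:R + e * a by rewrite /b; field; rewrite !gt_eqF.
by rewrite lerDl mulr_ge0// ltW.
Qed.

End gordon_probability.

(** * Exponential moments of the information density *)

Section exponential_moment.
Context {R : realType}.

(** A second-order expansion whose remainder grows exponentially only for negative [u]. *)
Lemma expRN_taylor (u : R) : expR (- u) <= 1 - u + u ^+ 2 * expR (Num.max 0 (- u)).
Proof.
have [u0|u0] := leP 0 u.
  have -> : Num.max 0 (- u) = 0 by apply/max_idPl; rewrite oppr_le0.
  rewrite expR0 mulr1 expRN -[leLHS]mul1r ler_pdivrMr ?expR_gt0//.
  have h := expR_ge1Dx u.
  have p : 0 <= 1 - u + u ^+ 2 by nra.
  apply: le_trans (ler_wpM2l p h).
  have : 0 <= u ^+ 3 by rewrite exprn_ge0.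
  by rewrite (_ : (1 - u + u ^+ 2) * (1 + u) = 1 + u ^+ 3); [lra|ring].
have -> : Num.max 0 (- u) = - u by apply/max_idPr; rewrite oppr_ge0 ltW.
set x := - u in u0 *.
have x0 : 0 < x by rewrite oppr_gt0.
have -> : 1 - u + u ^+ 2 * expR x = 1 + x + x ^+ 2 * expR x by rewrite /x; ring.
have h : expR x * (1 - x) <= 1.
  have := expR_ge1Dx (- x); rewrite expRN => h.
  apply: (le_trans (ler_wpM2l (expR_ge0 x) h)).
  by rewrite divff// gt_eqF// expR_gt0.
have e0 := expR_ge0 x.
have h2 : x * (expR x * (1 - x)) <= x * 1 by rewrite ler_wpM2l// ltW.
lra.
Qed.

Lemma sqr_le_expR (x : R) : 0 <= x -> x ^+ 2 <= 4 * expR x.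
Proof.
move=> x0; have := expR_ge1Dx (x / 2) => h.
have -> : expR x = expR (x / 2) * expR (x / 2) by rewrite -expRD; congr expR; field.
nra.
Qed.

(** Integrate the expansion of [expR (- u)] at [u = k * Y x]: for [k] in [0, 1] the remainder is at
    most [k ^+ 2 * W x], so the integral of [W] serves as [C] for all [k] at once. *)
Lemma exp_moment_bound d (T : measurableType d) (P : probability T R) (Y W : T -> R) :
  P.-integrable setT (EFin \o Y) -> P.-integrable setT (EFin \o W) ->
  (forall x, Y x ^+ 2 * expR (Num.max 0 (- Y x)) <= W x) ->
  exists2 C : R, 0 <= C & forall k, 0 <= k <= 1 ->
    (\int[P]_x (expR (- (k * Y x)))%:E <=
      (expR (- (k * \int[P]_x Y x) + C * k ^+ 2))%:E)%E.
Proof.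
move=> iY iW YW.
have mY : measurable_fun setT Y by apply/measurable_EFinP; exact: measurable_int iY.
have mW : measurable_fun setT W by apply/measurable_EFinP; exact: measurable_int iW.
have W0 x : 0 <= W x by apply: le_trans (YW x); rewrite mulr_ge0 ?sqr_ge0 ?expR_ge0.
exists (\int[P]_x W x); first exact: Rintegral_ge0.
move=> k /andP[k0 k1].
have bnd x : expR (- (k * Y x)) <= 1 - k * Y x + k ^+ 2 * W x.
  apply: (le_trans (expRN_taylor _)); rewrite lerD2l exprMn -mulrA ler_wpM2l ?sqr_ge0//.
  apply: le_trans (YW x); rewrite ler_wpM2l ?sqr_ge0// ler_expR.
  rewrite ge_max le_max lexx/=.
  rewrite -mulrN; have [y0|y0] := leP 0 (- Y x).
    by rewrite ler_piMl.
  by rewrite mulr_ge0_le0// ltW.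
have icst : P.-integrable setT (EFin \o (cst 1 : T -> R)) by exact: finite_measure_integrable_cst.
have ikY : P.-integrable setT (EFin \o (fun x => k * Y x)).
  by have := integrableZl measurableT k iY; apply: eq_integrable.
have ikW : P.-integrable setT (EFin \o (fun x => k ^+ 2 * W x)).
  by have := integrableZl measurableT (k ^+ 2) iW; apply: eq_integrable.
have i1 : P.-integrable setT (EFin \o (fun x => 1 - k * Y x)).
  by have := integrableB measurableT icst ikY; apply: eq_integrable.
have i2 : P.-integrable setT (EFin \o (fun x => 1 - k * Y x + k ^+ 2 * W x)).
  by have := integrableD measurableT i1 ikW; apply: eq_integrable.
apply: (@le_trans _ _ (\int[P]_x (1 - k * Y x + k ^+ 2 * W x)%:E)%E).
  apply: ge0_le_integral => //.
  - apply/measurable_EFinP; apply: (measurableT_comp (@measurable_expR R)).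
    by apply: measurableT_comp => //; exact: measurable_funM.
  - exact: measurable_int i2.
  - by move=> x _; rewrite lee_fin bnd.
have -> : (\int[P]_x (1 - k * Y x + k ^+ 2 * W x)%:E)%E =
    (1 - k * \int[P]_x Y x + k ^+ 2 * \int[P]_x W x)%:E.
  rewrite -[LHS]fineK; last exact: (integrable_fin_num _ i2).
  congr EFin; rewrite -/(Rintegral P setT (fun x => 1 - k * Y x + k ^+ 2 * W x)).
  rewrite (RintegralD measurableT i1 ikW) (RintegralB measurableT icst ikY).
  rewrite RintegralZl// RintegralZl//; congr (_ - _ + _).
  rewrite Rintegral_cst// [X in fine X](_ : _ = 1%E) ?mulr1//.
  exact: (probability_setT P).
rewrite lee_fin; apply: le_trans (expR_ge1Dx _).
by rewrite addrA mulrC (mulrC (k ^+ 2)); lra.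
Qed.

Lemma normal_sqr_exp_bound : exists2 C : R, 0 <= C & forall k, 0 <= k <= 1 ->
  (\int[normal_prob (0 : R) 1]_x (expR (k * (1 - x ^+ 2)))%:E <= (expR (C * k ^+ 2))%:E)%E.
Proof.
pose Y (x : measurableTypeR R) : R := x * x - 1.
have mid : measurable_fun setT (@id (measurableTypeR R)) by exact: measurable_id.
have mxx : measurable_fun setT (fun x : measurableTypeR R => x * x) by exact: measurable_funM.
have mY : measurable_fun setT Y by exact: measurable_funB.
have e12 (x : R) : x * x <= 4 * expR (1 * `|x|).
  by have := sqr_le_expR (normr_ge0 x); rewrite real_normK ?num_real// expr2 mul1r.
have ixx : (normal_prob (0 : R) 1).-integrable setT (EFin \o (fun x : measurableTypeR R => x * x)).
  apply: (@integrable_normal _ _ 4 1) => // x.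
  by rewrite ger0_norm ?e12// -expr2 sqr_ge0.
have icst : (normal_prob (0 : R) 1).-integrable setT (EFin \o (cst 1 : measurableTypeR R -> R)).
  exact: finite_measure_integrable_cst.
have iY : (normal_prob (0 : R) 1).-integrable setT (EFin \o Y).
  by have := integrableB measurableT ixx icst; apply: eq_integrable.
have EY : \int[normal_prob (0 : R) 1]_x Y x = 0.
  rewrite (RintegralB measurableT ixx icst) normal_second_moment.
  rewrite Rintegral_cst// [X in fine X](_ : _ = 1%E) ?mulr1 ?subrr//.
  exact: (probability_setT (normal_prob (0 : R) 1)).
(* Only the lower tail of [x * x] is at stake, and there [- Y x <= 1]; hence the constant
   [expR 1]. *)
pose W (x : measurableTypeR R) : R := (x * x - 1) ^+ 2 * expR 1.
have iW : (normal_prob (0 : R) 1).-integrable setT (EFin \o W).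
  apply: (@integrable_normal _ _ (25 * expR 1) 2) => //.
    by apply: measurable_funM => //; exact: measurable_funX.
  move=> x; rewrite /W ger0_norm; last by apply: mulr_ge0; [exact: sqr_ge0|exact: expR_ge0].
  rewrite [leRHS]mulrAC ler_wpM2r ?expR_ge0//.
  have -> : expR (2 * `|x|) = expR (1 * `|x|) * expR (1 * `|x|) by rewrite -expRD; congr expR; ring.
  have h := e12 x; have h0 : 1 <= expR (1 * `|x|) by rewrite -[leLHS]expR0 ler_expR mul1r.
  have x0 : 0 <= x * x by rewrite -expr2 sqr_ge0.
  nra.
have YW x : Y x ^+ 2 * expR (Num.max 0 (- Y x)) <= W x.
  rewrite /W /Y ler_wpM2l ?sqr_ge0// ler_expR ge_max ler01/=.
  have x0 : 0 <= x * x by rewrite -expr2 sqr_ge0.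
  lra.
have [C C0 CP] := exp_moment_bound iY iW YW.
exists C => // k k01.
have := CP k k01; rewrite EY mulr0 oppr0 add0r; apply: le_trans.
rewrite le_eqVlt; apply/orP; left; apply/eqP; apply: eq_integral => x _.
by congr (expR _)%:E; rewrite /Y; ring.
Qed.

End exponential_moment.

Lemma ae_impl d (T : measurableType d) (R : realType) (mu : {measure set T -> \bar R})
    (Q Q' : T -> Prop) : (forall x, Q x -> Q' x) ->
  {ae mu, forall x, Q x} -> {ae mu, forall x, Q' x}.
Proof.
move=> QQ' [A [mA A0 QA]]; exists A; split => // x /= nQ'.
by apply: QA => Qx; apply: nQ'; exact: QQ'.
Qed.

Section information_density.
Context {R : realType}.
Local Notation RT := (measurableTypeR R).
Local Notation N := (normal_prob (0 : R) 1).
Variables (P0 : probability RT R) (gam M : R).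
Hypotheses (gam0 : 0 < gam) (M0 : 0 <= M) (hM : {ae P0, forall b, `|b| <= M}).

(** [l] is the channel output for input [b] and noise [z]; the value is the logarithm of the joint
    density of input and output relative to the product of their laws. *)
Definition infodens (b z : R) : R :=
  let l := gam * b + Num.sqrt gam * z in
  l * b - gam / 2 * b ^+ 2 - ln (partition_fun P0 l gam).

Definition mean_infodens : R := \int[channel_prob P0]_x infodens x.1 x.2.

Lemma measurable_tilt : measurable_fun setT (fun lb : RT * RT => tilt lb.1 gam lb.2).
Proof.
apply: (measurableT_comp (@measurable_expR R)); apply: measurable_funD.
  by apply: measurable_funM => //; apply: measurable_funX; try exact: measurable_snd.
by apply: measurable_funM; [exact: measurable_fst|exact: measurable_snd].
Qed.

Lemma measurable_tilt2 l : measurable_fun setT (fun b : RT => tilt l gam b).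
Proof. by apply: (measurableT_comp measurable_tilt (pair1_measurable l)). Qed.

Lemma measurable_partition : measurable_fun setT (fun l : RT => partition_fun P0 l gam).
Proof.
have mt : measurable_fun setT (fun lb : RT * RT => (tilt lb.1 gam lb.2)%:E).
  by apply/measurable_EFinP; exact: measurable_tilt.
have := @measurable_fun_fubini_tonelli_F _ _ _ _ R P0 _ mt (fun x => _).
move=> H; apply: measurableT_comp => //.
apply: H => x; rewrite lee_fin; exact: expR_ge0.
Qed.

Lemma tilt_bounds l b : `|b| <= M ->
  expR (- (M * `|l| + gam / 2 * M ^+ 2)) <= tilt l gam b <= expR (M * `|l|).
Proof.
move=> bM; rewrite /tilt !ler_expR.
have lb : `|l * b| <= M * `|l| by rewrite normrM mulrC ler_wpM2r.
have b2 : b ^+ 2 <= M ^+ 2.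
  by rewrite -(real_normK (num_real b)) ler_pXn2r// nnegrE.
have g2 : 0 <= gam / 2 by rewrite divr_ge0// ltW.
have h1 := ler_wpM2l g2 b2; have h0 : 0 <= gam / 2 * b ^+ 2 by rewrite mulr_ge0// sqr_ge0.
move: lb; rewrite ler_norml => /andP[l1 l2]; apply/andP; split.
  by rewrite mulNr; lra.
by rewrite mulNr; lra.
Qed.

Lemma partition_bounds l :
  expR (- (M * `|l| + gam / 2 * M ^+ 2)) <= partition_fun P0 l gam <= expR (M * `|l|).
Proof.
have mt : measurable_fun setT (fun b : RT => (tilt l gam b)%:E).
  by apply/measurable_EFinP; exact: measurable_tilt2.
have t0 b : (0 <= (tilt l gam b)%:E)%E by rewrite lee_fin expR_ge0.
have ub : (\int[P0]_b (tilt l gam b)%:E <= (expR (M * `|l|))%:E)%E.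
  apply: (@le_trans _ _ (\int[P0]_b (expR (M * `|l|))%:E)%E).
    apply: ae_ge0_le_integral => //.
    by apply: (ae_impl _ hM) => b /(tilt_bounds l)/andP[_ h] _; rewrite lee_fin.
  by rewrite integral_cst// [X in (_ * X)%E](_ : _ = 1%E) ?mule1//; exact: (probability_setT P0).
have lb : ((expR (- (M * `|l| + gam / 2 * M ^+ 2)))%:E <= \int[P0]_b (tilt l gam b)%:E)%E.
  apply: (@le_trans _ _ (\int[P0]_b (expR (- (M * `|l| + gam / 2 * M ^+ 2)))%:E)%E).
    by rewrite integral_cst// [X in (_ * X)%E](_ : _ = 1%E) ?mule1//; exact: (probability_setT P0).
  apply: ae_ge0_le_integral => //.
  by apply: (ae_impl _ hM) => b /(tilt_bounds l)/andP[h _] _; rewrite lee_fin.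
have fn : (\int[P0]_b (tilt l gam b)%:E)%E \is a fin_num.
  rewrite ge0_fin_numE ?integral_ge0//; exact: (le_lt_trans ub (ltry _)).
by rewrite -!lee_fin /partition_fun /Rintegral fineK// lb ub.
Qed.

Lemma partition_EFin l : (partition_fun P0 l gam)%:E = (\int[P0]_b (tilt l gam b)%:E)%E.
Proof.
have mt : measurable_fun setT (fun b : RT => (tilt l gam b)%:E).
  by apply/measurable_EFinP; exact: measurable_tilt2.
have t0 b : (0 <= (tilt l gam b)%:E)%E by rewrite lee_fin expR_ge0.
rewrite /partition_fun /Rintegral fineK// ge0_fin_numE ?integral_ge0//.
apply: (@le_lt_trans _ _ (\int[P0]_b (expR (M * `|l|))%:E)%E).
  apply: ae_ge0_le_integral => //.
  by apply: (ae_impl _ hM) => b /(tilt_bounds l)/andP[_ h] _; rewrite lee_fin.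
rewrite integral_cst// [X in (_ * X)%E](_ : _ = 1%E) ?mule1 ?ltry//.
exact: (probability_setT P0).
Qed.

Lemma partition_gt0 l : 0 < partition_fun P0 l gam.
Proof. by have /andP[h _] := partition_bounds l; apply: lt_le_trans h; exact: expR_gt0. Qed.

(** Bounded support makes the log-partition function grow at most linearly; hence the information
    density grows linearly in the noise and has all exponential moments. *)
Lemma ln_partition_le l : `|ln (partition_fun P0 l gam)| <= M * `|l| + gam / 2 * M ^+ 2.
Proof.
have /andP[h1 h2] := partition_bounds l.
have g2 : 0 <= gam / 2 * M ^+ 2 by rewrite mulr_ge0 ?sqr_ge0// divr_ge0// ltW.
have p0 := partition_gt0 l.
rewrite ler_norml; apply/andP; split.
  by rewrite -[leLHS]expRK ler_ln ?posrE ?expR_gt0.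
apply: (@le_trans _ _ (M * `|l|)); last by rewrite lerDl.
by rewrite -[leRHS]expRK ler_ln ?posrE ?expR_gt0.
Qed.

Lemma measurable_infodens : measurable_fun setT (fun x : RT * RT => infodens x.1 x.2).
Proof.
have ml : measurable_fun setT (fun x : RT * RT => gam * x.1 + Num.sqrt gam * x.2 : RT).
  by apply: measurable_funD; apply: measurable_funM => //.
apply: measurable_funB.
  apply: measurable_funB; first by apply: measurable_funM => //; try exact: measurable_fst.
  by apply: measurable_funM => //; apply: measurable_funX; try exact: measurable_fst.
apply: (measurableT_comp (@measurable_ln R)).
exact: (measurableT_comp measurable_partition ml).
Qed.

Let c0 := 2 * gam * M ^+ 2 + gam * M ^+ 2.
Let c1 := 2 * Num.sqrt gam * M.

Lemma infodens_le b z : `|b| <= M -> `|infodens b z| <= c0 + c1 * `|z|.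
Proof.
move=> bM; rewrite /infodens.
set l := gam * b + Num.sqrt gam * z.
have s0 : 0 <= Num.sqrt gam by exact: sqrtr_ge0.
have lM : `|l| <= gam * M + Num.sqrt gam * `|z|.
  apply: (le_trans (ler_normD _ _)); rewrite !normrM (gtr0_norm gam0) (ger0_norm s0) lerD2r.
  by rewrite ler_wpM2l// ltW.
have h1 : `|l * b| <= M * (gam * M + Num.sqrt gam * `|z|).
  by rewrite normrM mulrC; apply: ler_pM.
have h2 : `|gam / 2 * b ^+ 2| <= gam / 2 * M ^+ 2.
  have g2 : 0 <= gam / 2 by rewrite divr_ge0// ltW.
  rewrite ger0_norm; last by rewrite mulr_ge0// sqr_ge0.
  by rewrite ler_wpM2l// -(real_normK (num_real b)) ler_pXn2r// nnegrE.
have h3 := ln_partition_le l.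
have h4 : M * `|l| <= M * (gam * M + Num.sqrt gam * `|z|) by rewrite ler_wpM2l.
apply: (le_trans (ler_normB _ _)).
apply: (le_trans (lerD (ler_normB _ _) (lexx _))).
apply: (le_trans (lerD (lerD h1 h2) h3)).
by rewrite /c0 /c1; lra.
Qed.

Lemma ae_channel (Q : RT -> Prop) : {ae P0, forall b, Q b} ->
  {ae channel_prob P0, forall x, Q x.1}.
Proof.
move=> [A [mA A0 QA]]; exists (A `*` setT); split.
- exact: measurableX.
- apply: (@etrans _ _ (P0 A * N setT)%E); first exact: product_measure1E.
  by rewrite A0 mul0e.
- by move=> x /= nQ; split => //; exact: QA.
Qed.

(** The growth bound holds only for [|b| <= M], that is almost everywhere, whereas
    [exp_moment_bound] wants a pointwise domination; this version provides it and agrees with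
    [infodens] almost everywhere. *)
Let infodens' (b z : R) : R := if `|b| <= M then infodens b z else 0.

Let measurable_infodens' : measurable_fun setT (fun x : RT * RT => infodens' x.1 x.2).
Proof.
apply: measurable_fun_ifT => //; last exact: measurable_infodens.
by apply: measurable_fun_ler => //; apply: measurableT_comp => //; try exact: measurable_fst.
Qed.

(** With [u] the linear bound, this is [4 * expR u], which dominates [u ^+ 2], times [expR u], which
    dominates the exponential factor of the remainder. *)
Let W (x : RT * RT) : R := 4 * expR (2 * (c0 + c1 * `|x.2|)).

Let c0_ge0 : 0 <= c0.
Proof. by rewrite /c0 -mulrDl mulr_ge0 ?sqr_ge0// addr_ge0 ?mulr_ge0// ltW. Qed.

Let c1_ge0 : 0 <= c1.
Proof. by rewrite /c1 !mulr_ge0// sqrtr_ge0. Qed.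

Let infodens'_le x : `|infodens' x.1 x.2| <= c0 + c1 * `|x.2|.
Proof.
rewrite /infodens'; case: ifPn => h; first exact: infodens_le.
by rewrite normr0 addr_ge0// mulr_ge0.
Qed.

Let integrable_channel_snd (f : RT -> R) : measurable_fun setT f -> (forall z, 0 <= f z) ->
  N.-integrable setT (EFin \o f) ->
  (channel_prob P0).-integrable setT (EFin \o (fun x => f x.2)).
Proof.
move=> mf f0 /integrableP[_ fi].
have mf2 : measurable_fun setT (EFin \o (fun x : RT * RT => f x.2)).
  by apply/measurable_EFinP; apply: (measurableT_comp mf); try exact: measurable_snd.
apply/integrableP; split => //.
rewrite /channel_prob fubini_tonelli1//; last exact: measurableT_comp.
rewrite /fubini_F /=.
by rewrite integral_cst// [X in (_ * X)%E](_ : _ = 1%E) ?mule1//; exact: (probability_setT P0).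
Qed.

Let integrable_W : (channel_prob P0).-integrable setT (EFin \o W).
Proof.
apply: (@integrable_channel_snd (fun z => 4 * expR (2 * (c0 + c1 * `|z|)))).
- apply: measurable_funM => //; apply: (measurableT_comp (@measurable_expR R)).
  apply: measurable_funM => //; apply: measurable_funD => //.
  by apply: measurable_funM => //; try exact: measurableT_comp.
- by move=> z; rewrite mulr_ge0// expR_ge0.
- apply: (@integrable_normal _ _ (4 * expR (2 * c0)) (2 * c1)).
    apply: measurable_funM => //; apply: (measurableT_comp (@measurable_expR R)).
    apply: measurable_funM => //; apply: measurable_funD => //.
    by apply: measurable_funM => //; try exact: measurableT_comp.
  move=> z; rewrite ger0_norm; last by rewrite mulr_ge0// expR_ge0.
  by rewrite -mulrA -expRD; apply: ler_wpM2l => //; rewrite ler_expR; lra.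
Qed.

Let integrable_infodens' : (channel_prob P0).-integrable setT (EFin \o (fun x => infodens' x.1 x.2)).
Proof.
apply: le_integrable integrable_W => //; first by apply/measurable_EFinP; exact: measurable_infodens'.
move=> x _ /=; rewrite lee_fin (le_trans (infodens'_le x))//.
have h : 0 <= c0 + c1 * `|x.2| by rewrite addr_ge0// mulr_ge0.
rewrite /W [leRHS]ger0_norm; last by rewrite mulr_ge0// expR_ge0.
by have := expR_ge1Dx (2 * (c0 + c1 * `|x.2|)); move: h; set u := c0 + _; lra.
Qed.

Lemma ae_infodens : {ae channel_prob P0, forall x, infodens' x.1 x.2 = infodens x.1 x.2}.
Proof.
by apply: (ae_impl _ (ae_channel hM)) => x h; rewrite /infodens' h.
Qed.

Lemma integrable_infodens : (channel_prob P0).-integrable setT (EFin \o (fun x => infodens x.1 x.2)).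
Proof.
have m1 : measurable_fun setT (EFin \o (fun x : RT * RT => infodens x.1 x.2)).
  by apply/measurable_EFinP; exact: measurable_infodens.
have m2 : measurable_fun setT (EFin \o (fun x : RT * RT => infodens' x.1 x.2)).
  by apply/measurable_EFinP; exact: measurable_infodens'.
apply/integrableP; split => //.
have /integrableP[_] := integrable_infodens'.
rewrite (@ae_eq_integral _ _ _ _ setT (abse \o (EFin \o (fun x : RT * RT => infodens x.1 x.2))))//.
- exact: measurableT_comp.
- exact: measurableT_comp.
- by apply: (ae_impl _ ae_infodens) => x h _ /=; rewrite h.
Qed.

Lemma infodens_exp_bound : exists2 C : R, 0 <= C & forall k, 0 <= k <= 1 ->
  (\int[P0]_b \int[N]_z (expR (- (k * infodens b z)))%:E <=
   (expR (- (k * mean_infodens) + C * k ^+ 2))%:E)%E.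
Proof.
have YW x : infodens' x.1 x.2 ^+ 2 * expR (Num.max 0 (- infodens' x.1 x.2)) <= W x.
  have h := infodens'_le x; set y := infodens' _ _ in h *.
  set u := c0 + c1 * `|x.2| in h *.
  have u0 : 0 <= u by apply: le_trans h.
  have -> : W x = (4 * expR u) * expR u.
    by rewrite /W -/u -mulrA -expRD; congr (_ * expR _); ring.
  apply: ler_pM; rewrite ?sqr_ge0 ?expR_ge0//.
    apply: (le_trans _ (sqr_le_expR u0)).
    by rewrite -(real_normK (num_real y)) ler_pXn2r// nnegrE.
  rewrite ler_expR ge_max u0/=.
  by apply: le_trans h; rewrite -normrN ler_norm.
have [C C0 CP] := exp_moment_bound integrable_infodens' integrable_W YW.
exists C => // k k01.
have := CP k k01.
have -> : \int[channel_prob P0]_x infodens' x.1 x.2 = mean_infodens.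
  rewrite /mean_infodens /Rintegral; congr fine; apply: ae_eq_integral => //.
  - by apply/measurable_EFinP; exact: measurable_infodens'.
  - by apply/measurable_EFinP; exact: measurable_infodens.
  - by apply: (ae_impl _ ae_infodens) => x h _ /=; rewrite h.
have me (f : RT * RT -> R) : measurable_fun setT f ->
    measurable_fun setT (fun x => (expR (- (k * f x)))%:E).
  move=> mf; apply/measurable_EFinP; apply: (measurableT_comp (@measurable_expR R)).
  by apply: measurableT_comp => //; exact: measurable_funM.
have -> : (\int[channel_prob P0]_x (expR (- (k * infodens' x.1 x.2)))%:E =
   \int[channel_prob P0]_x (expR (- (k * infodens x.1 x.2)))%:E)%E.
  apply: ae_eq_integral => //.
  - exact: (me (fun x => infodens' x.1 x.2) measurable_infodens').
  - exact: (me (fun x => infodens x.1 x.2) measurable_infodens).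
  - by apply: (ae_impl _ ae_infodens) => x h _ /=; rewrite h.
rewrite {1}/channel_prob fubini_tonelli1//.
exact: (me (fun x => infodens x.1 x.2) measurable_infodens).
Qed.

End information_density.

(** * The auxiliary optimisation problem *)

Section auxiliary_lower_bound.
Context {R : realType}.
Local Notation RT := (measurableTypeR R).
Variables (P0 : probability RT R) (n p : nat) (gam sigma q tau : R).
Hypotheses (n0 : (0 < n)%N) (p0 : (0 < p)%N) (gam0 : 0 < gam) (sigma0 : 0 < sigma)
  (q0 : 0 <= q) (tau0 : 0 < tau).
Local Notation J := ('I_p + unit)%type.
Local Notation Z := (fun l => partition_fun P0 l gam).

Definition overlap_dist (b m : 'I_p -> R) : R := p%:R^-1 * \sum_j (m j - b j) ^+ 2.

(* ||y - X m|| = ||G v|| for the vector v below, G being an n x (p+1) standard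
   Gaussian matrix whose last column is the normalised noise. *)
Definition residual_vec (b m : 'I_p -> R) (j : J) : R :=
  match j with
  | inl j => (b j - m j) / Num.sqrt p%:R
  | inr _ => sigma
  end.

Definition scale : R := Num.sqrt (gam * p%:R).

(** The first term offsets the linear dependence [gam * p * q' / 2] on the actual distance [q'], the
    second is a Lipschitz constant in [q'] of the norm term. *)
Definition penalty : R := gam * p%:R / 2 + Num.sqrt (gam * p%:R * n%:R) / sigma.

(** The quadratic term is what is left of [gam / 2 * \sum_j s j] when the variances [s j - m j ^+ 2]
    are split off. *)
Definition tilted_cost (b m : 'I_p -> R) (H : R) : R :=
  H - gam / 2 * \sum_j m j ^+ 2 + penalty * `|overlap_dist b m - q|.

(* H bounds the sum of the convex conjugates at m of the log-partition
   function with fixed second parameter gam. *)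
Definition entropy_epigraph (m : 'I_p -> R) (H : R) : Prop :=
  forall l : 'I_p -> R, \sum_j (l j * m j - ln (Z (l j))) <= H.

(** The product of [scale], the norm of the vector [v] at distance [q], and the typical norm of [g];
    it equals [sqrt (delta * p * n)] for the chosen [gam]. *)
Definition mean_energy : R := Num.sqrt (gam * (q + sigma ^+ 2) * p%:R * n%:R).

(* The lower bound of the auxiliary problem once |q' - q| is absorbed by the
   penalty; the last sum is an information density because minimising
   H - <l, m> over the epigraph gives minus a log-partition function. *)
Definition lower_value (b : 'I_p -> R) (g : 'I_n -> R) (h : J -> R) : R :=
  mean_energy * (1 - Num.max 0 (1 - (\sum_i g i ^+ 2) / n%:R)) - gam * p%:R * q / 2 +
  scale * sigma * h (inr tt) + \sum_j infodens P0 gam (b j) (h (inl j)).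

Let pR : 0 < p%:R :> R. Proof. by rewrite ltr0n. Qed.
Let nR : 0 < n%:R :> R. Proof. by rewrite ltr0n. Qed.

Lemma residual_vec_sqr b m :
  \sum_j residual_vec b m j ^+ 2 = overlap_dist b m + sigma ^+ 2.
Proof.
rewrite big_sumType/=; congr (_ + _); last by rewrite (big_pred1 tt)// => -[].
rewrite /overlap_dist mulr_sumr; apply: eq_bigr => j _.
by rewrite expr_div_n sqr_sqrtr ?ltW// -sqrrN opprB mulrC.
Qed.

Lemma overlap_dist_ge0 b m : 0 <= overlap_dist b m.
Proof. by rewrite mulr_ge0 ?invr_ge0 ?(ltW pR)// sumr_ge0// => j _; exact: sqr_ge0. Qed.

(** The epigraph is tested at the channel outputs [l j] for inputs [b j] and noises [h (inl j)]; the
    squares [gam / 2 * (m j - b j) ^+ 2] then balance the quadratic terms exactly. *)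
Lemma entropy_side b m H (h : J -> R) : entropy_epigraph m H ->
  \sum_j infodens P0 gam (b j) (h (inl j)) - gam * p%:R * overlap_dist b m / 2 <=
  Num.sqrt gam * \sum_j h (inl j) * (b j - m j) + H - gam / 2 * \sum_j m j ^+ 2.
Proof.
move=> eH.
pose l j := gam * b j + Num.sqrt gam * h (inl j).
have := eH l; set S := \sum_j (l j * m j - _) => hS.
suff -> : \sum_j infodens P0 gam (b j) (h (inl j)) - gam * p%:R * overlap_dist b m / 2 =
    S + Num.sqrt gam * \sum_j h (inl j) * (b j - m j) - gam / 2 * \sum_j m j ^+ 2 by lra.
have -> : gam * p%:R * overlap_dist b m / 2 = \sum_j gam / 2 * (m j - b j) ^+ 2.
  by rewrite -mulr_sumr /overlap_dist; field; rewrite gt_eqF.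
rewrite /S !mulr_sumr -sumrB -!big_split/= -sumrB; apply: eq_bigr => j _.
by rewrite /infodens /l; set lnz := ln _; field.
Qed.

Lemma norm_side b m (g : 'I_n -> R) :
  mean_energy * (1 - Num.max 0 (1 - (\sum_i g i ^+ 2) / n%:R)) - gam * p%:R * q / 2 <=
  scale * Num.sqrt (\sum_i (g i * Num.sqrt (\sum_j residual_vec b m j ^+ 2)) ^+ 2 + tau)
  - gam * p%:R * overlap_dist b m / 2 + penalty * `|overlap_dist b m - q|.
Proof.
set q' := overlap_dist b m; have q'0 : 0 <= q' by exact: overlap_dist_ge0.
rewrite residual_vec_sqr -/q'.
set vn := Num.sqrt (q' + sigma ^+ 2); pose rho := Num.sqrt (q + sigma ^+ 2).
have s20 : 0 < sigma ^+ 2 by rewrite exprn_gt0.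
have vn2 : vn ^+ 2 = q' + sigma ^+ 2 by rewrite sqr_sqrtr// addr_ge0// ltW.
have rho2 : rho ^+ 2 = q + sigma ^+ 2 by rewrite sqr_sqrtr// addr_ge0// ltW.
have vns : sigma <= vn by rewrite -[leLHS](gtr0_norm sigma0) -sqrtr_sqr ler_wsqrtr// lerDr.
have rho0 : 0 <= rho by exact: sqrtr_ge0.
set x := (\sum_i g i ^+ 2) / n%:R.
have x0 : 0 <= x by rewrite divr_ge0// sumr_ge0// => i _; exact: sqr_ge0.
(* [y] is the minimum of 1 and [x], so [y ^+ 2 <= x]; replacing the square root of [x] by [y] leaves
   an expression affine in [x] up to a positive part, whose exponential moment is accessible. *)
set y := 1 - Num.max 0 (1 - x).
have [y0 y1 yx] : [/\ 0 <= y, y <= 1 & y <= x].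
  rewrite /y; have [h|h] := leP 0 (1 - x); split; lra.
pose e := Num.sqrt (gam * p%:R * n%:R).
have gpn : 0 <= gam * p%:R by rewrite mulr_ge0// ltW.
have e0 : 0 <= e by exact: sqrtr_ge0.
have eE : e = scale * Num.sqrt n%:R by rewrite /e sqrtrM.
have LE : mean_energy = e * rho.
  rewrite /mean_energy /e /rho -[RHS]sqrtrM; last by rewrite mulr_ge0.
  by congr (Num.sqrt _); ring.
have lb : vn * Num.sqrt n%:R * y <= Num.sqrt (\sum_i (g i * vn) ^+ 2 + tau).
  have v0 : 0 <= vn * Num.sqrt n%:R * y.
    by rewrite !mulr_ge0 ?sqrtr_ge0.
  rewrite -[leLHS](ger0_norm v0) -sqrtr_sqr ler_wsqrtr//.
  have -> : \sum_i (g i * vn) ^+ 2 = vn ^+ 2 * (n%:R * x).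
    have -> : n%:R * x = \sum_i g i ^+ 2 by rewrite /x; field; rewrite gt_eqF.
    by rewrite mulr_sumr; apply: eq_bigr => i _; ring.
  have -> : (vn * Num.sqrt n%:R * y) ^+ 2 = vn ^+ 2 * (n%:R * y ^+ 2).
    by rewrite !exprMn (sqr_sqrtr (ltW nR)); ring.
  apply: (@le_trans _ _ (vn ^+ 2 * (n%:R * x))); last by rewrite lerDl ltW.
  rewrite ler_wpM2l ?sqr_ge0// ler_wpM2l ?(ltW nR)//.
  by apply: le_trans yx; rewrite expr2 ler_piMl.
(* The square root is Lipschitz here because its argument is at least [sigma ^+ 2]. *)
have dd : `|vn - rho| * sigma <= `|q' - q|.
  have -> : q' - q = (vn - rho) * (vn + rho) by rewrite -subr_sqr vn2 rho2; ring.
  rewrite normrM ler_wpM2l// (ger0_norm (addr_ge0 (le_trans (ltW sigma0) vns) rho0)).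
  by apply: (le_trans vns); rewrite lerDl.
have d1 : e * (y * (rho - vn)) <= e / sigma * `|q' - q|.
  apply: (@le_trans _ _ (e * `|vn - rho|)).
    rewrite ler_wpM2l//; apply: (le_trans (ler_norm _)).
    by rewrite normrM (ger0_norm y0) -(distrC vn) ler_piMl.
  rewrite mulrAC ler_pdivlMr// -mulrA ler_wpM2l//.
have sc0 : 0 <= scale by exact: sqrtr_ge0.
have lb2 := ler_wpM2l sc0 lb.
have gq : gam * p%:R / 2 * (q' - q) <= gam * p%:R / 2 * `|q' - q|.
  by rewrite ler_wpM2l ?ler_norm// divr_ge0.
have E1 : scale * (vn * Num.sqrt n%:R * y) = e * (vn * y) by rewrite eE; ring.
rewrite LE /penalty -/e mulrDl.
rewrite E1 in lb2.
set T := scale * _ in lb2 *; set D := `|q' - q| in d1 gq *.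
have : e * rho * y = e * (y * (rho - vn)) + e * (vn * y) by ring.
lra.
Qed.

Lemma auxiliary_ge b m H (g : 'I_n -> R) (h : J -> R) : entropy_epigraph m H ->
  lower_value b g h <=
  scale * (Num.sqrt (\sum_i (g i * Num.sqrt (\sum_j residual_vec b m j ^+ 2)) ^+ 2 + tau)
    + \sum_j h j * residual_vec b m j) + tilted_cost b m H.
Proof.
move=> eH; have h1 := entropy_side b h eH; have h2 := norm_side b m g.
have -> : \sum_j h j * residual_vec b m j =
    (\sum_j h (inl j) * (b j - m j)) / Num.sqrt p%:R + h (inr tt) * sigma.
  rewrite big_sumType/= (big_pred1 tt); last by case.
  by rewrite mulr_suml; congr (_ + _); apply: eq_bigr => j _; rewrite mulrA.
have sE : scale = Num.sqrt gam * Num.sqrt p%:R by rewrite /scale sqrtrM// ltW.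
have sp : Num.sqrt p%:R != 0 :> R by rewrite gt_eqF// sqrtr_gt0.
rewrite mulrDr mulrDr.
have -> : scale * ((\sum_j h (inl j) * (b j - m j)) / Num.sqrt p%:R) =
   Num.sqrt gam * \sum_j h (inl j) * (b j - m j).
  by rewrite sE; field.
rewrite /lower_value /tilted_cost.
move: h1 h2; set A := \sum_j infodens _ _ _ _; set B := Num.sqrt gam * _.
set C := mean_energy * _; set D := scale * Num.sqrt _; set E := penalty * _.
set F := gam * p%:R * overlap_dist b m / 2; set G := gam / 2 * _.
have -> : scale * (h (inr tt) * sigma) = scale * sigma * h (inr tt) by ring.
set K := _ * h _; set Q := gam * p%:R * q / 2.
lra.
Qed.

End auxiliary_lower_bound.

Lemma lee_prod {R : realType} (I : Type) (s : seq I) (f g : I -> \bar R) :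
  (forall i, 0 <= f i)%E -> (forall i, f i <= g i)%E ->
  (\prod_(i <- s) f i <= \prod_(i <- s) g i)%E.
Proof.
move=> f0 fg; elim: s => [|i s IH]; first by rewrite !big_nil.
by rewrite !big_cons lee_pmul//; apply: prode_ge0.
Qed.

Lemma prod_expR {R : realType} n (a : R) :
  (\prod_(i < n) (expR a)%:E = (expR (n%:R * a))%:E :> \bar R)%E.
Proof. by rewrite prodEFin prodr_const card_ord -expRM_natl. Qed.

Section auxiliary_exponential_moment.
Context {R : realType}.
Local Notation RT := (measurableTypeR R).
Local Notation N := (normal_prob (0 : R) 1).
Variables (P0 : probability RT R) (n p : nat) (gam sigma q C1 C2 : R).
Local Notation J := ('I_p + unit)%type.
Local Notation K := (gordon_index 'I_n J).
Local Notation TT := (#|K|.-tuple RT).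
Hypotheses (n0 : (0 < n)%N) (p0 : (0 < p)%N) (gam0 : 0 < gam) (sigma0 : 0 < sigma)
  (q0 : 0 <= q)
  (hC1 : forall k, 0 <= k <= 1 ->
    (\int[N]_x (expR (k * (1 - x ^+ 2)))%:E <= (expR (C1 * k ^+ 2))%:E)%E)
  (hC2 : forall k, 0 <= k <= 1 ->
    (\int[P0]_b \int[N]_z (expR (- (k * infodens P0 gam b z)))%:E <=
     (expR (- (k * mean_infodens P0 gam) + C2 * k ^+ 2))%:E)%E).

Let phi k b : \bar R := (\int[N]_z (expR (- (k * infodens P0 gam b z)))%:E)%E.

Let phi_ge0 k b : (0 <= phi k b)%E.
Proof. by apply: integral_ge0 => z _; rewrite lee_fin expR_ge0. Qed.

Let mexpinfo k : measurable_fun setT (fun x : RT * RT => (expR (- (k * infodens P0 gam x.1 x.2)))%:E).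
Proof.
apply/measurable_EFinP; apply: (measurableT_comp (@measurable_expR R)).
apply: measurable_funN; apply: measurable_funM => //.
exact: measurable_infodens.
Qed.

Let mphi k : measurable_fun setT (phi k).
Proof.
have H := @measurable_fun_fubini_tonelli_F _ _ RT RT R N
   (fun x : RT * RT => (expR (- (k * infodens P0 gam x.1 x.2)))%:E).
by apply: H => // x; rewrite lee_fin expR_ge0.
Qed.

(** A sum of functions of single coordinates, so its exponential integrates to a product. *)
Definition moment_exponent (c k s : R) (b : 'I_p -> R) (t : TT) : R :=
  \sum_i c * (1 - rowg t i ^+ 2) +
  (\sum_j - (k * infodens P0 gam (b j) (colg t (inl j))) + s * colg t (inr tt)).

Lemma gauss_moment_exponent (c k s : R) (b : 'I_p -> R) : 0 <= c <= 1 ->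
  (\int[gauss K]_t (expR (moment_exponent c k s b t))%:E <=
   (expR (n%:R * C1 * c ^+ 2 + s ^+ 2 / 2))%:E * \prod_j phi k (b j))%E.
Proof.
move=> c01.
pose e (i : K) : RT -> R := match i with
  | inl _ => fun _ => 0
  | inr (inl _) => fun x => c * (1 - x ^+ 2)
  | inr (inr (inl j)) => fun x => - (k * infodens P0 gam (b j) x)
  | inr (inr (inr _)) => fun x => s * x
  end.
have me i : measurable_fun setT (e i).
  have mid : measurable_fun setT (@id RT) by exact: measurable_id.
  case: i => [u|[i|[j|u]]] /=; first exact: measurable_cst.
  - by apply: measurable_funM => //; apply: measurable_funB => //; exact: measurable_funX.
  - apply: measurable_funN; apply: measurable_funM => //.
    apply: (measurableT_comp (measurable_infodens P0 gam) (g := fun x : RT => ((b j : RT), x))).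
    exact: pair1_measurable.
  - by apply: measurable_funM.
have E t : (expR (moment_exponent c k s b t))%:E = (\prod_i (expR (e i (crd t i)))%:E)%E.
  rewrite prodEFin -expR_sum; congr (EFin (expR _)).
  rewrite sum_gordon_index /= [X in X + _ + _]big1 ?add0r => [|i _]; last by rewrite big1.
  by congr (_ + _); rewrite big_sumType/= (big_pred1 tt)// => -[].
under eq_integral do rewrite E.
rewrite (@ge0_integral_prodP_prod R K (fun=> N) (fun i x => (expR (e i x))%:E)); last 2 first.
- move=> i; apply/measurable_EFinP; exact: (measurableT_comp (@measurable_expR R)).
- by move=> i x; rewrite lee_fin expR_ge0.
rewrite big_sumType/= big1 ?mul1e; last first.
  move=> i _; rewrite expR0 integral_cst//= mul1e.
  exact: (probability_setT N).
rewrite big_sumType/= expRD EFinM -muleA.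
apply: lee_pmul => //.
- by apply: prode_ge0 => i _; apply: integral_ge0 => z _; rewrite lee_fin expR_ge0.
- by apply: prode_ge0 => i _; apply: integral_ge0 => z _; rewrite lee_fin expR_ge0.
- apply: (@le_trans _ _ (\prod_(i < n) (expR (C1 * c ^+ 2))%:E)%E).
    apply: lee_prod => i; last exact: hC1.
    by apply: integral_ge0 => z _; rewrite lee_fin expR_ge0.
  by rewrite prod_expR -mulrA.
- rewrite big_sumType/= muleC (big_pred1 tt); last by case.
  apply: lee_pmul => //.
  + by apply: integral_ge0 => z _; rewrite lee_fin expR_ge0.
  + by apply: prode_ge0 => i _; exact: (phi_ge0 k).
  + by rewrite normal_mgf.
Qed.

Lemma prodP_phi k : 0 <= k <= 1 ->
  (\int[prodP (fun _ : 'I_p => P0)]_b \prod_j phi k (crd b j) <=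
   (expR (p%:R * (- (k * mean_infodens P0 gam) + C2 * k ^+ 2)))%:E)%E.
Proof.
move=> k01; rewrite (@ge0_integral_prodP_prod R 'I_p (fun=> P0) (fun=> phi k))//.
apply: (@le_trans _ _ (\prod_(i < p) (expR (- (k * mean_infodens P0 gam) + C2 * k ^+ 2))%:E)%E).
  by apply: lee_prod => i; [exact: integral_ge0|exact: hC2].
by rewrite prod_expR.
by move=> _; exact: (@mphi k).
Qed.

Definition moment_bound (k : R) : R :=
  let L := mean_energy n p gam sigma q in
  expR (- (k * L) + k * (gam * p%:R * q / 2)) * ((1 + expR (n%:R * C1 * (k * L / n%:R) ^+ 2)) *
   expR ((k * scale p gam * sigma) ^+ 2 / 2) *
   expR (p%:R * (- (k * mean_infodens P0 gam) + C2 * k ^+ 2))).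

Lemma measurable_moment_exponent c k s :
  measurable_fun setT (fun bt : (#|'I_p|.-tuple RT) * TT => moment_exponent c k s (crd bt.1) bt.2).
Proof.
have mr (i : K) : measurable_fun setT (fun bt : (#|'I_p|.-tuple RT) * TT => crd bt.2 i).
  by apply: (measurableT_comp (measurable_crd i)).
apply: measurable_funD.
  apply: measurable_sum => i; apply: measurable_funM => //; apply: measurable_funB => //.
  by apply: measurable_funX; exact: mr.
apply: measurable_funD; last by apply: measurable_funM => //; exact: mr.
apply: measurable_sum => j; apply: measurable_funN; apply: measurable_funM => //.
apply: (measurableT_comp (measurable_infodens P0 gam)
  (g := fun bt : (#|'I_p|.-tuple RT) * TT => (crd bt.1 j, crd bt.2 (inr (inr (inl j)) : K)))).
apply/measurable_fun_pairP; split; last exact: mr.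
by apply: (measurableT_comp (measurable_crd j)).
Qed.

Lemma measurable_lower_value : measurable_fun setT (fun bt : (#|'I_p|.-tuple RT) * TT =>
  lower_value P0 gam sigma q (crd bt.1) (rowg bt.2) (colg bt.2)).
Proof.
have mr (i : K) : measurable_fun setT (fun bt : (#|'I_p|.-tuple RT) * TT => crd bt.2 i).
  by apply: (measurableT_comp (measurable_crd i)).
apply: measurable_funD; last first.
  apply: measurable_sum => j.
  apply: (measurableT_comp (measurable_infodens P0 gam)
    (g := fun bt : (#|'I_p|.-tuple RT) * TT => (crd bt.1 j, crd bt.2 (inr (inr (inl j)) : K)))).
  apply/measurable_fun_pairP; split; last exact: mr.
  by apply: (measurableT_comp (measurable_crd j)).
apply: measurable_funD; last by apply: measurable_funM => //; exact: mr.
apply: measurable_funB => //; apply: measurable_funM => //; apply: measurable_funB => //.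
apply: measurable_maxr => //; apply: measurable_funB => //; apply: measurable_funM => //.
by apply: measurable_sum => i; apply: measurable_funX; exact: mr.
Qed.

Lemma gauss_lower_value (k : R) (b : #|'I_p|.-tuple RT) :
  let L := mean_energy n p gam sigma q in
  let c := k * L / n%:R in let s := - (k * scale p gam * sigma) in
  0 <= c <= 1 ->
  (\int[gauss K]_t
     (expR (- (k * lower_value P0 gam sigma q (crd b) (rowg t) (colg t))))%:E <=
   (expR (- (k * L) + k * (gam * p%:R * q / 2)) *
      ((1 + expR (n%:R * C1 * c ^+ 2)) * expR (s ^+ 2 / 2)))%:E * \prod_j phi k (crd b j))%E.
Proof.
move=> L c s c01.
have nR : 0 < n%:R :> R by rewrite ltr0n.
have kL0 : 0 <= k * L by case/andP: c01 => + _; rewrite pmulr_lge0// invr_gt0.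
pose C0 := expR (- (k * L) + k * (gam * p%:R * q / 2)).
(* The positive part is removed by [expR (a * max 0 u) <= 1 + expR (a * u)], for [a >= 0]; the two
   terms correspond to [c' = 0] and [c' = c]. *)
have pw (t : TT) : expR (- (k * lower_value P0 gam sigma q (crd b) (rowg t) (colg t))) <=
    C0 * (expR (moment_exponent 0 k s (crd b) t) + expR (moment_exponent c k s (crd b) t)).
  rewrite /moment_exponent /lower_value -/L.
  rewrite (_ : \sum_i 0 * _ = 0) ?add0r; last by rewrite big1// => i _; rewrite mul0r.
  set X := \sum_j - _ + s * _.
  have -> : \sum_i c * (1 - rowg t i ^+ 2) = k * L * (1 - (\sum_i rowg t i ^+ 2) / n%:R).
    by rewrite -mulr_sumr sumrB sumr_const card_ord /c; field; rewrite gt_eqF.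
  set u := 1 - _ / n%:R.
  have -> : - (k * (L * (1 - Num.max 0 u) - gam * p%:R * q / 2 + scale p gam * sigma * colg t (inr tt) +
     \sum_j infodens P0 gam (crd b j) (colg t (inl j)))) =
     (- (k * L) + k * (gam * p%:R * q / 2)) + (k * L * Num.max 0 u + X).
    by rewrite /X sumrN -mulr_sumr /s; ring.
  rewrite expRD ler_wpM2l ?expR_ge0//; move: X => X; rewrite !expRD.
  rewrite (_ : expR X + _ = (1 + expR (k * L * u)) * expR X); last by rewrite mulrDl mul1r.
  rewrite ler_wpM2r ?expR_ge0//.
  have [u0|u0] := leP 0 u; first by rewrite lerDr.
  by rewrite mulr0 expR0 lerDl expR_ge0.
have mE c' : measurable_fun setT (fun t : TT => (expR (moment_exponent c' k s (crd b) t))%:E).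
  apply/measurable_EFinP; apply: (measurableT_comp (@measurable_expR R)).
  by apply: (measurableT_comp (measurable_moment_exponent c' k s) (g := pair b)); exact: pair1_measurable.
have ex0 x : (0 <= (expR x)%:E :> \bar R)%E by rewrite lee_fin expR_ge0.
have mE2 : measurable_fun setT (fun t : TT => (expR (moment_exponent 0 k s (crd b) t))%:E
      + (expR (moment_exponent c k s (crd b) t))%:E)%E.
  by apply: emeasurable_funD; exact: mE.
apply: (@le_trans _ _ (\int[gauss K]_t (C0%:E * ((expR (moment_exponent 0 k s (crd b) t))%:E
      + (expR (moment_exponent c k s (crd b) t))%:E)))%E).
  apply: ge0_le_integral => //.
  - apply/measurable_EFinP; apply: (measurableT_comp (@measurable_expR R)).
    apply: measurable_funN; apply: measurable_funM => //.
    by apply: (measurableT_comp measurable_lower_value (g := pair b)); exact: pair1_measurable.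
  - by apply: emeasurable_funM; [exact: measurable_cst|exact: mE2].
  - by move=> t _; rewrite -EFinD -EFinM lee_fin.
rewrite ge0_integralZl//; [|by move=> t _; rewrite adde_ge0|exact: ex0].
rewrite ge0_integralD// EFinM -muleA; apply: lee_wpmul2l; first exact: ex0.
have pp : (0 <= \prod_j phi k (crd b j))%E by apply: prode_ge0.
rewrite mulrDl mul1r EFinD ge0_muleDl ?lee_fin ?mulr_ge0 ?expR_ge0//.
apply: leeD.
  apply: (le_trans (gauss_moment_exponent _ _ _ _)); first by rewrite lexx ler01.
  by rewrite expr0n/= mulr0 add0r.
apply: (le_trans (gauss_moment_exponent _ _ _ c01)).
by rewrite expRD.
Qed.

Lemma lower_value_moment k : 0 <= k <= 1 -> 0 <= k * mean_energy n p gam sigma q / n%:R <= 1 ->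
  (\int[prodP (fun _ : 'I_p => P0)]_b \int[gauss K]_t
     (expR (- (k * lower_value P0 gam sigma q (crd b) (rowg t) (colg t))))%:E <=
   (moment_bound k)%:E)%E.
Proof.
move=> k01 c01.
have pp (b : #|'I_p|.-tuple RT) : (0 <= \prod_j phi k (crd b j))%E by apply: prode_ge0.
have mp : measurable_fun setT (fun b : #|'I_p|.-tuple RT => \prod_j phi k (crd b j))%E.
  by apply: emeasurable_prod => j; apply: (measurableT_comp (@mphi k)); exact: measurable_crd.
apply: le_trans.
  apply: ge0_le_integral; [by []| | | |by move=> b _; exact: gauss_lower_value].
  - by move=> b _; apply: integral_ge0 => t _; rewrite lee_fin expR_ge0.
  - have mF := @measurable_fun_fubini_tonelli_F _ _ _ _ R (gauss K) (fun bt : (#|'I_p|.-tuple RT) * TT =>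
      (expR (- (k * lower_value P0 gam sigma q (crd bt.1) (rowg bt.2) (colg bt.2))))%:E).
    apply: mF; last by move=> bt; rewrite lee_fin expR_ge0.
    apply/measurable_EFinP; apply: (measurableT_comp (@measurable_expR R)).
    by apply: measurable_funN; apply: measurable_funM => //; exact: measurable_lower_value.
  - exact: emeasurable_funM.
have B0 : 0 <= expR (- (k * mean_energy n p gam sigma q) + k * (gam * p%:R * q / 2)) *
      ((1 + expR (n%:R * C1 * (k * mean_energy n p gam sigma q / n%:R) ^+ 2)) *
      expR ((- (k * scale p gam * sigma)) ^+ 2 / 2)).
  by rewrite !mulr_ge0 ?addr_ge0 ?expR_ge0.
rewrite ge0_integralZl//.
apply: (le_trans (lee_wpmul2l _ (prodP_phi k01))) => //.
by rewrite -EFinM lee_fin /moment_bound sqrrN !mulrA.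
Qed.

End auxiliary_exponential_moment.

(** * Lower tail of the minimal energy *)

(** [H] is kept as a variable of its own, not as a function of [m], so that the energy is
    continuous. *)
Definition energy {R : realType} (n p : nat) (gam sigma q tau : R)
    (G : 'I_n -> ('I_p + unit)%type -> R) (b m : 'I_p -> R) (H : R) : R :=
  scale p gam * Num.sqrt (\sum_i (\sum_j G i j * residual_vec sigma b m j) ^+ 2 + tau)
  + tilted_cost n gam sigma q b m H.

Lemma measurable_energy {R : realType} (n p : nat) (gam sigma q tau : R) d (T : measurableType d)
    (G : T -> 'I_n -> ('I_p + unit)%type -> measurableTypeR R) (b : T -> 'I_p -> measurableTypeR R)
    (m : 'I_p -> R) (H : R) :
  (forall i j, measurable_fun setT (fun t => G t i j)) ->
  (forall j, measurable_fun setT (b ^~ j)) ->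
  measurable_fun setT (fun t => energy gam sigma q tau (G t) (b t) m H).
Proof.
move=> mG mb; apply: measurable_funD.
  apply: measurable_funM => //; apply: (measurableT_comp (@measurable_sqrt R)).
  apply: measurable_funD => //; apply: measurable_sum => i; apply: measurable_funX.
  apply: measurable_sum => j; apply: measurable_funM; first exact: mG.
  case: j => [j|u] /=; last exact: measurable_cst.
  by apply: measurable_funM => //; apply: measurable_funB => //; exact: mb.
apply: measurable_funD => //; apply: measurable_funM => //.
apply: (measurableT_comp (@normr_measurable R setT)).
apply: measurable_funB => //; apply: measurable_funM => //; apply: measurable_sum => j.
by apply: measurable_funX; apply: measurable_funB => //; exact: mb.
Qed.

Section energy_lower_tail.
Context {R : realType}.
Local Notation RT := (measurableTypeR R).
Local Notation N := (normal_prob (0 : R) 1).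
Variables (P0 : probability RT R) (n p : nat) (gam sigma q tau C1 C2 k c : R).
Local Notation J := ('I_p + unit)%type.
Local Notation K := (gordon_index 'I_n J).
Local Notation TT := (#|K|.-tuple RT).
Local Notation TB := (#|'I_p|.-tuple RT).
Local Notation PB := (prodP (fun _ : 'I_p => P0)).
Hypotheses (n0 : (0 < n)%N) (p0 : (0 < p)%N) (gam0 : 0 < gam) (sigma0 : 0 < sigma)
  (q0 : 0 <= q) (tau0 : 0 < tau)
  (hC1 : forall k, 0 <= k <= 1 ->
    (\int[N]_x (expR (k * (1 - x ^+ 2)))%:E <= (expR (C1 * k ^+ 2))%:E)%E)
  (hC2 : forall k, 0 <= k <= 1 ->
    (\int[P0]_b \int[N]_z (expR (- (k * infodens P0 gam b z)))%:E <=
     (expR (- (k * mean_infodens P0 gam) + C2 * k ^+ 2))%:E)%E)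
  (k01 : 0 <= k <= 1) (kL : 0 <= k * mean_energy n p gam sigma q / n%:R <= 1).

Local Notation E bt := (energy gam sigma q tau (ent bt.2) (crd bt.1)).

Let sc0 : 0 < scale p gam.
Proof. by rewrite sqrtr_gt0 mulr_gt0// ltr0n. Qed.

Let mlv (b : TB) : measurable_fun setT (fun t : TT => lower_value P0 gam sigma q (crd b) (rowg t) (colg t)).
Proof.
have H := measurableT_comp (@measurable_lower_value R P0 n p gam sigma q) (pair1_measurable b).
exact: H.
Qed.

Let mlow (b : TB) : measurable [set t : TT | (lower_value P0 gam sigma q (crd b) (rowg t) (colg t) < c + 1)%R].
Proof.
rewrite (_ : mkset _ = (fun t : TT => lower_value P0 gam sigma q (crd b) (rowg t) (colg t)) @^-1` `]-oo, c + 1[%classic).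
  by rewrite -[X in measurable X]setTI; apply: mlv => //; exact: measurable_itv.
by apply/seteqP; split => t /=; rewrite in_itv.
Qed.

Lemma gauss_energy_le (F : finType) (e : F -> ('I_p -> R) * R) (b : TB) :
  (forall v, entropy_epigraph P0 gam (e v).1 (e v).2) ->
  (gauss K [set t | exists v, (E (b, t) (e v).1 (e v).2 <= c)%R] <=
   (gordon_const^-1)%:E * gauss K [set t | (lower_value P0 gam sigma q (crd b) (rowg t) (colg t) < c + 1)%R])%E.
Proof.
move=> epi.
pose V v := residual_vec sigma (crd b) (e v).1.
pose psi v := tilted_cost n gam sigma q (crd b) (e v).1 (e v).2 / scale p gam.
(* Gordon's inequality is applied after division by [scale]; this margin becomes the 1 in
   [c + 1]. *)
have a0 : 0 < (scale p gam)^-1 by rewrite invr_gt0.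
have H := @gordon_comparison R F 'I_n J V psi tau tau0 (c / scale p gam) (scale p gam)^-1 a0.
have g0 := @gordon_const_gt0 R.
have -> : [set t : TT | exists v, E (b, t) (e v).1 (e v).2 <= c] =
    [set t : TT | exists v, primal V psi tau t v <= c / scale p gam].
  apply/seteqP; split => t /= [v hv]; exists v; move: hv;
  by rewrite ler_pdivlMr// mulrC mulrDr /psi mulrCA divff ?gt_eqF// mulr1.
have mP : measurable [set t : TT | exists v, primal V psi tau t v <= c / scale p gam].
  by apply: measurable_exists_le => v; exact: measurable_primal.
have mA : measurable [set t : TT | exists v, auxil V psi tau t v < c / scale p gam + (scale p gam)^-1].
  by apply: measurable_exists_lt => v; exact: measurable_auxil.
apply: (@le_trans _ _ ((gordon_const^-1)%:E * gauss K [set t : TT | exists v, (auxil V psi tau t v < c / scale p gam + (scale p gam)^-1)%R])%E).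
  rewrite -(fineK (fin_num_measure (gauss K) _ mP)) -(fineK (fin_num_measure (gauss K) _ mA)).
  by rewrite -EFinM lee_fin [leRHS]mulrC ler_pdivlMr// [leLHS]mulrC.
apply: lee_wpmul2l; first by rewrite lee_fin invr_ge0 ltW.
apply: le_measure; rewrite ?inE; [exact: mA|exact: mlow|move=> t /= [v hv]].
apply: (le_lt_trans (auxiliary_ge n0 p0 gam0 sigma0 q0 tau0 (crd b) (rowg t) (colg t) (epi v))).
move: hv; rewrite -[X in _ + X]mul1r -mulrDl ltr_pdivlMr// mulrC mulrDr /psi mulrCA divff ?gt_eqF//.
by rewrite mulr1.
Qed.

Lemma lower_value_markov (b : TB) :
  (gauss K [set t | (lower_value P0 gam sigma q (crd b) (rowg t) (colg t) < c + 1)%R] <=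
   (expR (k * (c + 1)))%:E *
   \int[gauss K]_t (expR (- (k * lower_value P0 gam sigma q (crd b) (rowg t) (colg t))))%:E)%E.
Proof.
have k0 : 0 <= k by case/andP: k01.
have me : measurable_fun setT (fun t : TT => (expR (- (k * lower_value P0 gam sigma q (crd b) (rowg t) (colg t))))%:E).
  apply/measurable_EFinP; apply: (measurableT_comp (@measurable_expR R)).
  by apply: measurable_funN; apply: measurable_funM => //; exact: mlv.
rewrite -[X in gauss K X]setIT -integral_indic// -ge0_integralZl//.
apply: ge0_le_integral => //.
- by apply/measurable_EFinP; exact: measurable_indic.
- by apply: emeasurable_funM.
- move=> t _; rewrite -EFinM lee_fin -expRD indicE.
  case: (boolP (_ \in _)) => [|_]; last by rewrite expR_ge0.
  rewrite inE/= => h; apply: le_trans (expR_ge1Dx _); rewrite lerDl.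
  by rewrite -mulrBr mulr_ge0// subr_ge0 ltW.
Qed.

Definition tail_bound : R :=
  (gordon_const : R)^-1 * (expR (k * (c + 1)) * moment_bound P0 n p gam sigma q C1 C2 k).

Let mE1 (m : 'I_p -> R) (H : R) : measurable_fun setT (fun bt : TB * TT => E bt m H).
Proof.
apply: measurable_energy => [i j|j]; last by apply: (measurableT_comp (measurable_crd j)).
by apply: (measurableT_comp (measurable_crd _)).
Qed.

(** The comparison and Markov's inequality hold for each fixed signal [b]; integrating over [b] then
    averages the exponential moment of [lower_value]. *)
Lemma energy_le_finite (F : finType) (e : F -> ('I_p -> R) * R) :
  (forall v, entropy_epigraph P0 gam (e v).1 (e v).2) ->
  ((PB \x gauss K) [set bt | exists v, (E bt (e v).1 (e v).2 <= c)%R] <= tail_bound%:E)%E.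
Proof.
move=> epi.
have mS : measurable [set bt : TB * TT | exists v, E bt (e v).1 (e v).2 <= c].
  by apply: measurable_exists_le => v; exact: mE1.
rewrite /product_measure1/=.
have mL : measurable_fun setT (fun bt : TB * TT =>
    (expR (- (k * lower_value P0 gam sigma q (crd bt.1) (rowg bt.2) (colg bt.2))))%:E).
  apply/measurable_EFinP; apply: (measurableT_comp (@measurable_expR R)).
  by apply: measurable_funN; apply: measurable_funM => //; exact: measurable_lower_value.
have mF := @measurable_fun_fubini_tonelli_F _ _ _ _ R (gauss K) _ mL.
have {}mF := mF (fun bt => expR_ge0 _).
have C0 : (0 <= ((gordon_const : R)^-1 * expR (k * (c + 1)))%:E)%E.
  by rewrite lee_fin mulr_ge0 ?expR_ge0// invr_ge0 ltW// gordon_const_gt0.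
apply: (@le_trans _ _ (\int[PB]_b (((gordon_const : R)^-1 * expR (k * (c + 1)))%:E *
   \int[gauss K]_t (expR (- (k * lower_value P0 gam sigma q (crd b) (rowg t) (colg t))))%:E))%E).
  apply: ge0_le_integral => //.
  - exact: measurable_fun_xsection.
  - exact: emeasurable_funM.
  - move=> b _ /=.
    rewrite (_ : xsection _ b = [set t : TT | exists v, E (b, t) (e v).1 (e v).2 <= c]); last first.
      by apply/seteqP; split => t; rewrite /xsection/= inE.
    apply: (le_trans (gauss_energy_le b epi)); rewrite EFinM -muleA.
    by apply: lee_wpmul2l; [rewrite lee_fin invr_ge0 ltW// gordon_const_gt0|exact: lower_value_markov].
rewrite ge0_integralZl//; last first.
  by move=> b _; apply: integral_ge0 => t _; rewrite lee_fin expR_ge0.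
have -> : tail_bound = (gordon_const^-1 * expR (k * (c + 1))) * moment_bound P0 n p gam sigma q C1 C2 k.
  by rewrite /tail_bound mulrA.
rewrite [leRHS]EFinM; apply: lee_wpmul2l => //.
exact: lower_value_moment.
Qed.

(** The finite bound is the same for every number of points, so continuity from below passes it to
    the union. *)
Lemma energy_le_countable (e : nat -> ('I_p -> R) * R) :
  (forall i, entropy_epigraph P0 gam (e i).1 (e i).2) ->
  ((PB \x gauss K) [set bt | exists i, (E bt (e i).1 (e i).2 <= c)%R] <= tail_bound%:E)%E.
Proof.
move=> epi.
pose S N := [set bt : TB * TT | exists v : 'I_N, E bt (e v).1 (e v).2 <= c].
have mS N : measurable (S N) by apply: measurable_exists_le => v; exact: mE1.
have -> : [set bt | exists i, (E bt (e i).1 (e i).2 <= c)%R] = \bigcup_N S N.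
  apply/seteqP; split => bt /=; first by move=> [i hi]; exists i.+1 => //; exists ord_max.
  by move=> [N _ [v hv]]; exists v.
have ndS : nondecreasing_seq S.
  move=> N1 N2 le12; apply/subsetPset => bt [v hv].
  by exists (widen_ord le12 v).
have H := nondecreasing_cvg_mu (mu := (PB \x gauss K)%E) mS (bigcup_measurable (fun k _ => mS k)) ndS.
rewrite -(cvg_lim _ H)//; apply: lime_le; first by apply/cvg_ex; exists (((PB \x gauss K)%E) (\bigcup_N S N)).
by apply: nearW => N; apply: energy_le_finite => v; exact: epi.
Qed.

End energy_lower_tail.

(** * Countable dense families and continuity of the energy *)

Lemma countable_dense_sequence {R : realType} (p : nat) (E : ('I_p -> R) * R -> Prop) mh0 : E mh0 ->
  exists e : nat -> ('I_p -> R) * R, (forall i, E (e i)) /\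
  forall mh (eps : R), E mh -> 0 < eps ->
    exists i, (forall j, `|mh.1 j - (e i).1 j| < eps) /\ `|mh.2 - (e i).2| < eps.
Proof.
move=> E0.
(* Cells with rational centres and radii [1 / (N + 1)]: a point of [E] is chosen in every cell that
   meets [E], and [mh0] serves for some cells that do not. *)
pose C := ({ffun 'I_p -> rat} * rat * nat)%type.
pose near_cell (c : C) (mh : ('I_p -> R) * R) :=
  (forall j, `|mh.1 j - ratr (c.1.1 j)| < c.2.+1%:R^-1) /\ `|mh.2 - ratr c.1.2| < c.2.+1%:R^-1.
have pick c : exists mh, E mh /\ forall mh', E mh' -> near_cell c mh' -> near_cell c mh.
  have [[mh [Emh cmh]]|no] := pselect (exists mh, E mh /\ near_cell c mh); first by exists mh.
  by exists mh0; split => // mh' Emh' cmh'; exfalso; apply: no; exists mh'.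
have [f fP] := choice pick.
pose c0 : C := ([ffun=> 0], 0, 0%N).
exists (fun i => f (odflt c0 (unpickle i))); split => [i|mh eps Emh eps0]; first by case: (fP (odflt c0 (unpickle i))).
(* Two points of one cell may be two radii apart, hence [eps / 2]. *)
have [N hN] : exists N : nat, N.+1%:R^-1 < eps / 2 :> R.
  have e2 : 0 < eps / 2 by rewrite divr_gt0.
  by have [N hN] := ltr_add_invr e2; exists N; rewrite add0r in hN.
have rx (x : R) : exists r : rat, `|x - ratr r| < N.+1%:R^-1.
  have [|r] := @rat_in_itvoo R (x - N.+1%:R^-1) (x + N.+1%:R^-1); first by rewrite ltrD2l gtrN.
  rewrite in_itv/= => /andP[r1 r2]; exists r; rewrite ltr_distlC; apply/andP; split => //.
have [rj hrj] := choice rx.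
pose c : C := ([ffun j => rj (mh.1 j)], rj mh.2, N).
have cc : near_cell c mh by split => [j|] /=; rewrite ?ffunE; exact: hrj.
exists (pickle c); rewrite pickleK/=.
have [_ /(_ _ Emh cc) [h1 h2]] := fP c.
have tri (x y r : R) : `|x - r| < N.+1%:R^-1 -> `|y - r| < N.+1%:R^-1 -> `|x - y| < eps.
  rewrite -[in X in _ -> X -> _]distrC => hx hy.
  have -> : x - y = (x - r) + (r - y) by ring.
  by apply: (le_lt_trans (ler_normD _ _)); move: hN hx hy; set z := _^-1; lra.
by case: cc => h3 h4; split => [j|]; [exact: (tri _ _ _ (h3 j) (h1 j))|exact: (tri _ _ _ h4 h2)].
Qed.

Section energy_continuity.
Context {R : realType}.
Variables (n p : nat) (gam sigma q tau : R) (G : 'I_n -> ('I_p + unit)%type -> R) (b : 'I_p -> R).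

Lemma cvg_bigsum (I : finType) (u : I -> nat -> R) (l : I -> R) :
  (forall i, u i @ \oo --> l i) -> (\sum_i u i N) @[N --> \oo] --> \sum_i l i.
Proof.
move=> ul; elim: (index_enum I) => [|i s IH].
  by under eq_fun do rewrite big_nil; rewrite big_nil; exact: cvg_cst.
under eq_fun do rewrite big_cons; rewrite big_cons; apply: cvgD => //; exact: ul.
Qed.

Lemma energy_cvg (mN : nat -> 'I_p -> R) (HN : nat -> R) m H :
  (forall j, mN N j @[N --> \oo] --> m j) -> HN @ \oo --> H ->
  energy gam sigma q tau G b (mN N) (HN N) @[N --> \oo] --> energy gam sigma q tau G b m H.
Proof.
move=> mm HH.
apply: cvgD.
  apply: cvgM; first exact: cvg_cst.
  apply: (@cvg_comp _ _ _ _ Num.sqrt); last exact: sqrt_continuous.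
  apply: cvgD; last exact: cvg_cst.
  apply: cvg_bigsum => i; apply: (@cvg_comp _ _ _ _ (fun x => x ^+ 2)); last exact: exprn_continuous.
  apply: cvg_bigsum => j; apply: cvgM; first exact: cvg_cst.
  case: j => [j|u] /=; last exact: cvg_cst.
  apply: cvgM; last exact: cvg_cst.
  by apply: cvgB; [exact: cvg_cst|exact: mm].
apply: cvgD.
  apply: cvgB => //; apply: cvgM; first exact: cvg_cst.
  apply: cvg_bigsum => j; apply: (@cvg_comp _ _ _ _ (fun x => x ^+ 2)); last exact: exprn_continuous.
  exact: mm.
apply: cvgM; first exact: cvg_cst.
apply: cvg_norm; apply: cvgB; last exact: cvg_cst.
apply: cvgM; first exact: cvg_cst.
apply: cvg_bigsum => j; apply: (@cvg_comp _ _ _ _ (fun x => x ^+ 2)); last exact: exprn_continuous.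
by apply: cvgB; [exact: mm|exact: cvg_cst].
Qed.

(** By continuity a strict violation at any point of [E] already shows at a member of the sequence;
    so the countable event contains the uncountable one. *)
Lemma energy_dense (E : ('I_p -> R) * R -> Prop) (e : nat -> ('I_p -> R) * R) (mh : ('I_p -> R) * R) (c : R) :
  (forall mh (eps : R), E mh -> 0 < eps ->
    exists i, (forall j, `|mh.1 j - (e i).1 j| < eps) /\ `|mh.2 - (e i).2| < eps) ->
  E mh -> energy gam sigma q tau G b mh.1 mh.2 < c ->
  exists i, energy gam sigma q tau G b (e i).1 (e i).2 <= c.
Proof.
move=> de Emh lc.
have pick (N : nat) : exists i, (forall j, `|mh.1 j - (e i).1 j| < N.+1%:R^-1) /\ `|mh.2 - (e i).2| < N.+1%:R^-1.
  by apply: de => //; rewrite invr_gt0.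
have [f fP] := choice pick.
have cv (x : R) (y : nat -> R) : (forall N, `|x - y N| < N.+1%:R^-1) -> y @ \oo --> x.
  move=> xy; apply/cvgrPdist_lt => eps eps0; near=> N.
  apply: (lt_trans (xy N)); near: N; exact: near_infty_natSinv_lt (PosNum eps0).
have := @energy_cvg (fun N => (e (f N)).1) (fun N => (e (f N)).2) mh.1 mh.2 (fun j => cv _ _ (fun N => (fP N).1 j)) (cv _ _ (fun N => (fP N).2)).
move=> /cvgr_lt /(_ _ lc) [N _ hN]; exists (f N).
by apply: ltW; apply: hN => /=.
Unshelve. all: by end_near. Qed.

End energy_continuity.

(** * Transfer from standard Gaussian coordinates to the model *)

Lemma measurable_div_preimage {R : realType} (s : R) (A : set (measurableTypeR R)) : measurable A ->
  measurable ([set x | A (x / s)] : set (measurableTypeR R)).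
Proof.
move=> mA; have mid : measurable_fun setT (@id (measurableTypeR R)) by exact: measurable_id.
by rewrite -[X in measurable X]setTI; apply: (measurable_funM mid (measurable_cst s^-1)).
Qed.

Lemma normal_prob_scale {R : realType} (s : R) (A : set (measurableTypeR R)) : 0 < s -> measurable A ->
  normal_prob 0 s [set x | A (x / s)] = normal_prob 0 1 A.
Proof.
move=> s0 mA.
have mA' := measurable_div_preimage s mA.
have I (Q : probability (measurableTypeR R) R) B : measurable B -> Q B = (\int[Q]_x (\1_B x)%:E)%E.
  by move=> mB; rewrite integral_indic// setIT.
apply: (etrans (I _ _ mA')); apply: (etrans _ (esym (I _ _ mA))).
apply: etrans; first (apply/esym; apply: ge0_integral_normal_affine) => //.
  by apply/measurable_EFinP; exact: measurable_indic.
apply: eq_integral => x _; rewrite add0r; congr EFin.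
rewrite !indicE; congr ((_ : bool)%:R); apply/idP/idP; rewrite !inE/= mulrAC divff ?gt_eqF// mul1r//.
Qed.

Section law_transfer.
Context {R : realType}.
Local Notation RT := (measurableTypeR R).
Local Notation N := (normal_prob (0 : R) 1).
Variables (P0 : probability RT R) (n p : nat).
Local Notation J := ('I_p + unit)%type.
Local Notation K := (gordon_index 'I_n J).
Local Notation TT := (#|K|.-tuple RT).
Local Notation TB := (#|'I_p|.-tuple RT).
Local Notation PB := (prodP (fun _ : 'I_p => P0)).
Definition model_index : finType := ('I_n * 'I_p + 'I_p + 'I_n)%type.
Local Notation M := model_index.
Definition standard_law (k : M) : probability RT R :=
  match k with inl (inr _) => P0 | _ => N end.

(** The tail bound lives on signals times Gordon coordinates, the theorem on an arbitrary space.
    Both are mapped to the common space of model entries; the last matrix column is read as the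
    noise. *)
Definition merge_coordinates (bt : TB * TT) (k : M) : RT :=
  match k with
  | inl (inl ij) => ent bt.2 ij.1 (inl ij.2)
  | inl (inr j) => crd bt.1 j
  | inr i => ent bt.2 i (inr tt)
  end.

Lemma measurable_merge_coordinates k : measurable_fun setT (merge_coordinates ^~ k).
Proof.
case: k => [[[i j]|j]|i] /=; last by apply: (measurableT_comp (measurable_crd _)).
- by apply: (measurableT_comp (measurable_crd _)).
- by apply: (measurableT_comp (measurable_crd j)).
Qed.

Lemma merge_coordinates_law B : measurable B ->
  (PB \x gauss K)%E ((fun bt => mkt (merge_coordinates bt)) @^-1` B) = prodP standard_law B.
Proof.
apply: law_prodP => [k|A mA]; first exact: measurable_merge_coordinates.
pose Ab (j : 'I_p) := A (inl (inr j)).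
pose Ag (k : K) : set RT := match k with
  | inl (inl ij) => match ij.2 with inl j => A (inl (inl (ij.1, j))) | inr _ => A (inr ij.1) end
  | _ => setT end.
have mAb j : measurable (Ab j) by exact: mA.
have mAg k : measurable (Ag k) by case: k => [[[i [j|u]]|u]|k] //=; exact: mA.
have -> : [set bt | forall k, A k (merge_coordinates bt k)] = rect Ab `*` rect Ag.
  apply/seteqP; split => -[b t] /=.
    move=> h; split => [j|k]; first exact: (h (inl (inr j))).
    by case: k => [[[i [j|[]]]|u]|k] //.
  move=> [hb hg] [[[i j]|j]|i] /=; [exact: (hg (inl (inl (i, inl j))))|exact: hb|].
  exact: (hg (inl (inl (i, inr tt)))).
apply: (@etrans _ _ (PB (rect Ab) * gauss K (rect Ag))%E).
  by apply: product_measure1E; exact: measurable_rect.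
have EB : PB (rect Ab) = (\prod_j P0 (A (inl (inr j))))%E by exact: prodP_rect.
have EG : gauss K (rect Ag) = ((\prod_ij N (A (inl (inl ij)))) * \prod_i N (A (inr i)))%E.
  rewrite /gauss prodP_rect// big_sumType/= [X in (_ * X)%E]big1 ?mule1; last first.
    by move=> i _; exact: (probability_setT N).
  rewrite big_sumType/= [X in (_ * X)%E]big1 ?mule1; last first.
    by move=> i _; exact: (probability_setT N).
  transitivity (\prod_i ((\prod_j N (A (inl (inl (i, j))))) * N (A (inr i))))%E.
    rewrite -(pair_bigA _ (fun i j => N (Ag (inl (inl (i, j))))))/=.
    apply: eq_bigr => i _; rewrite big_sumType/=; congr (_ * _)%E.
    by rewrite (big_pred1 tt)// => -[].
  rewrite big_split/=; congr (_ * _)%E.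
  by rewrite (pair_bigA _ (fun i j => N (A (inl (inl (i, j))))))/=; apply: eq_bigr => -[].
rewrite EB EG [RHS]big_sumType/= [X in _ = (X * _)%E]big_sumType/= muleA; congr (_ * _)%E.
exact: muleC.
Qed.

Section model.
Context d (Om : measurableType d) (P : probability Om R) (s2 : R).
Context (x : 'I_n -> 'I_p -> {RV P >-> RT}) (beta0 : 'I_p -> {RV P >-> RT})
  (eps : 'I_n -> {RV P >-> RT}).
Hypotheses (p0 : (0 < p)%N) (s20 : 0 < s2) (model : gaussian_linear_model P0 s2 x beta0 eps).

Definition entry_sd (k : M) : R :=
  match k with
  | inl (inl _) => Num.sqrt p%:R^-1
  | inl (inr _) => 1
  | inr _ => Num.sqrt s2
  end.

Definition standardized (w : Om) (k : M) : RT := model_entries x beta0 eps k w / entry_sd k.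

Lemma measurable_standardized k : measurable_fun setT (standardized ^~ k).
Proof.
have mz (z : {RV P >-> RT}) (r : R) : measurable_fun setT (fun w => z w / r : RT).
  by apply: measurable_funM; [exact: (measurable_funPT z)|exact: measurable_cst].
by case: k => [[[i j]|j]|i]; exact: mz.
Qed.

Lemma standardized_law B : measurable B ->
  P ((fun w => mkt (standardized w)) @^-1` B) = prodP standard_law B.
Proof.
apply: law_prodP => [k|A mA]; first exact: measurable_standardized.
pose A' (k : M) : set RT := [set y | A k (y / entry_sd k)].
have mA' k : measurable (A' k) by exact: measurable_div_preimage.
have -> : [set w | forall k, A k (standardized w k)] =
    \bigcap_(k in [set: M]) (model_entries x beta0 eps k @^-1` A' k).
  by apply/seteqP; split => w /= h k; [move=> _|]; exact: h.
apply: (etrans (entries_independent model mA')); apply: eq_bigr => k _.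
case: k => [[[i j]|j]|i] /=.
- apply: (etrans (design_law model i j (mA' _))); apply: normal_prob_scale => //.
  by rewrite sqrtr_gt0 invr_gt0 ltr0n.
- apply: (etrans (signal_law model j (mA' _))); congr (P0 _).
  by apply/seteqP; split => y /=; rewrite /A'/= divr1.
- apply: (etrans (noise_law model i (mA' _))); apply: normal_prob_scale => //.
  by rewrite sqrtr_gt0.
Qed.

Definition model_matrix (w : Om) (i : 'I_n) (j : J) : RT :=
  match j with
  | inl j => standardized w (inl (inl (i, j)))
  | inr _ => standardized w (inr i)
  end.

(** Both events are preimages of one measurable set [B] under maps with the same image law. *)
Lemma model_energy_law gam sigma q tau c (e : nat -> ('I_p -> R) * R) :
  let S := [set w | exists i, energy gam sigma q tau (model_matrix w) (beta0 ^~ w) (e i).1 (e i).2 <= c] in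
  measurable S /\
  P S = (PB \x gauss K)%E
    [set bt | exists i, energy gam sigma q tau (ent bt.2) (crd bt.1) (e i).1 (e i).2 <= c].
Proof.
pose GM (u : #|M|.-tuple RT) (i : 'I_n) (j : J) : RT :=
  match j with inl j => crd u (inl (inl (i, j)) : M) | inr _ => crd u (inr i : M) end.
pose bM (u : #|M|.-tuple RT) (j : 'I_p) : RT := crd u (inl (inr j) : M).
pose B := [set u | exists i, energy gam sigma q tau (GM u) (bM u) (e i).1 (e i).2 <= c].
have mB : measurable B.
  rewrite (_ : B = \bigcup_i ((fun u => energy gam sigma q tau (GM u) (bM u) (e i).1 (e i).2) @^-1` `]-oo, c]%classic)).
    apply: bigcup_measurable => i _; rewrite -[X in measurable X]setTI.
    apply: measurable_energy => //; last by move=> j; exact: measurable_crd.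
    by move=> i' [j|u]; exact: measurable_crd.
  apply/seteqP; split => u /=; first by move=> [i h]; exists i => //=; rewrite in_itv.
  by move=> [i _]; rewrite /= in_itv/= => h; exists i.
have GE1 w : GM (mkt (standardized w)) = model_matrix w.
  by apply/funext => i'; apply/funext => -[j|u]; rewrite /GM crd_mkt.
have bE1 w : bM (mkt (standardized w)) = beta0 ^~ w.
  by apply/funext => j; rewrite /bM crd_mkt /standardized/= divr1.
have GE2 bt : GM (mkt (merge_coordinates bt)) = ent bt.2.
  by apply/funext => i'; apply/funext => -[j|[]]; rewrite /GM crd_mkt.
have bE2 bt : bM (mkt (merge_coordinates bt)) = crd bt.1.
  by apply/funext => j; rewrite /bM crd_mkt.
have E1 : [set w | exists i, energy gam sigma q tau (model_matrix w) (beta0 ^~ w) (e i).1 (e i).2 <= c] =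
   (fun w => mkt (standardized w)) @^-1` B.
  apply/seteqP; split => w [i h]; exists i; first by rewrite GE1 bE1.
  by rewrite GE1 bE1 in h.
have E2 : [set bt | exists i, energy gam sigma q tau (ent bt.2) (crd bt.1) (e i).1 (e i).2 <= c] =
   (fun bt => mkt (merge_coordinates bt)) @^-1` B.
  apply/seteqP; split => bt [i h]; exists i; first by rewrite GE2 bE2.
  by rewrite GE2 bE2 in h.
split; first rewrite E1 -[X in measurable X]setTI.
  by apply: measurable_mkt => // k; exact: measurable_standardized.
by rewrite E1 E2 merge_coordinates_law// standardized_law.
Qed.

End model.

End law_transfer.

(** * Mutual information of the Gaussian channel *)

Lemma measurable_lne {R : realType} : measurable_fun setT (@lne R).
Proof.
rewrite (_ : @lne R = fun x => if (x <= 0)%E then -oo%E else if x == +oo%E then +oo%E else (ln (fine x))%:E).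
  apply: measurable_fun_ifT; [exact: measurable_fun_lee|exact: measurable_cst|].
  apply: measurable_fun_ifT; [exact: measurable_fun_eqe|exact: measurable_cst|].
  apply/measurable_EFinP; apply: (measurableT_comp (@measurable_ln R)).
  exact: fine_measurable.
by apply/funext => -[r| |] //=; rewrite ?lee_fin ?leNye ?leye_eq.
Qed.

(** The given density agrees with the Radon-Nikodym derivative [Q]-almost everywhere, hence
    [P]-almost everywhere by domination; positivity of [f] turns [lne] into [ln]. *)
Lemma kl_divergence_density d (T : measurableType d) (R : realType) (P Q : probability T R)
    (f : T -> R) : measurable_fun setT f -> (forall x, 0 < f x) ->
  (forall A, measurable A -> P A = (\int[Q]_(x in A) (f x)%:E)%E) ->
  kl_divergence P Q = (\int[P]_x (ln (f x))%:E)%E.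
Proof.
move=> mf f0 PE.
have mEf : measurable_fun setT (EFin \o f) by exact/measurable_EFinP.
have PQ : P `<< Q.
  apply/null_content_dominatesP => A mA QA0; rewrite PE//.
  by apply: null_set_integral => //; exact: measurable_funTS.
have fi : Q.-integrable setT (EFin \o f).
  apply/integrableP; split => //; rewrite (eq_integral (EFin \o f)); last first.
    by move=> x _ /=; rewrite gtr0_norm.
  by rewrite -PE//; apply: (le_lt_trans (probability_le1 P measurableT)); exact: ltry.
rewrite /kl_divergence; case: asboolP => // _.
set D := Radon_Nikodym _ _.
have iD : Q.-integrable setT D by exact: Radon_Nikodym_integrable.
have mD := measurable_int _ iD.
have fD : ae_eq Q setT (EFin \o f) D.
  apply: integral_ae_eq => // E _ mE; rewrite -PE//.
  exact: (Radon_Nikodym_integral (nu := charge_of_finite_measure P) PQ mE).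
have := null_dominates_ae_eq measurableT PQ fD.
move=> fDP; apply: ae_eq_integral => //.
- exact: (measurableT_comp measurable_lne mD).
- by apply/measurable_EFinP; exact: (measurableT_comp (@measurable_ln R) mf).
- apply: ae_impl fDP => x /= h _; rewrite -h//= leNgt f0//.
Qed.

Lemma integral_probability_cst d (T : measurableType d) (R : realType) (Q : probability T R)
  (r : \bar R) : (\int[Q]_x r = r)%E.
Proof. by rewrite integral_cst// [X in (_ * X)%E](_ : _ = 1%E) ?mule1//; exact: (probability_setT Q). Qed.

Lemma probability_indic d (T : measurableType d) (R : realType) (Q : probability T R) A :
  measurable A -> Q A = (\int[Q]_x (\1_A x)%:E)%E.
Proof. by move=> mA; rewrite integral_indic// setIT. Qed.

Section channel_mutual_information.
Context {R : realType}.
Local Notation RT := (measurableTypeR R).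
Local Notation N := (normal_prob (0 : R) 1).
Variables (P0 : probability RT R) (gam M : R).
Hypotheses (gam0 : 0 < gam) (M0 : 0 <= M) (hM : {ae P0, forall b, `|b| <= M}).
Local Notation sg := (Num.sqrt gam).
Local Notation Z := (fun l => partition_fun P0 l gam).

(** Given input [b], the output is [sqrt gam * z] with the mean of [z] shifted by [sqrt gam * b]; by
    the tilt formula its density relative to the unshifted law is [tilt]. *)
Lemma ge0_integral_channel_pair (g : RT * RT -> \bar R) : measurable_fun setT g ->
  (forall x, 0 <= g x)%E ->
  (\int[channel_prob P0]_x g (x.1, channel_output gam x) =
   \int[P0]_b \int[N]_z (g (b, (sg * z)%R : RT) * (tilt (sg * z) gam b)%:E))%E.
Proof.
move=> mg g0.
have s2 : sg * sg = gam by rewrite -expr2 sqr_sqrtr// ltW.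
have mp : measurable_fun setT (fun x : RT * RT => (x.1, channel_output gam x)).
  by apply/measurable_fun_pairP; split; [exact: measurable_fst|exact: measurable_channel_output].
apply: (etrans (@fubini_tonelli1 _ _ RT RT R P0 N _ (measurableT_comp mg mp) (fun x => g0 _))).
apply: eq_integral => b _; rewrite /fubini_F/=.
have mid : measurable_fun setT (@id RT) by exact: measurable_id.
have ms : measurable_fun setT (fun z : RT => sg * z : RT) by exact: measurable_funM.
pose h (z : RT) := g (b, sg * z : RT).
have mh : measurable_fun setT h.
  by apply: (measurableT_comp mg); apply: (measurableT_comp (pair1_measurable b)).
transitivity (\int[N]_z h ((sg * b) + 1 * z)%R)%E.
  apply: eq_integral => z _; rewrite /h /channel_output/=; congr (g (_, _)).
  by rewrite mul1r mulrDr mulrA s2.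
apply: (etrans (ge0_integral_normal_affine (sg * b) ltr01 mh (fun z => g0 _))).
have H := ge0_integral_normal_tilt (sg * b) mh (fun z => g0 _).
suff HI I : (\int[N]_x (h x * (expR (sg * b * x))%:E) = (expR ((sg * b) ^+ 2 / 2))%:E * I)%E ->
  I = (\int[N]_z (g (b, (sg * z)%R) * (tilt (sg * z) gam b)%:E))%E by exact: HI H.
move=> {}H.
have -> : I = ((expR (- ((sg * b) ^+ 2 / 2)))%:E * ((expR ((sg * b) ^+ 2 / 2))%:E * I))%E.
  by rewrite muleA -EFinM -expRD addNr expR0 mul1e.
have mhe : measurable_fun setT (fun x : RT => (h x * (expR (sg * b * x))%:E)%E).
  apply: emeasurable_funM => //; apply/measurable_EFinP; apply: (measurableT_comp (@measurable_expR R)).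
  exact: measurable_funM.
rewrite -H -ge0_integralZl//; last first.
  by move=> z _; rewrite mule_ge0 ?lee_fin ?expR_ge0//; exact: g0.
apply: eq_integral => z _; rewrite muleCA -EFinM -expRD; congr (_ * (expR _)%:E)%E.
by rewrite exprMn expr2 s2; ring.
Qed.

Let PX := distribution (channel_prob P0) (channel_input : {RV channel_prob P0 >-> RT}).
Let PY := distribution (channel_prob P0) (channel_output gam : {RV channel_prob P0 >-> RT}).
Let PXY := distribution (channel_prob P0) (rv_pair (channel_input : {RV channel_prob P0 >-> RT})
   (channel_output gam : {RV channel_prob P0 >-> RT})).

Let density (x : RT * RT) : R := tilt x.2 gam x.1 / Z x.2.

Let mtilt : measurable_fun setT (fun x : RT * RT => tilt x.2 gam x.1).
Proof.
apply: (measurableT_comp (measurable_tilt gam) (g := fun x : RT * RT => (x.2, x.1))).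
by apply/measurable_fun_pairP; split; [exact: measurable_snd|exact: measurable_fst].
Qed.

Let mZ := measurable_partition P0 gam.

Let mdensity : measurable_fun setT density.
Proof.
apply: measurable_funM; first exact: mtilt.
by apply: measurable_inv_gt0 => [x|]; [exact: (partition_gt0 gam0 M0 hM)|apply: (measurableT_comp mZ); exact: measurable_snd].
Qed.

(** Averaging [tilt] over the input gives the partition function as density of the output, so the
    joint law has density [tilt / Z] relative to the product of the marginals. *)
Lemma ge0_integral_channel_output (k : RT -> \bar R) : measurable_fun setT k ->
  (forall l, 0 <= k l)%E ->
  (\int[PY]_l k l = \int[N]_z (k (sg * z)%R * (Z (sg * z)%R)%:E))%E.
Proof.
move=> mk k0; rewrite ge0_integral_distribution//.
have ms : measurable_fun setT (fun z : RT => sg * z : RT) by exact: measurable_funM.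
have mk2 : measurable_fun setT (fun x : RT * RT => k x.2).
  by apply: (measurableT_comp mk); exact: measurable_snd.
rewrite (ge0_integral_channel_pair mk2 (fun x => k0 _)).
have mf : measurable_fun setT (fun x : RT * RT => (k (sg * x.2)%R * (tilt (sg * x.2) gam x.1)%:E)%E).
  apply: emeasurable_funM.
    apply: (measurableT_comp mk); apply: (measurableT_comp ms); exact: measurable_snd.
  apply/measurable_EFinP; apply: (measurableT_comp mtilt (g := fun x : RT * RT => (x.1, sg * x.2 : RT))).
  apply/measurable_fun_pairP; split; [exact: measurable_fst|].
  by apply: (measurableT_comp ms); exact: measurable_snd.
have f0 x : (0 <= k (sg * x.2)%R * (tilt (sg * x.2) gam x.1)%:E)%E.
  by rewrite mule_ge0// lee_fin expR_ge0.
rewrite (@fubini_tonelli _ _ RT RT R P0 N _ mf f0).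
apply: eq_integral => z _; rewrite /= ge0_integralZl//.
- by rewrite (partition_EFin gam0 M0 hM).
- by apply/measurable_EFinP; exact: measurable_tilt2.
- by move=> b _; rewrite lee_fin expR_ge0.
Qed.

Lemma channel_density A : measurable A -> PXY A = (\int[PX \x PY]_(x in A) (density x)%:E)%E.
Proof.
move=> mA.
have d0 x : (0 <= (density x)%:E)%E.
  by rewrite lee_fin divr_ge0 ?expR_ge0// ltW// (partition_gt0 gam0 M0 hM).
pose F := (EFin \o density) \_ A.
have F0 x : (0 <= F x)%E by rewrite /F patchE; case: ifP => _; [exact: d0|exact: lexx].
have mF : measurable_fun setT F.
  apply/(measurable_restrictT _ _).1 => //; apply: measurable_funTS.
  by apply/measurable_EFinP; exact: mdensity.
rewrite integral_mkcond -/F fubini_tonelli1//.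
have mFF := @measurable_fun_fubini_tonelli_F _ _ _ _ R PY F mF F0.
rewrite ge0_integral_distribution//; last first.
  by move=> b; apply: integral_ge0 => l _.
have -> : (\int[channel_prob P0]_x ((fubini_F PY F) \o channel_input) x = \int[P0]_b fubini_F PY F b)%E.
  have mG : measurable_fun setT (fun x : RT * RT => fubini_F PY F x.1).
    by apply: (measurableT_comp mFF); exact: measurable_fst.
  have G0 (x : RT * RT) : (0 <= fubini_F PY F x.1)%E by apply: integral_ge0 => l _; exact: F0.
  apply: (etrans (@fubini_tonelli1 _ _ RT RT R P0 N _ mG G0)).
  apply: eq_integral => b _; exact: (integral_probability_cst N (fubini_F PY F b)).
have m1 : measurable_fun setT (fun x : RT * RT => (\1_A x)%:E : \bar R).
  by apply/measurable_EFinP; exact: measurable_indic.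
transitivity (\int[channel_prob P0]_x (\1_A (x.1, channel_output gam x))%:E)%E.
  apply: (etrans (probability_indic PXY mA)).
  by apply: (etrans (ge0_integral_distribution _ m1 _)) => // x; rewrite lee_fin.
have i0 x : (0 <= (\1_A x)%:E :> \bar R)%E by rewrite lee_fin.
apply: (etrans (ge0_integral_channel_pair m1 i0)).
apply: eq_integral => b _; rewrite /fubini_F ge0_integral_channel_output//; last first.
  by apply: (measurableT_comp mF); exact: pair1_measurable.
apply: eq_integral => z _; rewrite /F patchE indicE.
case: ifP => _; last by rewrite !mul0e.
by rewrite mul1e -EFinM /density/= mulfVK// gt_eqF// (partition_gt0 gam0 M0 hM).
Qed.

Lemma channel_mutual_infoE : channel_mutual_info P0 gam = (mean_infodens P0 gam)%:E.
Proof.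
have Zp l : 0 < Z l by exact: (partition_gt0 gam0 M0 hM).
have dp x : 0 < density x by rewrite divr_gt0 ?expR_gt0.
rewrite /channel_mutual_info /mutual_info (kl_divergence_density mdensity dp channel_density).
have ii := integrable_infodens gam0 M0 hM.
have E (x : RT * RT) : ln (density (rv_pair (channel_input : {RV channel_prob P0 >-> RT})
   (channel_output gam : {RV channel_prob P0 >-> RT}) x)) = infodens P0 gam x.1 x.2.
  rewrite /density/= /rv_pair/= /channel_output/= lnM ?posrE ?expR_gt0 ?invr_gt0// lnV ?posrE//.
  by rewrite /tilt expRK /infodens/= [in LHS]addrC; ring.
rewrite integral_distribution.
- rewrite (eq_integral (EFin \o (fun x : RT * RT => infodens P0 gam x.1 x.2))); last first.
    by move=> x _ /=; rewrite E.
  by rewrite /mean_infodens /Rintegral fineK//; exact: integrable_fin_num.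
- by apply/measurable_EFinP; apply: (measurableT_comp (@measurable_ln R)); exact: mdensity.
- by apply: eq_integrable ii => // x _ /=; rewrite E.
Qed.

End channel_mutual_information.

(** A point outside the support has a null neighbourhood, hence lies in a null interval with
    rational endpoints; there are countably many of these. *)
Lemma compact_support_bounded {R : realType} (P0 : probability (measurableTypeR R) R) :
  compact (measure_support P0) ->
  exists2 M : R, 0 <= M & {ae P0, forall b, `|b| <= M}.
Proof.
move=> /compact_bounded/pinfty_ex_gt0[M M0 hM]; exists M; first exact: ltW.
pose I (r : rat * rat) : set (measurableTypeR R) := `]ratr r.1, ratr r.2[%classic.
pose F (k : nat) := if unpickle k is Some r then (if P0 (I r) == 0%E then I r else set0) else set0.
have nF : P0.-negligible (\bigcup_k F k).
  apply: negligible_bigcup => k; rewrite /F; case: unpickle => [r|]; last exact: negligible_set0.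
  case: eqP => [h|_]; last exact: negligible_set0.
  by apply/negligibleP => //; exact: measurable_itv.
apply: negligibleS nF => x /= nx.
have [U [oU Ux PU]] : exists U : set R, [/\ open U, U x & P0 U = 0%E].
  apply: contrapT => no; apply: nx; apply: (hM x) => U oU Ux.
  rewrite lt0e measure_ge0 andbT; apply/eqP => PU; apply: no; by exists U.
have /nbhs_ballP[e /= e0 eU] : nbhs x U by apply: open_nbhs_nbhs.
have [|r1] := @rat_in_itvoo R (x - e) x; first by rewrite ltrBlDr ltrDl.
have [|r2] := @rat_in_itvoo R x (x + e); first by rewrite ltrDl.
rewrite !in_itv/= => /andP[h1 h2] /andP[h3 h4].
have FE : F (pickle (r1, r2)) = if P0 (I (r1, r2)) == 0%E then I (r1, r2) else set0 by rewrite /F pickleK.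
exists (pickle (r1, r2)); [exact: Logic.I|rewrite FE].
have -> : P0 (I (r1, r2)) == 0%E.
  rewrite -measure_le0 -PU; apply: le_measure; rewrite ?inE; [exact: measurable_itv|exact: open_measurable|].
  move=> y; rewrite /I/= in_itv/= => /andP[y1 y2]; apply: eU; rewrite /ball/= ltr_distlC.
  by apply/andP; split; [exact: (lt_trans h3)|exact: (lt_trans y2)].
by rewrite /I/= in_itv/= h4 h1.
Qed.

(** * Lower bound for the TAP free energy *)

(** The typical value of [lower_value], lowered by [eta] per coordinate. *)
Definition energy_level {R : realType} (P0 : probability (measurableTypeR R) R) (n p : nat)
    (gam sigma q eta : R) : R :=
  mean_energy n p gam sigma q - gam * p%:R * q / 2 + p%:R * mean_infodens P0 gam - p%:R * eta.

Section energy_tail.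
Context {R : realType}.
Local Notation RT := (measurableTypeR R).
Variables (P0 : probability RT R) (gam sigma q delta eta M : R).
Hypotheses (gam0 : 0 < gam) (sigma0 : 0 < sigma) (q0 : 0 <= q) (eta0 : 0 < eta)
  (gamE : gam * (q + sigma ^+ 2) = delta) (M0 : 0 <= M) (hM : {ae P0, forall b, `|b| <= M}).

Let delta0 : 0 < delta.
Proof. by rewrite -gamE mulr_gt0// ltr_wpDl// exprn_gt0. Qed.

(** The first-order terms cancel, except for the gain [k * eta * p] and the margin [k <= 1]; the
    assumption on [k] lets the second-order terms consume at most half of the gain. The 2 comes from
    [1 + expR x <= 2 * expR x]. *)
Lemma tail_bound_le n p C1 C2 k : (0 < n)%N -> (0 < p)%N -> 0 <= C1 -> 0 <= C2 -> 0 <= k <= 1 ->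
  k * (C1 * delta + delta / 2 + C2) <= eta / 2 ->
  tail_bound P0 n p gam sigma q C1 C2 k (energy_level P0 n p gam sigma q eta) <=
  gordon_const^-1 * (2 * expR 1) * expR (- (k * eta / 2 * p%:R)).
Proof.
move=> n0 p0 C10 C20 /andP[k0 k1] hk.
have nR : 0 < n%:R :> R by rewrite ltr0n.
have pR : 0 < p%:R :> R by rewrite ltr0n.
rewrite /tail_bound -mulrA ler_wpM2l ?invr_ge0 ?(ltW (@gordon_const_gt0 R))//.
rewrite /moment_bound /energy_level /=; set L := mean_energy _ _ _ _ _.
have L2 : L ^+ 2 = delta * p%:R * n%:R.
  by rewrite sqr_sqrtr gamE// !mulr_ge0// ltW.
have -> : n%:R * C1 * (k * L / n%:R) ^+ 2 = C1 * k ^+ 2 * delta * p%:R.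
  by rewrite !exprMn L2; field; rewrite gt_eqF.
have -> : (k * scale p gam * sigma) ^+ 2 = k ^+ 2 * (gam * sigma ^+ 2) * p%:R.
  by rewrite !exprMn /scale sqr_sqrtr ?mulr_ge0 ?(ltW gam0)//; ring.
set x := C1 * k ^+ 2 * delta * p%:R.
have x0 : 0 <= x by rewrite !mulr_ge0// ?sqr_ge0// ltW.
have h1 : 1 + expR x <= 2 * expR x.
  by have : 1 <= expR x by [rewrite -[leLHS]expR0 ler_expR]; lra.
set A := expR (k * _); set B := expR (- (k * L) + _); set C := expR (_ / 2); set D := expR (p%:R * _).
apply: (@le_trans _ _ (A * (B * (2 * expR x * C * D)))).
  rewrite ler_wpM2l ?expR_ge0// ler_wpM2l ?expR_ge0// ler_wpM2r ?expR_ge0// ler_wpM2r ?expR_ge0//.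
have -> : A * (B * (2 * expR x * C * D)) = 2 * (A * B * expR x * C * D) by ring.
rewrite -[leRHS]mulrA ler_wpM2l// /A /B /C /D -!expRD ler_expR.
set mi := mean_infodens _ _.
have g2 : gam * sigma ^+ 2 <= delta.
  by rewrite -gamE mulrDr lerDr mulr_ge0// ltW.
have kp0 : 0 <= k * p%:R by rewrite mulr_ge0// ltW.
have h2 : k ^+ 2 * (gam * sigma ^+ 2) * p%:R / 2 <= k ^+ 2 * delta * p%:R / 2.
  by rewrite ler_wpM2r// ler_wpM2r ?(ltW pR)// ler_wpM2l// sqr_ge0.
have h3 := ler_wpM2l kp0 hk.
have E1 : k * p%:R * (k * (C1 * delta + delta / 2 + C2)) =
  x + k ^+ 2 * delta * p%:R / 2 + C2 * k ^+ 2 * p%:R by rewrite /x; field.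
rewrite E1 in h3.
have -> : k * (L - gam * p%:R * q / 2 + p%:R * mi - p%:R * eta + 1) +
   (- (k * L) + k * (gam * p%:R * q / 2)) + x +
   k ^+ 2 * (gam * sigma ^+ 2) * p%:R / 2 + p%:R * (- (k * mi) + C2 * k ^+ 2) =
   k + (x + k ^+ 2 * (gam * sigma ^+ 2) * p%:R / 2 + C2 * k ^+ 2 * p%:R) - k * p%:R * eta by field.
have -> : k * eta / 2 * p%:R = k * p%:R * (eta / 2) by field.
move: h2 h3; set u := k ^+ 2 * (gam * sigma ^+ 2) * p%:R / 2; set v := k ^+ 2 * delta * p%:R / 2.
set y := C2 * k ^+ 2 * p%:R.
have -> : k * p%:R * eta = 2 * (k * p%:R * (eta / 2)) by field.
set z := k * p%:R * (eta / 2).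
by move=> h2 h3; clear -h2 h3 k1; lra.
Qed.

Lemma energy_tail : exists A B : R, [/\ 0 <= A, 0 < B &
  forall n p (tau : R) (e : nat -> ('I_p -> R) * R), (0 < n)%N -> (0 < p)%N -> 0 < tau ->
    delta * p%:R <= 4 * n%:R ->
    (forall i, entropy_epigraph P0 gam (e i).1 (e i).2) ->
    ((prodP (fun _ : 'I_p => P0) \x gauss (gordon_index 'I_n ('I_p + unit)%type))%E
      [set bt | exists i, (energy gam sigma q tau (ent bt.2) (crd bt.1) (e i).1 (e i).2 <=
                          energy_level P0 n p gam sigma q eta)%R]
     <= (A * expR (- (B * p%:R)))%:E)%E].
Proof.
have [C1 C10 hC1] := @normal_sqr_exp_bound R.
have [C2 C20 hC2] := infodens_exp_bound gam0 M0 hM.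
pose D := C1 * delta + delta / 2 + C2.
have D0 : 0 < D by rewrite ltr_pwDl// ltr_wpDl ?divr_gt0// mulr_ge0// ltW.
(* The bound [1 / 2] serves [kL]: since [delta * p <= 4 * n], the mean energy is at most [2 * n].
   Nothing in [k] depends on [n] or [p]. *)
pose k := Num.min (1 / 2) (eta / 2 / D).
have k0 : 0 < k by rewrite lt_min !divr_gt0.
have k12 : k <= 1 / 2 by rewrite ge_min lexx.
have kD : k * D <= eta / 2 by rewrite -ler_pdivlMr// ge_min lexx orbT.
have k01 : 0 <= k <= 1 by rewrite ltW//=; lra.
exists (gordon_const^-1 * (2 * expR 1)), (k * eta / 2); split.
- by rewrite !mulr_ge0 ?expR_ge0// invr_ge0 ltW// gordon_const_gt0.
- by rewrite divr_gt0// mulr_gt0.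
move=> n p tau e n0 p0 tau0 pn epi.
have nR : 0 < n%:R :> R by rewrite ltr0n.
have pR : 0 < p%:R :> R by rewrite ltr0n.
have kL : 0 <= k * mean_energy n p gam sigma q / n%:R <= 1.
  apply/andP; split; first by rewrite divr_ge0 ?(ltW nR)// mulr_ge0 ?sqrtr_ge0// ltW.
  rewrite ler_pdivrMr// mul1r.
  apply: (@le_trans _ _ (1 / 2 * (2 * n%:R))); last by lra.
  apply: ler_pM => //; rewrite ?sqrtr_ge0 ?(ltW k0)//.
  rewrite /mean_energy gamE -[leRHS]ger0_norm ?mulr_ge0 ?(ltW nR)// -sqrtr_sqr ler_wsqrtr//.
  have -> : (2 * n%:R) ^+ 2 = 4 * n%:R * n%:R :> R by ring.
  by rewrite ler_wpM2r// ltW.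
apply: (le_trans (energy_le_countable _ n0 p0 gam0 sigma0 q0 tau0 hC1 hC2 k01 kL epi)).
by rewrite lee_fin; exact: tail_bound_le.
Qed.

Lemma model_energy_ge : exists A B : R, [/\ 0 <= A, 0 < B &
  forall n p d (Om : measurableType d) (P : probability Om R)
    (x : 'I_n -> 'I_p -> {RV P >-> RT}) (beta0 : 'I_p -> {RV P >-> RT}) (eps : 'I_n -> {RV P >-> RT})
    (tau : R), (0 < n)%N -> (0 < p)%N -> 0 < tau -> delta * p%:R <= 4 * n%:R ->
    gaussian_linear_model P0 (sigma ^+ 2) x beta0 eps ->
    exists S, [/\ measurable S, (P S <= (A * expR (- (B * p%:R)))%:E)%E &
      forall w, ~ S w -> forall m H, entropy_epigraph P0 gam m H ->
        energy_level P0 n p gam sigma q eta <=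
        energy gam sigma q tau (model_matrix (sigma ^+ 2) x beta0 eps w) (beta0 ^~ w) m H]].
Proof.
have [A [B [A0 B0 hAB]]] := energy_tail; exists A, B; split => // n p d Om P x beta0 eps tau n0 p0 tau0 pn model.
(* The dense sequence needs a starting point; with an empty epigraph the claim is vacuous. *)
have [[mh0 E0]|no] := pselect (exists mh : ('I_p -> R) * R, entropy_epigraph P0 gam mh.1 mh.2); last first.
  exists set0; split => //; first by rewrite measure0 lee_fin mulr_ge0// expR_ge0.
  by move=> w _ m H mH; exfalso; apply: no; exists (m, H).
have [e [epi de]] := @countable_dense_sequence R p (fun mh => entropy_epigraph P0 gam mh.1 mh.2) mh0 E0.
have s20 : 0 < sigma ^+ 2 by rewrite exprn_gt0.
have := model_energy_law p0 s20 model gam sigma q tau (energy_level P0 n p gam sigma q eta) e.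
set S := [set w | _] => -[mS PS].
exists S; split => //; first by rewrite PS; exact: hAB.
move=> w nSw m H mH; rewrite leNgt; apply/negP => lt; apply: nSw.
exact: (energy_dense (mh := (m, H)) de mH lt).
Qed.

End energy_tail.

Section tap_lower_bound.
Context {R : realType}.
Local Notation RT := (measurableTypeR R).
Variables (P0 : probability RT R) (n p : nat) (s2 gam q tau c : R).
Hypotheses (p0 : (0 < p)%N) (s20 : 0 < s2) (gam0 : 0 < gam) (tau0 : 0 < tau).
Variables (X : 'M[R]_(n, p)) (b m s : 'cV[R]_p) (eps : 'cV[R]_n)
  (G : 'I_n -> ('I_p + unit)%type -> R).
Hypotheses (Gl : forall i j, G i (inl j) = X i j / Num.sqrt p%:R^-1)
  (Gr : forall i, G i (inr tt) = eps i ord0 / Num.sqrt s2).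
Hypothesis hc : forall m H, entropy_epigraph P0 gam m H ->
  c <= energy gam (Num.sqrt s2) q tau G (b ^~ ord0) m H.

Let q' := p%:R^-1 * \sum_j (m j ord0 - b j ord0) ^+ 2.
Let r := p%:R^-1 * \sum_j (s j ord0 - (m j ord0) ^+ 2).

Lemma neg_entropy_ge l g a t :
  ((- (1 / 2) * g * t + l * a - ln (partition_fun P0 l g))%:E <= neg_entropy P0 a t)%E.
Proof. by apply: ereal_sup_ubound; exists (l, g). Qed.

Lemma residualE i : \sum_j G i j * residual_vec (Num.sqrt s2) (b ^~ ord0) (m ^~ ord0) j =
  (X *m b + eps - X *m m) i ord0.
Proof.
have sp : Num.sqrt p%:R != 0 :> R by rewrite gt_eqF// sqrtr_gt0 ltr0n.
have ss : Num.sqrt s2 != 0 :> R by rewrite gt_eqF// sqrtr_gt0.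
rewrite big_sumType/= (big_pred1 tt); last by case.
rewrite Gr mulfVK//.
rewrite !mxE addrAC -sumrB; congr (_ + _); apply: eq_bigr => j _.
by rewrite Gl sqrtrV ?ler0n//; field.
Qed.

Lemma tap_free_energy_ge : 0 <= r ->
  ((n%:R / 2 * ln (2 * pi * (s2 + r)) + c - penalty n p gam (Num.sqrt s2) * `|q' - q|
    - gam * p%:R * r / 2 - gam * p%:R * s2 / 2 - tau / (2 * s2))%:E
   <= tap_free_energy P0 s2 X (X *m b + eps) m s)%E.
Proof.
move=> r0; rewrite /tap_free_energy.
have pR : 0 < p%:R :> R by rewrite ltr0n.
have nNy j : (neg_entropy P0 (m j ord0) (s j ord0) != -oo)%E.
  apply/eqP => h; have := neg_entropy_ge 0 0 (m j ord0) (s j ord0); rewrite h.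
  by rewrite leeNy_eq.
(* No entropy is [-oo], so a single infinite one makes the whole free energy infinite. *)
have [[j hj]|no] := pselect (exists j, neg_entropy P0 (m j ord0) (s j ord0) = +oo%E).
  rewrite (_ : (\sum_j _)%E = +oo%E); first by rewrite addey// !addye// leey.
  rewrite (bigD1 j)//= hj addye//.
  by apply/eqP => /esum_eqNyP[i [_ _ /eqP]]; rewrite (negbTE (nNy i)).
pose h j := fine (neg_entropy P0 (m j ord0) (s j ord0)).
have hE j : neg_entropy P0 (m j ord0) (s j ord0) = (h j)%:E.
  rewrite /h fineK// fin_numE nNy/=; apply/eqP => hj; by apply: no; exists j.
under [X in (_ + X + _ + _)%E]eq_bigr do rewrite hE.
rewrite sumEFin -!EFinD lee_fin.
(* Restricting the supremum in the entropy to second parameter [gam] shows that this [H] lies above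
   the conjugates at [m]. *)
pose H := \sum_j (h j + gam / 2 * s j ord0).
have mH : entropy_epigraph P0 gam (m ^~ ord0) H.
  move=> l; apply: ler_sum => j _.
  have := neg_entropy_ge (l j) gam (m j ord0) (s j ord0); rewrite hE lee_fin; lra.
have := hc mH; rewrite /energy /tilted_cost.
have -> : overlap_dist (b ^~ ord0) (m ^~ ord0) = q' by [].
under eq_bigr do rewrite residualE.
set a := \sum_i (_ i ord0) ^+ 2.
have a0 : 0 <= a by apply: sumr_ge0 => i _; exact: sqr_ge0.
have Ss : \sum_j s j ord0 = p%:R * r + \sum_j m j ord0 ^+ 2.
  by rewrite /r mulrA divff ?gt_eqF// mul1r sumrB subrK.
have HE : H = \sum_j h j + gam / 2 * (p%:R * r + \sum_j m j ord0 ^+ 2).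
  by rewrite -Ss mulr_sumr -big_split.
have LE : ln (2 * pi * (s2 + r)) = ln (2 * pi * s2) + ln (1 + (p%:R^-1 * \sum_j s j ord0 - p%:R^-1 * \sum_j m j ord0 ^+ 2) / s2).
  rewrite -mulrBr Ss addrK mulKf ?gt_eqF// -lnM ?posrE.
  - by congr ln; field; rewrite gt_eqF.
  - by rewrite !mulr_gt0// pi_gt0.
  - by rewrite ltr_pwDl// divr_ge0// ltW.
rewrite LE HE.
set u := Num.sqrt (a + tau).
have u2 : u ^+ 2 = a + tau by rewrite sqr_sqrtr// addr_ge0// ltW.
have w2 : scale p gam ^+ 2 = gam * p%:R by rewrite sqr_sqrtr// mulr_ge0// ltW.
(* The tangent inequality for the square, at the smoothed norm [u]; the smoothing accounts for the
   loss [tau / (2 * s2)]. *)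
have am : 0 <= (u - scale p gam * s2) ^+ 2 / (2 * s2) by rewrite divr_ge0 ?sqr_ge0// mulr_ge0// ltW.
have amE : (u - scale p gam * s2) ^+ 2 / (2 * s2) =
   1 / (2 * s2) * a + tau / (2 * s2) - scale p gam * u + gam * p%:R * s2 / 2.
  have -> : (u - scale p gam * s2) ^+ 2 = u ^+ 2 - 2 * (scale p gam * u) * s2 + scale p gam ^+ 2 * s2 ^+ 2 by ring.
  by rewrite u2 w2; field; rewrite gt_eqF.
rewrite amE in am.
move: am; set wu := scale p gam * u; set pen := _ * `|_ - _|.
set Q := \sum_j m j ord0 ^+ 2; set Hs := \sum_j h j; set l1 := ln _; set l2 := ln _.
set t := tau / _; set a' := _ * a.
rewrite [n%:R / 2 * (l1 + l2)]mulrDr.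
have -> : \sum_j h j + gam / 2 * (p%:R * r + Q) = Hs + gam * p%:R * r / 2 + gam / 2 * Q by rewrite mulrDr /Hs; field.
set n1 := _ * l1; set n2 := _ * l2; set g1 := gam * p%:R * r / 2; set g2 := gam / 2 * Q; set g3 := gam * p%:R * s2 / 2.
by clear; lra.
Qed.

End tap_lower_bound.

(** * Comparison with the replica-symmetric potential *)

Lemma ln_le_sub1 {R : realType} (x : R) : 0 < x -> ln x <= x - 1.
Proof.
move=> x0; rewrite -ler_expR lnK ?posrE//.
by apply: le_trans (expR_ge1Dx _); rewrite addrC subrK.
Qed.

Section replica_symmetric_gap.
Context {R : realType}.
Variables (delta s2 iota : R).
Hypotheses (delta0 : 0 < delta) (s20 : 0 < s2) (iota0 : 0 < iota).

Lemma ln_gap a b : 0 <= a -> 0 <= b -> ln (s2 + a) - ln (s2 + b) <= `|a - b| / s2.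
Proof.
move=> a0 b0.
have sa : 0 < s2 + a by rewrite ltr_pwDl.
have sb : 0 < s2 + b by rewrite ltr_pwDl.
rewrite -ln_div ?posrE//; apply: (le_trans (ln_le_sub1 _)); first by rewrite divr_gt0.
have -> : (s2 + a) / (s2 + b) - 1 = (a - b) / (s2 + b) by field; rewrite gt_eqF.
apply: (@le_trans _ _ (`|a - b| / (s2 + b))).
  by rewrite ler_wpM2r ?ler_norm// invr_ge0 ltW.
by rewrite ler_wpM2l// lef_pV2 ?posrE// lerDl.
Qed.

(** At [r = q0] this is an equality, because [delta = gam * (q0 + s2)]. Moving [r] away changes the
    logarithm and the linear term by at most half of [delta / s2 * |r - q0|] each. *)
Lemma rs_potential_gap gam q0 r : 0 <= q0 -> 0 <= r -> gam = delta / (q0 + s2) ->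
  s2 * gam / 2 - delta / 2 * ln (gam / (2 * pi * delta)) - delta / s2 * `|r - q0| <=
  delta / 2 * ln (2 * pi * (s2 + r)) + delta - gam * q0 / 2 - gam * r / 2 - gam * s2 / 2.
Proof.
move=> q00 r0 gamE.
have sq : 0 < q0 + s2 by rewrite ltr_wpDl.
have sr : 0 < s2 + r by rewrite ltr_pwDl.
have pi0 : 0 < 2 * pi :> R by rewrite mulr_gt0// pi_gt0.
have gs : gam * (q0 + s2) = delta by rewrite gamE mulfVK// gt_eqF.
have gam0 : 0 < gam by rewrite gamE divr_gt0.
have -> : ln (gam / (2 * pi * delta)) = - (ln (2 * pi) + ln (s2 + q0)).
  have <- : ln ((2 * pi * (q0 + s2))^-1) = - (ln (2 * pi) + ln (s2 + q0)).
    have lE : ln (2 * pi * (q0 + s2)) = ln (2 * pi) + ln (s2 + q0).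
      by rewrite (lnM (x := 2 * pi)) ?posrE// (addrC q0).
    by rewrite -lE lnV// posrE mulr_gt0.
  have aux (u v w : R) : 0 < u -> 0 < v -> 0 < w -> w / v / (u * w) = (u * v)^-1.
    by move=> u0 v0 w0; field; rewrite !gt_eqF.
  by rewrite gamE aux.
have -> : ln (2 * pi * (s2 + r)) = ln (2 * pi) + ln (s2 + r) by rewrite (lnM (x := 2 * pi)) ?posrE.
have h1 := ln_gap q00 r0.
have gle : gam <= delta / s2 by rewrite ler_pdivlMr// -gs ler_wpM2l ?(ltW gam0)// lerDr.
have h2 : gam * (r - q0) <= delta / s2 * `|r - q0|.
  apply: (@le_trans _ _ (gam * `|r - q0|)); first by rewrite ler_wpM2l ?ler_norm// ltW.
  by rewrite ler_wpM2r.
have h3 := ler_wpM2l (ltW delta0) h1.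
have DE : delta * (`|q0 - r| / s2) = delta / s2 * `|r - q0| by rewrite (distrC q0); ring.
rewrite DE in h3.
set D := delta / s2 * _ in h2 h3 *.
have e1 : delta / 2 * - (ln (2 * pi) + ln (s2 + q0)) = - (delta / 2 * ln (2 * pi) + delta * ln (s2 + q0) / 2) by field.
have e2 : delta / 2 * (ln (2 * pi) + ln (s2 + r)) = delta / 2 * ln (2 * pi) + delta * ln (s2 + r) / 2 by field.
rewrite e1 e2; move: h2 h3 gs; rewrite !mulrBr mulrDr.
have -> : s2 * gam = gam * s2 by ring.
set y1 := delta * ln (s2 + q0); set y2 := delta * ln (s2 + r); set y3 := _ * ln _.
set z1 := gam * q0; set z2 := gam * r; set z3 := gam * s2.
by clear; lra.
Qed.

(** The denominator adds the slope of [rs_potential_gap] and the bound of [penalty_le] on the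
    penalty per coordinate, so that together they cost [iota / 8] on a cell. *)
Definition net_width : R :=
  iota / 8 / (delta / s2 + (delta / s2 + Num.sqrt (2 * delta ^+ 2 / s2) / Num.sqrt s2)).

Let width_denom : R := delta / s2 + (delta / s2 + Num.sqrt (2 * delta ^+ 2 / s2) / Num.sqrt s2).

Let width_denom0 : 0 < width_denom.
Proof. by rewrite addr_gt0 ?divr_gt0// ltr_pwDl ?divr_gt0// divr_ge0 ?sqrtr_ge0. Qed.

Lemma net_width_gt0 : 0 < net_width.
Proof. by rewrite divr_gt0 ?divr_gt0. Qed.

Lemma penalty_le n p gam : (0 < p)%N -> 0 < gam -> gam <= delta / s2 -> n%:R / p%:R <= 2 * delta ->
  p%:R^-1 * penalty n p gam (Num.sqrt s2) <= delta / s2 + Num.sqrt (2 * delta ^+ 2 / s2) / Num.sqrt s2.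
Proof.
move=> p0 gam0 gle np.
have pR : 0 < p%:R :> R by rewrite ltr0n.
rewrite /penalty mulrDr.
have -> : p%:R^-1 * (gam * p%:R / 2) = gam / 2 by field; rewrite gt_eqF.
apply: lerD; first by apply: le_trans gle; rewrite ler_pdivrMr// ler_pMr// ler1n.
rewrite mulrA ler_wpM2r ?invr_ge0 ?sqrtr_ge0//.
rewrite -[p%:R^-1]ger0_norm ?invr_ge0 ?(ltW pR)// -sqrtr_sqr -sqrtrM ?sqr_ge0// ler_wsqrtr//.
have -> : p%:R^-1 ^+ 2 * (gam * p%:R * n%:R) = gam * (n%:R / p%:R) by field; rewrite gt_eqF.
have -> : 2 * delta ^+ 2 / s2 = delta / s2 * (2 * delta) by ring.
by apply: ler_pM => //; exact: ltW.
Qed.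

(** The budget: [iota / 8] each for the deviation, for [tau], and for the net; [iota / 4] for
    [|q - r|]; [iota / 16] each for the logarithm and for the mean energy when [n / p] replaces
    [delta]. The total is below [iota]. *)
Lemma tap_level_ge (P0 : probability (measurableTypeR R) R) n p gam q0 q r Lam :
  let tau := p%:R * s2 * iota / 4 in
  (0 < p)%N -> 0 <= q0 -> 0 <= r -> gam = delta / (q0 + s2) ->
  `|q - q0| <= net_width -> `|q - r| <= iota * s2 / (4 * delta) ->
  `|ln (2 * pi * (s2 + r))| <= Lam ->
  n%:R / p%:R <= 2 * delta -> `|n%:R / p%:R - delta| * Lam <= iota / 8 ->
  delta - iota / 16 <= Num.sqrt (delta * (n%:R / p%:R)) ->
  s2 * gam / 2 - delta / 2 * ln (gam / (2 * pi * delta)) + mean_infodens P0 gam - iota <=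
  p%:R^-1 * (n%:R / 2 * ln (2 * pi * (s2 + r)) + energy_level P0 n p gam (Num.sqrt s2) q0 (iota / 8)
    - penalty n p gam (Num.sqrt s2) * `|q - q0|
    - gam * p%:R * r / 2 - gam * p%:R * s2 / 2 - tau / (2 * s2)).
Proof.
move=> tau p0 q00 r0 gamE hq hqr hL np hx hs.
have pR : 0 < p%:R :> R by rewrite ltr0n.
have sq : 0 < q0 + s2 by rewrite ltr_wpDl.
have gs : gam * (q0 + s2) = delta by rewrite gamE mulfVK// gt_eqF.
have gam0 : 0 < gam by rewrite gamE divr_gt0.
have gle : gam <= delta / s2 by rewrite ler_pdivlMr// -gs ler_wpM2l ?(ltW gam0)// lerDr.
have gap := rs_potential_gap q00 r0 gamE.
have pen := penalty_le p0 gam0 gle np.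
have w0 := net_width_gt0.
have penw : p%:R^-1 * penalty n p gam (Num.sqrt s2) * `|q - q0| + delta / s2 * `|q - q0| <= iota / 8.
  apply: (@le_trans _ _ (width_denom * net_width)).
    rewrite -mulrDl; apply: ler_pM => //.
      rewrite addr_ge0 ?divr_ge0 ?(ltW delta0) ?(ltW s20)// mulr_ge0 ?invr_ge0 ?(ltW pR)//.
      rewrite addr_ge0 ?divr_ge0 ?sqrtr_ge0// ?mulr_ge0// ltW//.
    by rewrite /width_denom addrC lerD2l.
  by rewrite /net_width mulrC divfK// gt_eqF.
have tri : delta / s2 * `|r - q0| <= iota / 4 + delta / s2 * `|q - q0|.
  apply: (@le_trans _ _ (delta / s2 * (`|q - r| + `|q - q0|))).
    rewrite ler_wpM2l ?divr_ge0 ?(ltW delta0) ?(ltW s20)//.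
    have -> : r - q0 = - (q - r) + (q - q0) by ring.
    by rewrite (le_trans (ler_normD _ _))// normrN.
  rewrite mulrDr lerD2r.
  apply: (@le_trans _ _ (delta / s2 * (iota * s2 / (4 * delta)))).
    by rewrite ler_wpM2l ?divr_ge0 ?(ltW delta0) ?(ltW s20).
  by rewrite le_eqVlt; apply/orP; left; apply/eqP; field; rewrite !gt_eqF.
have lnb : (delta / 2 - n%:R / p%:R / 2) * ln (2 * pi * (s2 + r)) <= iota / 16.
  apply: (le_trans (ler_norm _)); rewrite normrM.
  have -> : delta / 2 - n%:R / p%:R / 2 = - ((n%:R / p%:R - delta) / 2) by field; rewrite gt_eqF.
  rewrite normrN normrM (ger0_norm (_ : 0 <= 2^-1 :> R))// mulrAC.
  apply: (@le_trans _ _ (iota / 8 / 2)); last by lra.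
  rewrite ler_wpM2r//; apply: le_trans hx; by rewrite ler_wpM2l.
have LE : p%:R^-1 * mean_energy n p gam (Num.sqrt s2) q0 = Num.sqrt (delta * (n%:R / p%:R)).
  rewrite /mean_energy sqr_sqrtr ?(ltW s20)// gs.
  rewrite -[X in X * _ = _]ger0_norm ?invr_ge0 ?(ltW pR)// -sqrtr_sqr -sqrtrM ?sqr_ge0//.
  by congr (Num.sqrt _); field; rewrite gt_eqF.
rewrite /energy_level.
have -> : p%:R^-1 * (n%:R / 2 * ln (2 * pi * (s2 + r)) +
   (mean_energy n p gam (Num.sqrt s2) q0 - gam * p%:R * q0 / 2 + p%:R * mean_infodens P0 gam - p%:R * (iota / 8)) -
   penalty n p gam (Num.sqrt s2) * `|q - q0| - gam * p%:R * r / 2 - gam * p%:R * s2 / 2 - tau / (2 * s2)) =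
  n%:R / p%:R / 2 * ln (2 * pi * (s2 + r)) + p%:R^-1 * mean_energy n p gam (Num.sqrt s2) q0
   - gam * q0 / 2 + mean_infodens P0 gam - iota / 8 - p%:R^-1 * penalty n p gam (Num.sqrt s2) * `|q - q0|
   - gam * r / 2 - gam * s2 / 2 - iota / 8.
  rewrite /tau; set X1 := mean_energy _ _ _ _ _; set X2 := mean_infodens _ _; set X3 := penalty _ _ _ _.
  set X4 := ln _; set X5 := `|_|.
  by field; rewrite !gt_eqF.
rewrite LE; move: gap hs penw tri lnb; rewrite mulrBl.
set Y1 := Num.sqrt (delta * _); set Y2 := mean_infodens _ _; set Y3 := _ * penalty _ _ _ _ * _.
set Y4 := delta / s2 * `|q - q0|; set Y5 := delta / s2 * `|r - q0|.
set Y6 := delta / 2 * ln (gam / _); set Y7 := delta / 2 * ln _; set Y8 := _ / 2 * ln _.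
set Z1 := s2 * gam; set Z2 := gam * q0; set Z3 := gam * r; set Z4 := gam * s2.
by move: iota0; clear; lra.
Qed.

End replica_symmetric_gap.

(** * Finite nets, union bound and high probability *)

Lemma measure_bigsetU_le {R : realType} d (T : measurableType d) (mu : {measure set T -> \bar R})
    (S : nat -> set T) (N : nat) : (forall j, measurable (S j)) ->
  (mu (\big[setU/set0]_(j < N) S j) <= \sum_(j < N) mu (S j))%E.
Proof.
move=> mS; elim: N => [|N IH]; first by rewrite !big_ord0 measure0.
rewrite !big_ord_recr/=; apply: (le_trans (measureU2 _ _ _)) => //.
  exact: bigsetU_measurable.
exact: leeD2r.
Qed.

(** Only first coordinates are discretised, by the integer part of [q / h]. The representatives must
    lie in [K] itself, since the potential there is compared with the infimum over [K]. *)
Lemma cell_representatives {R : realType} (K : set (R * R)) (B h : R) (k0 : R * R) : K k0 -> 0 < h ->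
  (forall qr, K qr -> 0 <= qr.1 <= B) ->
  exists (N : nat) (f : nat -> R * R), (forall j, K (f j)) /\
    forall qr, K qr -> exists2 j, (j < N)%N & `|qr.1 - (f j).1| <= h.
Proof.
move=> Kk0 h0 KB.
have pick (j : nat) : exists x, K x /\ forall x', K x' -> Num.truncn (x'.1 / h) = j -> Num.truncn (x.1 / h) = j.
  have [[x [Kx xj]]|no] := pselect (exists x, K x /\ Num.truncn (x.1 / h) = j); first by exists x.
  by exists k0; split => // x' Kx' x'j; exfalso; apply: no; exists x'.
have [f fP] := choice pick.
exists (Num.truncn (B / h)).+1, f; split => [j|qr Kqr]; first by case: (fP j).
have /andP[q0 qB] := KB _ Kqr.
exists (Num.truncn (qr.1 / h)).
  by rewrite ltnS le_truncn// ler_wpM2r// invr_ge0 ltW.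
have [Kf /(_ _ Kqr erefl) fj] := fP (Num.truncn (qr.1 / h)).
have /andP[f0 _] := KB _ Kf.
have := @truncn_itv R (qr.1 / h); rewrite divr_ge0 ?(ltW h0)// => /(_ isT)/andP[a1 a2].
have := @truncn_itv R ((f (Num.truncn (qr.1 / h))).1 / h); rewrite fj divr_ge0 ?(ltW h0)// => /(_ isT)/andP[b1 b2].
have : `|qr.1 / h - (f (Num.truncn (qr.1 / h))).1 / h| <= 1.
  by move: a1 a2 b1 b2; rewrite -natr1 ler_norml; set x := qr.1 / h; set y := _ / h; set z := _%:R; clear; lra.
by rewrite -mulrBl normrM [X in _ * X]gtr0_norm ?invr_gt0// ler_pdivrMr// mul1r.
Qed.

Section lower_bound_event.
Context {R : realType}.
Local Notation RT := (measurableTypeR R).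
Variables (P0 : probability RT R) (delta s2 iota M Lam : R) (K : set (R * R)) (N : nat)
  (f : nat -> R * R) (A B : nat -> R).
Hypotheses (delta0 : 0 < delta) (s20 : 0 < s2) (iota0 : 0 < iota) (M0 : 0 <= M)
  (hM : {ae P0, forall b, `|b| <= M}).
Hypotheses (K0 : forall qr, K qr -> 0 <= qr.1 /\ 0 <= qr.2)
  (Kdiff : forall qr, K qr -> `|qr.1 - qr.2| <= iota * s2 / (4 * delta))
  (KL : forall qr, K qr -> `|ln (2 * pi * (s2 + qr.2))| <= Lam)
  (fK : forall j, K (f j))
  (fnet : forall qr, K qr -> exists2 j, (j < N)%N & `|qr.1 - (f j).1| <= net_width delta s2 iota).
Local Notation gam j := (delta / ((f j).1 + s2)).
Hypothesis hAB : forall j n p d (Om : measurableType d) (P : probability Om R)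
    (x : 'I_n -> 'I_p -> {RV P >-> RT}) (beta0 : 'I_p -> {RV P >-> RT}) (eps : 'I_n -> {RV P >-> RT})
    (tau : R), (0 < n)%N -> (0 < p)%N -> 0 < tau -> delta * p%:R <= 4 * n%:R ->
    gaussian_linear_model P0 s2 x beta0 eps ->
    exists S, [/\ measurable S, (P S <= (A j * expR (- (B j * p%:R)))%:E)%E &
      forall w, ~ S w -> forall m H, entropy_epigraph P0 (gam j) m H ->
        energy_level P0 n p (gam j) (Num.sqrt s2) (f j).1 (iota / 8) <=
        energy (gam j) (Num.sqrt s2) (f j).1 tau (model_matrix s2 x beta0 eps w) (beta0 ^~ w) m H].

Lemma lower_bound_event n p d (Om : measurableType d) (P : probability Om R)
    (x : 'I_n -> 'I_p -> {RV P >-> RT}) (beta0 : 'I_p -> {RV P >-> RT}) (eps : 'I_n -> {RV P >-> RT}) :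
  (0 < n)%N -> (0 < p)%N -> delta * p%:R <= 4 * n%:R -> n%:R / p%:R <= 2 * delta ->
  `|n%:R / p%:R - delta| * Lam <= iota / 8 ->
  delta - iota / 16 <= Num.sqrt (delta * (n%:R / p%:R)) ->
  gaussian_linear_model P0 s2 x beta0 eps ->
  exists S, [/\ measurable S, (P S <= (\sum_(j < N) A j * expR (- (B j * p%:R)))%:E)%E &
    forall w, ~ S w ->
    (ereal_inf [set ((p%:R^-1)%:E *
                     tap_free_energy P0 s2 (design x w) (response x beta0 eps w) ms.1 ms.2)%E
                | ms in tap_domain P0 (signal beta0 w) K]
     >= ereal_inf [set rs_potential P0 delta s2 (delta / (qr.1 + s2)) | qr in K] - iota%:E)%E].
Proof.
move=> n0 p0 pn np hx hs model.
have pR : 0 < p%:R :> R by rewrite ltr0n.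
pose tau := p%:R * s2 * iota / 4.
have tau0 : 0 < tau by rewrite divr_gt0// !mulr_gt0.
have [S SP] := choice (fun j => hAB j n0 p0 tau0 pn model).
have mS j : measurable (S j) by case: (SP j).
exists (\big[setU/set0]_(j < N) S j); split.
- exact: bigsetU_measurable.
- apply: (le_trans (measure_bigsetU_le P N mS)); rewrite -sumEFin; apply: lee_sum => j _.
  by case: (SP j).
move=> w nSw; apply: le_ereal_inf_tmp => _ [[m s] [_ /= Kms] <-].
set q := p%:R^-1 * _ in Kms; set r := p%:R^-1 * _ in Kms.
have [j jN hj] := fnet Kms.
have [q00 _] := K0 (fK j); have [_ r0] := K0 Kms.
have nSj : ~ S j w.
  by move=> Sj; apply: nSw; rewrite -bigcup_mkord; exists j.
have [_ _ /(_ w nSj) hE] := SP j.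
have gam0 : 0 < gam j by rewrite divr_gt0// ltr_wpDl.
have F := @tap_free_energy_ge R P0 n p s2 (gam j) (f j).1 tau _ p0 s20 gam0 tau0
  (design x w) (signal beta0 w) m s (noise eps w) (model_matrix s2 x beta0 eps w).
have bE : (fun i => signal beta0 w i ord0) = beta0 ^~ w.
  by apply/funext => i; rewrite mxE.
have {}F := F (energy_level P0 n p (gam j) (Num.sqrt s2) (f j).1 (iota / 8)).
have {}F := F _ _ _ r0.
(* The infimum over [K] is at most the potential at the representative [f j]. *)
apply: (@le_trans _ _ ((s2 * gam j / 2 - delta / 2 * ln (gam j / (2 * pi * delta)) + mean_infodens P0 (gam j) - iota)%:E)).
  rewrite EFinB; apply: leeD2r; apply: ereal_inf_lbound; exists (f j) => //.
  by rewrite /rs_potential (channel_mutual_infoE gam0 M0 hM) -EFinD.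
apply: (@le_trans _ _ ((p%:R^-1)%:E * (n%:R / 2 * ln (2 * pi * (s2 + r))
   + energy_level P0 n p (gam j) (Num.sqrt s2) (f j).1 (iota / 8)
    - penalty n p (gam j) (Num.sqrt s2) * `|q - (f j).1|
    - gam j * p%:R * r / 2 - gam j * p%:R * s2 / 2 - tau / (2 * s2))%:E)%E).
  rewrite -EFinM lee_fin.
  exact: (tap_level_ge delta0 s20 iota0 P0 p0 q00 r0 erefl hj (Kdiff Kms) (KL Kms) np hx hs).
apply: lee_wpmul2l; first by rewrite lee_fin invr_ge0 ltW.
apply: F.
- by move=> i j'; rewrite /model_matrix /standardized /= mxE.
- by move=> i; rewrite /model_matrix /standardized /= mxE.
- by move=> m' H' mH; rewrite bE; exact: hE.
Qed.

End lower_bound_event.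

Lemma whp_of_tail {R : realType} d (Om : forall k, measurableType (d k))
    (P : forall k, probability (Om k) R) (E : forall k, set (Om k)) (b : nat -> R) :
  b @ \oo --> 0 ->
  (\forall k \near \oo, exists S, [/\ measurable S, (P k S <= (b k)%:E)%E & ~` S `<=` E k]) ->
  whp P E.
Proof.
move=> b0 nS.
(* [whp] wants a measurable inner set for every [k]: the complement of [S] where the bound is
   available, and the empty set for the other indices. *)
have pick k : exists A, (measurable A /\ A `<=` E k) /\
    ((exists S, [/\ measurable S, (P k S <= (b k)%:E)%E & ~` S `<=` E k]) -> ((1 - b k)%:E <= P k A)%E).
  have [[S [mS PS SE]]|no] := pselect (exists S, [/\ measurable S, (P k S <= (b k)%:E)%E & ~` S `<=` E k]); last first.
    by exists set0; split; [split|move=> /no].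
  exists (~` S); split; first by split => //; exact: measurableC.
  move=> _; rewrite EFinB leeBlDr//; apply: (le_trans _ (leeD2l _ PS)).
  rewrite -(probability_setT (P k)) -(setvU S); apply: measureU2 => //; exact: measurableC.
have [A AP] : {A : forall k, set (Om k) | forall k, (measurable (A k) /\ A k `<=` E k) /\
    ((exists S, [/\ measurable S, (P k S <= (b k)%:E)%E & ~` S `<=` E k]) -> ((1 - b k)%:E <= P k (A k))%E)}.
  by exists (fun k => sval (cid (pick k))) => k; exact: (svalP (cid (pick k))).
exists A; split; first by move=> k; case: (AP k).
have lb : (1 - b k)%:E @[k --> \oo] --> 1%E.
  apply: cvg_EFin; first exact: nearW.
  rewrite -[X in _ --> X]subr0; apply: cvgB => //; exact: cvg_cst.
apply: (squeeze_cvge _ lb (cvg_cst 1%E)).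
near=> k; have [[mA _] h] := AP k.
rewrite probability_le1 ?andbT//; apply: h; by near: k.
Unshelve. all: by end_near. Qed.

Theorem mainTheorem9 (R : realType) (delta s2 iota : R) :
  0 < delta -> 0 < s2 -> 0 < iota ->
  exists2 epsilon : R, 0 < epsilon &
  forall (P0 : probability (measurableTypeR R) R),
  compact (measure_support P0) ->
  (exists a b c : R, [/\ measure_support P0 a, measure_support P0 b
     & measure_support P0 c] /\ [/\ a != b, b != c & a != c]) ->
  forall K : set (R * R),
  K `<=` [set qr | 0 <= qr.1 /\ 0 <= qr.2] ->
  compact K ->
  (ereal_sup [set `|qr.1 - qr.2|%:E | qr in K] <= epsilon%:E)%E ->
  forall (n p : nat -> nat),
  n k @[k --> \oo] --> \oo ->
  p k @[k --> \oo] --> \oo ->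
  (n k)%:R / (p k)%:R @[k --> \oo] --> delta ->
  forall (d : nat -> measure_display) (Om : forall k, measurableType (d k))
    (P : forall k, probability (Om k) R)
    (x : forall k, 'I_(n k) -> 'I_(p k) -> {RV (P k) >-> measurableTypeR R})
    (beta0 : forall k, 'I_(p k) -> {RV (P k) >-> measurableTypeR R})
    (eps : forall k, 'I_(n k) -> {RV (P k) >-> measurableTypeR R}),
  (forall k, gaussian_linear_model P0 s2 (x k) (beta0 k) (eps k)) ->
  whp P (fun k => [set w |
    (ereal_inf [set (((p k)%:R^-1)%:E *
                     tap_free_energy P0 s2 (design (x k) w)
                       (response (x k) (beta0 k) (eps k) w) ms.1 ms.2)%E
                | ms in tap_domain P0 (signal (beta0 k) w) K]
     >= ereal_inf [set rs_potential P0 delta s2 (delta / (qr.1 + s2))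
                  | qr in K] - iota%:E)%E]).
Proof.
(* Chosen so that the loss [delta / s2 * |q - r|] is at most [iota / 4]; it is fixed before [P0] and
   [K]. *)
move=> delta0 s20 iota0; exists (iota * s2 / (4 * delta)); first by rewrite divr_gt0 ?mulr_gt0.
move=> P0 cP0 _ K K0 cK Ksup n p noo poo npd d Om P x beta0 eps model.
(* For empty [K] the infimum of the free energy is [+oo] and the claim is trivial; otherwise [k0]
   seeds the net. *)
have [Ke|/set0P[k0 Kk0]] := eqVneq K set0.
  exists (fun=> setT); split; last by under eq_fun do rewrite probability_setT; exact: cvg_cst.
  move=> k; split => // w _ /=; rewrite (_ : tap_domain _ _ _ = set0) ?image_set0 ?ereal_inf0 ?leey//.
  by rewrite Ke; apply/seteqP; split => // ms [].
have [M M0 hM] := compact_support_bounded cP0.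
have /pinfty_ex_gt0[B B0 hB] := compact_bounded cK.
have KB qr : K qr -> 0 <= qr.1 <= B /\ 0 <= qr.2 <= B.
  move=> Kqr; have [q0 r0] := K0 _ Kqr.
  have := hB _ Kqr; rewrite /= prod_normE ge_max => /andP[h1 h2].
  by rewrite q0 r0 (le_trans (ler_norm _) h1) (le_trans (ler_norm _) h2).
have Kdiff qr : K qr -> `|qr.1 - qr.2| <= iota * s2 / (4 * delta).
  by move=> Kqr; rewrite -lee_fin; apply: le_trans Ksup; apply: ereal_sup_ubound; exists qr.
(* A bound of the logarithm for [r] in [0, B], by monotonicity; it controls the error made in
   replacing [n / p] by [delta], uniformly over [K]. *)
pose Lam := `|ln (2 * pi * s2)| + `|ln (2 * pi * (s2 + B))|.
have pi20 : 0 < 2 * pi :> R by rewrite mulr_gt0// pi_gt0.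
have mono (a b : R) : 0 < a -> a <= b -> ln (2 * pi * a) <= ln (2 * pi * b).
  move=> a0 ab; have b0 := lt_le_trans a0 ab.
  by rewrite ler_ln ?posrE; [exact: ler_wpM2l (ltW pi20) _ _ ab|exact: mulr_gt0|exact: mulr_gt0].
have KL qr : K qr -> `|ln (2 * pi * (s2 + qr.2))| <= Lam.
  move=> /KB[_ /andP[r0 rB]].
  have sr : 0 < s2 + qr.2 by rewrite ltr_pwDl.
  have h1 : ln (2 * pi * s2) <= ln (2 * pi * (s2 + qr.2)).
    by apply: mono => //; rewrite lerDl.
  have h2 : ln (2 * pi * (s2 + qr.2)) <= ln (2 * pi * (s2 + B)).
    by apply: mono => //; rewrite lerD2l.
  have n1 := ler_norm (- ln (2 * pi * s2)); rewrite normrN in n1.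
  have n2 := ler_norm (ln (2 * pi * (s2 + B))).
  have n3 := normr_ge0 (ln (2 * pi * s2)); have n4 := normr_ge0 (ln (2 * pi * (s2 + B))).
  by rewrite ler_norml /Lam; apply/andP; split; lra.
have [N [f [fK fnet]]] := cell_representatives Kk0 (net_width_gt0 delta0 s20 iota0) (fun qr Kqr => (KB _ Kqr).1).
have sg0 : 0 < Num.sqrt s2 by rewrite sqrtr_gt0.
have sg2 : Num.sqrt s2 ^+ 2 = s2 by rewrite sqr_sqrtr// ltW.
pose gam j := delta / ((f j).1 + s2).
have q0 j : 0 <= (f j).1 by case: (K0 _ (fK j)).
have qs j : 0 < (f j).1 + s2 by rewrite ltr_wpDl.
have gam0 j : 0 < gam j by rewrite divr_gt0.
have gamE j : gam j * ((f j).1 + Num.sqrt s2 ^+ 2) = delta by rewrite sg2 mulfVK// gt_eqF.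
have iota8 : 0 < iota / 8 by rewrite divr_gt0.
have tails j := model_energy_ge (gam0 j) sg0 (q0 j) iota8 (gamE j) M0 hM.
rewrite sg2 in tails.
have [A {}tails] := choice tails; have {tails}[T tails] := choice tails.
have T0 j : 0 < T j by case: (tails j).
apply: (@whp_of_tail _ _ _ _ _ (fun k => \sum_(j < N) A j * expR (- (T j * (p k)%:R)))).
  rewrite [X in _ --> X](_ : 0 = \sum_(j < N) A j * 0); last by rewrite big1// => j _; rewrite mulr0.
  apply: cvg_bigsum => j; apply: cvgM; first exact: cvg_cst.
  have Tp : T j * (p k)%:R @[k --> \oo] --> +oo.
    apply/cvgryPge => a.
    have /cvgryPge/(_ (a / T j)) : (p i)%:R @[i --> \oo] --> (+oo : set_system R) by apply/cvgrnyP.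
    by apply: filterS => i; rewrite ler_pdivrMr// mulrC.
  exact: (cvg_comp _ _ Tp (@cvgr_expR R)).
pose rat_np k : R := (n k)%:R / (p k)%:R.
have rd : rat_np @ \oo --> delta by exact: npd.
have Lam0 : 0 <= Lam by rewrite addr_ge0.
have cs : Num.sqrt (delta * ((n k)%:R / (p k)%:R)) @[k --> \oo] --> delta.
  rewrite [X in _ --> X](_ : delta = Num.sqrt (delta * delta)); last first.
    by rewrite -expr2 sqrtr_sqr gtr0_norm.
  apply: (@cvg_comp _ _ _ _ Num.sqrt); last exact: sqrt_continuous.
  by apply: cvgM => //; exact: cvg_cst.
have e1 : \forall k \near \oo, (n k)%:R / (p k)%:R <= 2 * delta.
  by apply: (cvgr_le _ rd); rewrite ltr_pMl// ltr1n.
have e2 : \forall k \near \oo, delta / 4 <= (n k)%:R / (p k)%:R.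
  by apply: (cvgr_ge _ rd); rewrite ltr_pdivrMr// ltr_pMr// ltr1n.
(* [Lam + 1] avoids a division by zero, [Lam] being only nonnegative. *)
have e3 : \forall k \near \oo, `|delta - (n k)%:R / (p k)%:R| <= iota / 8 / (Lam + 1).
  by move/cvgrPdist_le : rd; apply; rewrite divr_gt0// ltr_wpDl.
have e4 : \forall k \near \oo, delta - iota / 16 <= Num.sqrt (delta * ((n k)%:R / (p k)%:R)).
  by apply: (cvgr_ge _ cs); rewrite ltrBlDr ltrDl divr_gt0.
near=> k.
have n0 : (0 < n k)%N by near: k; move/cvgnyPgt : noo; exact.
have p0 : (0 < p k)%N by near: k; move/cvgnyPgt : poo; exact.
have pR : 0 < (p k)%:R :> R by rewrite ltr0n.
have np : (n k)%:R / (p k)%:R <= 2 * delta by near: k.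
have pn : delta * (p k)%:R <= 4 * (n k)%:R.
  have : delta / 4 <= (n k)%:R / (p k)%:R by near: k.
  by rewrite ler_pdivlMr// mulrAC ler_pdivrMr// [leRHS]mulrC.
have hx : `|(n k)%:R / (p k)%:R - delta| * Lam <= iota / 8.
  have h : `|delta - (n k)%:R / (p k)%:R| <= iota / 8 / (Lam + 1) by near: k.
  rewrite distrC; apply: (@le_trans _ _ (iota / 8 / (Lam + 1) * (Lam + 1))).
    by apply: ler_pM => //; rewrite lerDl.
  by rewrite divfK// gt_eqF// ltr_wpDl.
have hs : delta - iota / 16 <= Num.sqrt (delta * ((n k)%:R / (p k)%:R)) by near: k.
have hAB j := (let: And3 _ _ h := tails j in h).
have [S [mS PS SE]] := lower_bound_event delta0 s20 iota0 M0 hM K0 Kdiff KL fK fnet hAB n0 p0 pn np hx hs (model k).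
by exists S; split.
Unshelve. all: by end_near. Qed.
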